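(* Let $\tau,\widetilde\tau\in\mathbb{C}$ have positive imaginary parts, and let $\Sigma=\mathbb{C}/(\mathbb{Z}+\mathbb{Z}\tau)$ and $\widetilde\Sigma=\mathbb{C}/(\mathbb{Z}+\mathbb{Z}\widetilde\tau)$. Let $X$ (resp. $Y$) be the total space of a holomorphic vector bundle $E$ (resp. $\widetilde E$) of rank $2$ and degree $0$ over $\Sigma$ (resp. $\widetilde\Sigma$). If $X$ is biholomorphic to $Y$, then $\Sigma$ and $\widetilde\Sigma$ are isomorphic, and $E$ is holomorphically bundle isomorphic to $\widetilde E$.
   Context: Here a (holomorphic) bundle isomorphism between $E\to\Sigma$ and $\widetilde E\to\widetilde\Sigma$ is a biholomorphism of total spaces that covers some biholomorphism $\Sigma\to\widetilde\Sigma$ of the base curves (not necessarily the identity when $\Sigma=\widetilde\Sigma$) and is linear on the fibres. *)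

(* Defs.v *)
From HB Require Import structures.
From mathcomp Require Import all_boot all_order all_algebra.
From mathcomp Require Import all_classical all_reals all_analysis.
From mathcomp Require Import complex ring_quotient.
Set Implicit Arguments.
Unset Strict Implicit.
Unset Printing Implicit Defensive.
Import Order.TTheory GRing.Theory Num.Theory.
Import numFieldNormedType.Exports.
Local Open Scope classical_set_scope.
Local Open Scope ring_scope.

(* R[i] packed so that the norm topology of a numClosedFieldType applies.
   [differentiable] between normed modules over Cx R is complex Frechet
   differentiability, so near a point it means holomorphic. *)
Definition Cx (R : realType) : numClosedFieldType := R[i].

(* A chart is injective on cdom with inverse cinv there; the values of cmap
   outside cdom, and of cinv outside cmap @` cdom, are irrelevant. *)
Record chart (K : numFieldType) (V : normedModType K) (M : choiceType) := Chart {
  cdom : set M ;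
  cmap :> M -> V ;
  cinv : V -> M ;
  chartK : forall p, cdom p -> cinv (cmap p) = p }.

Lemma cmap_imageI (K : numFieldType) (V : normedModType K) (M : choiceType) (a : chart V M) (A A' : set M) :
  A `<=` cdom a -> A' `<=` cdom a -> a @` (A `&` A') = a @` A `&` a @` A'.
Proof.
move=> Aa A'a; apply/seteqP; split=> [_ [p [Ap A'p] <-]|z].
  by split; exists p.
case=> -[p Ap <-] [q A'q /(congr1 (cinv a))].
rewrite !chartK; [|exact: Aa|exact: A'a] => qp.
by exists p => //; split=> //; rewrite -qp.
Qed.

Lemma near_eq_differentiable (K : numFieldType) (V W : normedModType K)
    (f g : V -> W) (x : V) :
  (\forall z \near x, f z = g z) -> differentiable g x -> differentiable f x.
Proof.
move=> fg dg; have [cdg /eqaddoP eg] := (diff_locallyP x g).1 dg.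
have fgx : f x = g x by exact: nbhs_singleton fg.
suff dE : f \o shift x = cst (f x) + 'd g x +o_ 0 id.
  by apply/diff_locallyP; rewrite (diff_unique cdg dE).
apply/eqaddoP => e e0; have := eg e e0.
have fg0 : \forall z \near 0, f (z + x) = g (z + x).
  by move: fg; rewrite (near_shift 0) /=; apply: filterS => z /=; rewrite subr0.
apply: filterS2 fg0 => z /= fgz.
by rewrite /= !fctE /= fgz fgx.
Qed.

Lemma differentiable_mx (K : numFieldType) (V : normedModType K) m n
    (f : V -> 'M[K]_(m, n)) (x : V) :
  (forall i j, differentiable (fun z => f z i j) x) -> differentiable f x.
Proof.
move=> df.
have -> : f = \sum_(i < m) \sum_(j < n) (fun z => f z i j *: delta_mx i j).
  apply/funext => z; rewrite fct_sumE [LHS]matrix_sum_delta.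
  by apply: eq_bigr => i _; rewrite fct_sumE.
apply: differentiable_sum => i; apply: differentiable_sum => j.
exact: differentiableZl.
Qed.

Lemma differentiable_mulmx (K : numFieldType) (V : normedModType K) m n p
    (f : V -> 'M[K]_(m, n)) (g : V -> 'M[K]_(n, p)) (x : V) :
  differentiable f x -> differentiable g x ->
  differentiable (fun z => f z *m g z) x.
Proof.
move=> df dg; apply: differentiable_mx => i j.
have -> : (fun z => (f z *m g z) i j) =
    \sum_(k < n) (fun z => f z i k * g z k j).
  by apply/funext => z; rewrite mxE fct_sumE.
apply: differentiable_sum => k.
by apply: differentiableM;
  [apply: (differentiable_comp (g := fun M : 'M[K]_(m, n) => M i k) df)
  |apply: (differentiable_comp (g := fun M : 'M[K]_(n, p) => M k j) dg)];
  exact: differentiable_coord.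
Qed.

(* A complex manifold as a set with a holomorphic atlas: its topology is the one
   making the charts homeomorphisms onto open sets (mopen below). Hausdorffness
   and second countability are not fields: they hold automatically for complex
   tori and for total spaces of vector bundles over them. *)
Record cmanifold (R : realType) (V : normedModType (Cx R)) := CManifold {
  cpoint :> choiceType ;
  atlas : set (chart V cpoint) ;
  atlas_cover : forall p, exists2 a, atlas a & cdom a p ;
  atlas_open : forall a b, atlas a -> atlas b ->
    open (a @` (cdom a `&` cdom b)) ;
  atlas_holo : forall a b, atlas a -> atlas b ->
    forall p, cdom a p -> cdom b p -> differentiable (b \o cinv a) (a p) }.

Arguments atlas {R V} c.

Definition mopen (R : realType) (V : normedModType (Cx R)) (M : cmanifold V)
    (A : set M) :=
  forall a, atlas M a -> open (a @` (A `&` cdom a)).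

(* The first conjunct is continuity of f at p. *)
Definition holomorphic (R : realType) (V W : normedModType (Cx R))
    (M : cmanifold V) (N : cmanifold W) (f : M -> N) :=
  forall p a b, atlas M a -> atlas N b -> cdom a p -> cdom b (f p) ->
    (\forall z \near a p, cdom b (f (cinv a z))) /\
    differentiable (b \o f \o cinv a) (a p).

Definition biholomorphism (R : realType) (V W : normedModType (Cx R))
    (M : cmanifold V) (N : cmanifold W) (f : M -> N) :=
  holomorphic f /\
  exists g : N -> M, [/\ cancel f g, cancel g f & holomorphic g].

Definition biholomorphic (R : realType) (V W : normedModType (Cx R))
    (M : cmanifold V) (N : cmanifold W) :=
  exists f : M -> N, biholomorphism f.

Definition lattice (R : realType) (tau : Cx R) : {pred Cx R} :=
  fun z => `[< exists m n : int, z = m%:~R + n%:~R * tau >].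

Lemma lattice_zmod_closed (R : realType) (tau : Cx R) :
  zmod_closed (lattice tau).
Proof.
split; first by apply/asboolP; exists 0, 0; rewrite mul0r addr0.
move=> _ _ /asboolP[m [n ->]] /asboolP[m' [n' ->]]; apply/asboolP.
exists (m - m'), (n - n'); rewrite !intrB mulrBl opprD.
by rewrite addrACA.
Qed.

HB.instance Definition _ (R : realType) (tau : Cx R) :=
  GRing.isZmodClosed.Build (Cx R) (lattice tau) (lattice_zmod_closed tau).

Definition torus (R : realType) (tau : Cx R) : choiceType :=
  Quotient.quot (lattice tau).

Definition torus_proj (R : realType) (tau : Cx R) : Cx R -> torus tau :=
  \pi_(Quotient.quot (lattice tau))%qT.

Arguments torus_proj {R} tau _.

(* The charts of C / (Z + Z tau) are all sections, with open image, of the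
   quotient map. *)
Definition torus_atlas (R : realType) (tau : Cx R) :
    set (chart (Cx R : normedModType (Cx R)) (torus tau)) :=
  [set a | cinv a = torus_proj tau /\ open (a @` cdom a)].

Arguments torus_atlas {R} tau _.

Lemma cvg_translate (K : numFieldType) (V : normedModType K) (x y : V) :
  (z + (y - x)) @[z --> x] --> y.
Proof.
by rewrite -[X in _ --> X](subrKC x); apply: cvgD; [exact: cvg_id|exact: cvg_cst].
Qed.

Lemma torus_projP (R : realType) (tau x y : Cx R) :
  torus_proj tau x = torus_proj tau y <-> x - y \in lattice tau.
Proof.
rewrite Quotient.idealrBE; split=> [e|/eqP//].
by apply/eqP; exact: e.
Qed.

Lemma lattice_discrete (R : realType) (tau : Cx R) : 0 < complex.Im tau ->
  exists2 d : Cx R, 0 < d &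
    forall z, z \in lattice tau -> `|z| < d -> z = 0.
Proof.
move=> tau0.
have normRe (z : R[i]) : (`|complex.Re z|%:C)%C <= `|z|.
  by rewrite normc_def lecR -sqrtr_sqr ler_wsqrtr// lerDl sqr_ge0.
have normIm (z : R[i]) : (`|complex.Im z|%:C)%C <= `|z|.
  by rewrite normc_def lecR -sqrtr_sqr ler_wsqrtr// lerDr sqr_ge0.
have intE (m : int) : (m%:~R : R[i]) = (m%:~R%:C)%C by rewrite rmorph_int.
have int_ge1 (m : int) : m != 0 -> 1 <= `|m%:~R| :> R.
  by move=> m0; rewrite -intr_norm -[1]/(1%:~R) ler_int -gtz0_ge1 normr_gt0.
exists ((Num.min 1 (complex.Im tau))%:C)%C; first by rewrite ltcR lt_min ltr01.
move=> z /asboolP[m [n zE]] zd; have n0 : n = 0.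
  apply/eqP/negPn/negP => n0.
  have := le_lt_trans (normIm z) zd.
  rewrite ltcR ltNge => /negP; apply.
  rewrite zE !intE; case: (tau) tau0 => [tr ti] /= ti0.
  rewrite mul0r addr0 add0r normrM (gtr0_norm ti0) ge_min.
  by rewrite ler_peMl ?orbT ?int_ge1 // ltW.
subst n; rewrite mul0r addr0 in zE.
suff m0 : m = 0 by rewrite zE m0.
apply/eqP/negPn/negP => m0.
have := le_lt_trans (normRe z) zd.
rewrite ltcR ltNge => /negP; apply.
by rewrite zE intE /= ge_min int_ge1.
Qed.

Lemma torus_cover (R : realType) (tau : Cx R) (p : torus tau) :
  0 < complex.Im tau -> exists2 a, torus_atlas tau a & cdom a p.
Proof.
move=> /lattice_discrete[d d0 dP].
pose z0 : Cx R := repr p.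
pose D := torus_proj tau @` ball z0 (d / 2).
pose s (q : torus tau) : Cx R :=
  get [set z | ball z0 (d / 2) z /\ torus_proj tau z = q].
have sP q : D q -> ball z0 (d / 2) (s q) /\ torus_proj tau (s q) = q.
  move=> [z z0z zq].
  by apply: (@getPex _ [set z | ball z0 (d / 2) z /\ torus_proj tau z = q]); exists z.
pose a : chart (Cx R) (torus tau) :=
  Chart (fun q (Dq : D q) => (sP q Dq).2).
exists a; last first.
  exists z0; last exact: reprK.
  by apply: ballxx; rewrite divr_gt0.
split=> //=; suff -> : s @` D = ball z0 (d / 2) by exact: ball_open.
apply/seteqP; split=> [_ [q /sP[? _] <-]//|z zb].
have Dz : D (torus_proj tau z) by exists z.
exists (torus_proj tau z) => //; have [sb /torus_projP/dP e] := sP _ Dz.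
apply/eqP; rewrite -subr_eq0; apply/eqP/e.
move: sb zb; rewrite -ball_normE /= => sb zb.
rewrite -(subrKA z0) (splitr d); apply: le_lt_trans (ler_normD _ _) _.
by apply: ltrD; rewrite // distrC.
Qed.

Lemma torus_translate (R : realType) (tau : Cx R) a b : torus_atlas tau a ->
  torus_atlas tau b -> forall p, cdom a p -> cdom b p ->
  \forall z \near a p, (a @` (cdom a `&` cdom b)) z /\
    b (torus_proj tau z) = z + (b p - a p).
Proof.
move=> [ai ao] [bi bo] p pa pb.
have aP q : cdom a q -> torus_proj tau (a q) = q by rewrite -ai; exact: chartK.
have bP q : cdom b q -> torus_proj tau (b q) = q by rewrite -bi; exact: chartK.
have za : \forall z \near a p, (a @` cdom a) z.
  by apply: open_nbhs_nbhs; split=> //; exists p.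
have zb : \forall z \near a p, (b @` cdom b) (z + (b p - a p)).
  have := @cvg_translate _ (Cx R) (a p) (b p).
  by move=> /(_ (b @` cdom b)); apply; apply: open_nbhs_nbhs; split=> //; exists p.
apply: filterS2 za zb => z [q qa qz] [q' q'b q'z].
have zE : torus_proj tau (z + (b p - a p)) = torus_proj tau z.
  rewrite torus_projP addrAC subrr add0r -torus_projP.
  by rewrite bP ?aP.
have zq' : torus_proj tau z = q' by rewrite -zE -q'z bP.
have zq : torus_proj tau z = q by rewrite -qz aP.
split; last by rewrite zq'.
by exists q => //; split=> //; rewrite -zq zq'.
Qed.

Lemma torus_open (R : realType) (tau : Cx R) a b : torus_atlas tau a ->
  torus_atlas tau b -> open (a @` (cdom a `&` cdom b)).
Proof.
move=> aT bT; rewrite openE => _ [p [pa pb] <-].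
by apply: filterS (torus_translate aT bT pa pb) => z [].
Qed.

Lemma torus_holo (R : realType) (tau : Cx R) a b : torus_atlas tau a ->
  torus_atlas tau b -> forall p, cdom a p -> cdom b p ->
  differentiable (b \o cinv a) (a p).
Proof.
move=> aT bT p pa pb.
apply: (@near_eq_differentiable _ _ _ _ (fun z => z + (b p - a p))).
  by apply: filterS (torus_translate aT bT pa pb) => z []; rewrite /= aT.1.
by apply: differentiableD.
Qed.

Definition elliptic_curve (R : realType) (tau : Cx R)
    (tau_gt0 : 0 < complex.Im tau) : cmanifold (Cx R : normedModType (Cx R)) :=
  CManifold (fun p => torus_cover p tau_gt0) (@torus_open R tau)
    (@torus_holo R tau).

(* Local trivialisation, over tdom, of a family of vector spaces; off tdom the
   linear maps are irrelevant. *)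
Record triv (R : realType) (B : Type) (E : B -> lmodType (Cx R)) (r : nat) :=
  Triv {
  tdom : set B ;
  tmap : forall x, {linear E x -> 'rV[Cx R]_r} ;
  tinv : forall x, {linear 'rV[Cx R]_r -> E x} ;
  tmapK : forall x, tdom x -> cancel (tmap x) (tinv x) ;
  tinvK : forall x, tdom x -> cancel (tinv x) (tmap x) }.

(* Transition function tdom t `&` tdom u -> GL_r from t to u; vectors are rows,
   so tmap u x v = tmap t x v *m transition t u x. *)
Definition transition (R : realType) (B : Type) (E : B -> lmodType (Cx R))
    (r : nat) (t u : triv E r) (x : B) : 'M[Cx R]_r :=
  lin1_mx (tmap u x \o tinv t x).

(* Holomorphic vector bundle of rank r over B. *)
Record bundle (R : realType) (V : normedModType (Cx R)) (B : cmanifold V)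
    (r : nat) := Bundle {
  fiber :> B -> lmodType (Cx R) ;
  trivs : set (triv fiber r) ;
  triv_cover : forall x, exists2 t, trivs t & tdom t x ;
  triv_open : forall t, trivs t -> mopen (tdom t) ;
  triv_holo : forall t u a, trivs t -> trivs u -> atlas B a ->
    forall x, cdom a x -> tdom t x -> tdom u x ->
    differentiable (transition t u \o cinv a) (a x) }.

Arguments trivs {R V B r} b.

Definition total_model (R : realType) (V : normedModType (Cx R)) (r : nat) :
  normedModType (Cx R) := (V * 'rV[Cx R]_r)%type.

Definition total (R : realType) (V : normedModType (Cx R)) (B : cmanifold V)
    (r : nat) (E : bundle B r) : choiceType := {x : B & E x}.

Section TotalChart.
Context (R : realType) (V : normedModType (Cx R)) (B : cmanifold V).
Context (r : nat) (E : bundle B r).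

Definition total_cmap (a : chart V B) (t : triv E r) (e : total E) :
    V * 'rV[Cx R]_r :=
  (a (tag e), tmap t (tag e) (tagged e)).

Definition total_cinv (a : chart V B) (t : triv E r) (zv : V * 'rV[Cx R]_r) :
    total E :=
  Tagged (fun x => E x) (tinv t (cinv a zv.1) zv.2).

Definition total_cdom (a : chart V B) (t : triv E r) : set (total E) :=
  [set e | cdom a (tag e) /\ tdom t (tag e)].

Lemma total_chartK (a : chart V B) (t : triv E r) (e : total E) :
  total_cdom a t e -> total_cinv a t (total_cmap a t e) = e.
Proof.
case: e => x v [/= ax tx]; rewrite /total_cinv /total_cmap /=.
by rewrite (chartK ax) (tmapK tx).
Qed.

Definition total_chart (a : chart V B) (t : triv E r) :
    chart (total_model V r) (total E) :=
  Chart (@total_chartK a t).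

Definition total_atlas : set (chart (total_model V r) (total E)) :=
  [set c | exists a t, [/\ atlas B a, trivs E t & c = total_chart a t]].

Lemma total_cover (e : total E) :
  exists2 c, total_atlas c & cdom c e.
Proof.
have [a aB ae] := atlas_cover (tag e); have [t tE te] := triv_cover E (tag e).
by exists (total_chart a t) => //; exists a, t.
Qed.

Lemma total_atlas_open c d : total_atlas c -> total_atlas d ->
  open (c @` (cdom c `&` cdom d)).
Proof.
move=> [a [t [aB tE ->]]] [b [u [bB uE ->]]].
pose A := a @` ((cdom a `&` cdom b) `&`
  ((tdom t `&` cdom a) `&` (tdom u `&` cdom a))).
have oA : open A.
  rewrite /A cmap_imageI; [|by move=> p []..|by move=> p [[]]].
  rewrite [a @` ((_ `&` _) `&` _)]cmap_imageI; [|by move=> p []..].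
  apply: openI; first exact: atlas_open.
  by apply: openI; exact: triv_open.
have -> : total_chart a t @` (cdom (total_chart a t) `&` cdom (total_chart b u))
    = fst @^-1` A.
  apply/seteqP; split=> [_ [e [[/= ae te] [/= be ue]] <-]|[z v] /=].
    by exists (tag e).
  case=> x [[ax bx] [[tx _] [ux _]]] <-.
  exists (Tagged (fun x => E x) (tinv t x v)) => //=.
  by rewrite /total_cmap /= (tinvK tx).
by apply: open_comp => // z _; exact: cvg_fst.
Qed.

Lemma total_atlas_holo c d : total_atlas c -> total_atlas d ->
  forall e, cdom c e -> cdom d e -> differentiable (d \o cinv c) (c e).
Proof.
move=> [a [t [aB tE ->]]] [b [u [bB uE ->]]] e [/= ae te] [/= be ue].
have -> : total_chart b u \o total_cinv a t =
  fun zv => ((b \o cinv a) zv.1, zv.2 *m (transition t u \o cinv a) zv.1).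
  apply/funext => -[z v]; rewrite /= /total_cmap /=; congr (_, _).
  by rewrite /transition mul_rV_lin1.
have dfst (U W : normedModType (Cx R)) (p : U * W) : differentiable fst p.
  by apply: linear_differentiable => q; exact: cvg_fst.
have dsnd (U W : normedModType (Cx R)) (p : U * W) : differentiable snd p.
  by apply: linear_differentiable => q; exact: cvg_snd.
apply: differentiable_pair.
  apply: (differentiable_comp (f := fst) (g := b \o cinv a)) => //.
  exact: atlas_holo.
apply: differentiable_mulmx; first exact: dsnd.
have dT := triv_holo tE uE aB ae te ue.
exact: (differentiable_comp (dfst _ _ (total_cmap a t e)) dT).
Qed.

Definition total_space : cmanifold (total_model V r) :=
  CManifold total_cover total_atlas_open total_atlas_holo.

End TotalChart.


Definition bundle_isomorphic (R : realType) (V W : normedModType (Cx R))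
    (B : cmanifold V) (B' : cmanifold W) (r r' : nat)
    (E : bundle B r) (E' : bundle B' r') :=
  exists (f : B -> B') (F : forall x, {linear E x -> E' (f x)})
         (Phi : total_space E -> total_space E'),
    [/\ biholomorphism f, biholomorphism Phi &
        forall e, Phi e = Tagged (fun y => E' y) (F (tag e) (tagged e))].

(* h is meromorphic at z0, not identically zero there, of order n. *)
Definition has_order (R : realType) (h : Cx R -> Cx R) (z0 : Cx R) (n : int) :=
  exists g : Cx R -> Cx R,
    [/\ \forall z \near z0, differentiable g z, g z0 != 0 &
        \forall z \near z0^', h z = (z - z0) ^ n * g z].

(* A (meromorphic) section of the line bundle det E, given by its components in
   the trivialisations of det E induced by those of E. *)
Definition det_section (R : realType) (V : normedModType (Cx R))
    (B : cmanifold V) (r : nat) (E : bundle B r) (s : triv E r -> B -> Cx R) :=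
  forall t u, trivs E t -> trivs E u -> forall x, tdom t x -> tdom u x ->
    s u x = s t x * \det (transition t u x).

Definition is_divisor (R : realType)
    (B : cmanifold (Cx R : normedModType (Cx R))) (r : nat) (E : bundle B r)
    (s : triv E r -> B -> Cx R) (D : B -> int) :=
  forall t a, trivs E t -> atlas B a -> forall x, tdom t x -> cdom a x ->
    has_order (s t \o cinv a) (a x) (D x).

(* deg E is the degree of the divisor of any meromorphic section of det E that is
   not identically zero; over a compact curve such sections exist and the
   degrees of their divisors agree. *)
Definition has_degree (R : realType)
    (B : cmanifold (Cx R : normedModType (Cx R))) (r : nat) (E : bundle B r)
    (d : int) :=
  exists (s : triv E r -> B -> Cx R) (D : B -> int),
    [/\ det_section s, is_divisor s D, finite_set [set x | D x != 0] &
        \sum_(x \in [set: B]) D x = d].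

(* Main.v *)
From HB Require Import structures.
Require Import Defs.
From mathcomp Require Import all_boot all_order all_algebra.
From mathcomp Require Import all_classical all_reals all_analysis.
From mathcomp Require Import complex.
From mathcomp Require Import ring lra.
Set Implicit Arguments.
Unset Strict Implicit.
Unset Printing Implicit Defensive.
Import Order.TTheory GRing.Theory Num.Theory.
Import numFieldNormedType.Exports.
Local Open Scope classical_set_scope.
Local Open Scope ring_scope.

(* Let h : B -> B' be the map obtained by applying the biholomorphism Phi to the
   zero section of E and projecting to B', and k the map built from Phi^-1 in the
   same way. A holomorphic map of tori has the form z |-> a z + b, because its
   derivative is an entire doubly periodic function. Conjugating by Phi the
   multiplication by t on the fibres of E' gives self-maps of B, from the identity
   at t = 1 to k o h at t = 0, whose slopes vary continuously in the discrete set
   of lattice points, so k o h has slope 1 and h is an isomorphism. Thus Phi maps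
   the zero section of E to a section of E', and after composing Phi with a
   fibrewise translation this section is the zero section. The derivative of Phi in
   the fibre direction along the zero sections, i.e. the map induced on their normal
   bundles E and E', is then the bundle isomorphism.

   That derivatives of holomorphic functions are holomorphic is obtained from
   Goursat's theorem on rectangles, applied to difference quotients. *)

(** * Integration along segments *)

(** The analytic input is [differentiable_partial]: for a function holomorphic in two variables, the
    derivative in one of them is holomorphic in the other. It enters three times: the derivative of
    a map into a torus is holomorphic, the slopes depend continuously on t, and the fibre derivative
    depends holomorphically on the base point. The obstacle is that [differentiable] says nothing
    about continuity of the derivative. A Cauchy formula is therefore needed for difference
    quotients, which are not known to be differentiable at their base point; rectangle integrals are
    shown to ignore isolated points where the integrand is only continuous. The value 2 pi i is
    never computed: a lower bound for the integral of 1 / (z - w) suffices. Even after recentering,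
    Phi need not send fibres to fibres, so restricting it to a fibre gives no bundle map. Its
    derivative along the zero section does, and the chain rule makes the derivatives of Phi and of
    its inverse mutually inverse. *)

Lemma nbhs_distP (K : numFieldType) (V : normedModType K) (x : V) (P : set V) :
  nbhs x P <-> exists2 e : K, 0 < e & forall y, `|x - y| < e -> P y.
Proof.
split=> [/nbhs_ballP[e /= e0 eP]|[e e0 eP]].
  by exists e => // y xy; apply: eP; rewrite -ball_normE.
by apply/nbhs_ballP; exists e => //= y; rewrite -ball_normE; exact: eP.
Qed.

Lemma near_dist (K : numFieldType) (V : normedModType K) (x : V) (e : K) :
  0 < e -> \forall y \near x, `|x - y| < e.
Proof. by move=> e0; apply/nbhs_distP; exists e. Qed.

(** The two sides are normed over different fields, so that one criterion serves maps between [R]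
    and [C] in both directions. *)
Lemma continuous_distP (K K' : numFieldType) (V : normedModType K)
    (W : normedModType K') (f : V -> W) (x : V) :
  {for x, continuous f} <->
  forall e : K', 0 < e -> exists2 d : K, 0 < d &
    forall y, `|x - y| < d -> `|f x - f y| < e.
Proof.
split=> [cf e e0|H P /nbhs_distP[e e0 eP]].
  by have /cf /nbhs_distP := near_dist (f x) e0.
by have [d d0 dP] := H e e0; apply/nbhs_distP; exists d => // y /dP /eP.
Qed.

Section ComplexPlane.
Context {R : realType}.
Local Notation C := (Cx R).
Local Notation Re := (@complex.Re R).
Local Notation Im := (@complex.Im R).

Lemma Re_add (x y : C) : Re (x + y) = Re x + Re y. Proof. by case: x; case: y. Qed.
Lemma Im_add (x y : C) : Im (x + y) = Im x + Im y. Proof. by case: x; case: y. Qed.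
Lemma Re_opp (x : C) : Re (- x) = - Re x. Proof. by case: x. Qed.
Lemma Im_opp (x : C) : Im (- x) = - Im x. Proof. by case: x. Qed.
Lemma Re_mul (x y : C) : Re (x * y) = Re x * Re y - Im x * Im y.
Proof. by case: x; case: y. Qed.
Lemma Im_mul (x y : C) : Im (x * y) = Re x * Im y + Im x * Re y.
Proof. by case: x; case: y. Qed.

Lemma cx_ext (x y : C) : Re x = Re y -> Im x = Im y -> x = y.
Proof. by case: x => a b; case: y => c d /= -> ->. Qed.

Lemma norm_Re_le (z : C) : (`|Re z|%:C)%C <= `|z|.
Proof. exact: normc_ge_Re. Qed.

Lemma norm_Im_le (z : C) : (`|Im z|%:C)%C <= `|z|.
Proof. by rewrite normc_def lecR -sqrtr_sqr ler_wsqrtr// lerDr sqr_ge0. Qed.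

Lemma normC (x : R) : `|(x%:C)%C : C| = (`|x|%:C)%C.
Proof. by rewrite normc_def /= expr0n addr0 sqrtr_sqr. Qed.

Lemma norm_le_ReIm (z : C) : `|z| <= ((`|Re z| + `|Im z|)%:C)%C.
Proof.
rewrite normc_def lecR; set a := `|Re z|; set b := `|Im z|.
have -> : Re z ^+ 2 = a ^+ 2 by rewrite real_normK ?num_real.
have -> : Im z ^+ 2 = b ^+ 2 by rewrite real_normK ?num_real.
have a0 : 0 <= a by exact: normr_ge0.
have b0 : 0 <= b by exact: normr_ge0.
rewrite -[leRHS]ger0_norm ?addr_ge0// -sqrtr_sqr ler_wsqrtr//.
by rewrite sqrrD -addrA [_ *+ 2 + _]addrC addrA lerDl mulrn_wge0 // mulr_ge0.
Qed.

Lemma ge0_real_part (e : C) : 0 <= e -> e = ((Re e)%:C)%C.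
Proof. by move=> /ger0_Im; case: e => a b /= ->. Qed.

Lemma gt0_Re (e : C) : 0 < e -> 0 < Re e.
Proof. by rewrite ltcE => /andP[]. Qed.

Lemma Re_continuous (z : C) : {for z, continuous (Re : C -> R)}.
Proof.
apply/(@continuous_distP C R C R) => e e0; exists (e%:C)%C; first by rewrite ltcR.
move=> w zw; rewrite -Re_opp -Re_add -ltcR.
exact: le_lt_trans (norm_Re_le _) zw.
Qed.

Lemma Im_continuous (z : C) : {for z, continuous (Im : C -> R)}.
Proof.
apply/(@continuous_distP C R C R) => e e0; exists (e%:C)%C; first by rewrite ltcR.
move=> w zw; rewrite -Im_opp -Im_add -ltcR.
exact: le_lt_trans (norm_Im_le _) zw.
Qed.

Lemma realC_continuous (x : R) : {for x, continuous (fun x : R => (x%:C)%C : C)}.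
Proof.
apply/(@continuous_distP R C R C) => e e0; exists (Re e); first exact: gt0_Re.
move=> y xy.
by rewrite (ge0_real_part (ltW e0)) -(rmorphB (real_complex R)) normC ltcR.
Qed.

(** The window ]-2, 2[ is fixed once and for all: it contains [-1, 1], where all the rectangles used
    later have their corners, with room on both sides for two-sided derivatives at the ends. *)
Lemma real_antiderivative (g : R -> R) : continuous g ->
  exists G : R -> R, forall x : R, -2 < x < 2 -> is_derive x 1 G (g x).
Proof.
move=> cg.
exists (fun x => \int[lebesgue_measure]_(t in `[(-2), x]) g t)%R.
move=> x /andP[x1 x2].
have ig : lebesgue_measure.-integrable `[(-2), (2 : R)] (EFin \o g).
  apply: continuous_compact_integrable; first exact: segment_compact.
  exact: continuous_subspaceT.
have [dG GE] := continuous_FTC1_closed x2 ig x1 (cg x).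
by apply: (DeriveDef dG); rewrite -derive1E.
Qed.

(** An arbitrary choice, and a default value when [g] has no antiderivative; only differences of its
    values are used. *)
Definition antideriv (g : R -> R) : R -> R :=
  get [set G | forall x : R, -2 < x < 2 -> is_derive x 1 G (g x)].

Lemma derive_sub_ge (G g : R -> R) a b m : a <= b ->
  (forall x : R, a <= x <= b -> is_derive x 1 G (g x)) ->
  (forall x, a <= x <= b -> m <= g x) ->
  m * (b - a) <= G b - G a.
Proof.
move=> ab dG mg.
have [x|x xab|c cab ->] := @MVT_segment R G g a b ab.
- by move=> xab; apply: dG; rewrite !(itvP xab).
- apply: derivable_within_continuous => y yab.
  by apply: (@ex_derive _ _ _ _ _ _ (g y)); apply: dG; rewrite !(itvP yab).
- by rewrite ler_wpM2r ?subr_ge0// mg// !(itvP cab).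
Qed.

Lemma derive0_eq (G : R -> R) a b : -2 < a < 2 -> -2 < b < 2 ->
  (forall x : R, -2 < x < 2 -> is_derive x 1 G 0) -> G a = G b.
Proof.
move=> aI bI dG.
wlog ab : a b aI bI / a <= b => [H|].
  by case: (leP a b) => [|/ltW] ab; [exact: H|symmetry; exact: H].
have I x : a <= x <= b -> -2 < x < 2.
  by move=> /andP[ax xb]; move: aI bI; lra.
apply/eqP; rewrite eq_le -subr_ge0 -[X in _ && X]subr_ge0; apply/andP; split.
  have := @derive_sub_ge G (cst 0) a b 0 ab (fun x xI => dG x (I x xI)).
  by rewrite mul0r; apply=> x _.
have := @derive_sub_ge (- G) (cst 0) a b 0 ab.
rewrite mul0r opprK addrC; apply=> // x xI.
by apply: is_derive_eq (oppr0 _); apply: is_deriveN; exact: dG (I x xI).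
Qed.

(** Two antiderivatives differ by a constant on the window, so the arbitrary choice in [antideriv]
    is harmless and any explicit antiderivative computes the integral. *)
Lemma antiderivE (G g : R -> R) a b : -2 < a < 2 -> -2 < b < 2 ->
  (forall x : R, -2 < x < 2 -> is_derive x 1 G (g x)) ->
  antideriv g b - antideriv g a = G b - G a.
Proof.
move=> aI bI dG.
have dA : forall x : R, -2 < x < 2 -> is_derive x 1 (antideriv g) (g x).
  by apply: (@getPex _ [set G | forall x : R, -2 < x < 2 -> is_derive x 1 G (g x)]); exists G.
have := @derive0_eq (antideriv g - G) a b aI bI; rewrite !fctE => E.
suff : antideriv g a - G a = antideriv g b - G b by lra.
apply: E => x xI; apply: is_derive_eq (subrr (g x)).
exact: is_deriveB (dA x xI) (dG x xI).
Qed.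

Lemma antideriv_is_derive (g : R -> R) : continuous g ->
  forall x : R, -2 < x < 2 -> is_derive x 1 (antideriv g) (g x).
Proof.
move=> /real_antiderivative.
exact: (@getPex _ [set G | forall x : R, -2 < x < 2 -> is_derive x 1 G (g x)]).
Qed.

(* Oriented integral over [a, b], meaningful for a, b in ]-2, 2[. *)
Definition segint (f : R -> C) (a b : R) : C :=
  ((antideriv (Re \o f) b - antideriv (Re \o f) a) +i*
   (antideriv (Im \o f) b - antideriv (Im \o f) a))%C.

Lemma segint_split f a b c : segint f a b + segint f b c = segint f a c.
Proof. by apply: cx_ext; rewrite ?Re_add ?Im_add /=; ring. Qed.

Lemma segint_rev f a b : segint f a b = - segint f b a.
Proof. by apply: cx_ext; rewrite ?Re_opp ?Im_opp /=; ring. Qed.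

Lemma Re_comp_continuous (f : R -> C) : continuous f -> continuous (Re \o f).
Proof. by move=> cf x; apply: continuous_comp; [exact: cf|exact: Re_continuous]. Qed.

Lemma Im_comp_continuous (f : R -> C) : continuous f -> continuous (Im \o f).
Proof. by move=> cf x; apply: continuous_comp; [exact: cf|exact: Im_continuous]. Qed.

Lemma segintD (f g : R -> C) (a b : R) : continuous f -> continuous g ->
  -2 < a < 2 -> -2 < b < 2 ->
  segint (fun x => f x + g x) a b = segint f a b + segint g a b.
Proof.
move=> cf cg aI bI; apply: cx_ext; rewrite ?Re_add ?Im_add /=.
  apply: (etrans (@antiderivE (antideriv (Re \o f) + antideriv (Re \o g)) _ a b aI bI _));
    last by rewrite !fctE; ring.
  move=> x xI; rewrite /= Re_add; apply: is_deriveD; apply: antideriv_is_derive => //;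
    exact: Re_comp_continuous.
apply: (etrans (@antiderivE (antideriv (Im \o f) + antideriv (Im \o g)) _ a b aI bI _));
  last by rewrite !fctE; ring.
move=> x xI; rewrite /= Im_add; apply: is_deriveD; apply: antideriv_is_derive => //;
  exact: Im_comp_continuous.
Qed.

Lemma segintZ (k : C) (f : R -> C) (a b : R) : continuous f ->
  -2 < a < 2 -> -2 < b < 2 ->
  segint (fun x => k * f x) a b = k * segint f a b.
Proof.
move=> cf aI bI; apply: cx_ext; rewrite ?Re_mul ?Im_mul /=.
  pose G x := Re k * antideriv (Re \o f) x - Im k * antideriv (Im \o f) x.
  apply: (etrans (@antiderivE G _ a b aI bI _)); last by rewrite /G; ring.
  move=> x xI; rewrite /= Re_mul.
  apply: (@is_deriveB _ _ _ (Re k \*: _) (Im k \*: _)); apply: is_deriveZ;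
    apply: antideriv_is_derive => //;
    [exact: Re_comp_continuous|exact: Im_comp_continuous].
pose G x := Re k * antideriv (Im \o f) x + Im k * antideriv (Re \o f) x.
apply: (etrans (@antiderivE G _ a b aI bI _)); last by rewrite /G; ring.
move=> x xI; rewrite /= Im_mul.
apply: (@is_deriveD _ _ _ (Re k \*: _) (Im k \*: _)); apply: is_deriveZ;
  apply: antideriv_is_derive => //;
  [exact: Im_comp_continuous|exact: Re_comp_continuous].
Qed.

Lemma segint1 (a b : R) : -2 < a < 2 -> -2 < b < 2 ->
  segint (cst 1) a b = ((b - a)%:C)%C.
Proof.
move=> aI bI; apply: cx_ext => /=.
  apply: (etrans (@antiderivE id _ a b aI bI _)) => // x _; exact: is_derive_id.
apply: (etrans (@antiderivE (cst 0) _ a b aI bI _)); last by rewrite subrr.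
Qed.

Lemma segint_id (a b : R) : -2 < a < 2 -> -2 < b < 2 ->
  segint (fun x => (x%:C)%C) a b = (((b ^+ 2 - a ^+ 2) / 2)%:C)%C.
Proof.
move=> aI bI; apply: cx_ext => /=.
  pose G (y : R) := 2^-1 * y ^+ 2.
  apply: (etrans (@antiderivE G _ a b aI bI _)); last by rewrite /G; field.
  move=> x _; apply: is_derive_eq.
  by rewrite /GRing.scale /=; field.
apply: (etrans (@antiderivE (cst 0) _ a b aI bI _)); last by rewrite subrr.
Qed.

Lemma segint_Im_ge (f : R -> C) (a b m : R) : continuous f -> a <= b -> -2 < a < 2 -> -2 < b < 2 ->
  (forall x, a <= x <= b -> m <= Im (f x)) -> m * (b - a) <= Im (segint f a b).
Proof.
move=> cf ab aI bI mf; apply: (@derive_sub_ge _ (Im \o f)) => // x /andP[ax xb].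
apply: antideriv_is_derive; first exact: Im_comp_continuous.
by move: aI bI; lra.
Qed.

Lemma segint_Re_ge (f : R -> C) (a b m : R) : continuous f -> a <= b -> -2 < a < 2 -> -2 < b < 2 ->
  (forall x, a <= x <= b -> m <= Re (f x)) -> m * (b - a) <= Re (segint f a b).
Proof.
move=> cf ab aI bI mf; apply: (@derive_sub_ge _ (Re \o f)) => // x /andP[ax xb].
apply: antideriv_is_derive; first exact: Re_comp_continuous.
by move: aI bI; lra.
Qed.

Lemma segint_norm_le (f : R -> C) (a b : R) (M : C) : continuous f -> -2 < a < 2 -> -2 < b < 2 ->
  (forall x, (a <= x <= b) || (b <= x <= a) -> `|f x| <= M) ->
  `|segint f a b| <= 2 * M * (`|b - a|%:C)%C.
Proof.
move=> cf aI bI fM.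
wlog ab : a b aI bI fM / a <= b => [H|].
  case: (leP a b) => [|/ltW] ab; first exact: H.
  rewrite segint_rev normrN distrC; apply: H => // x.
  by rewrite orbC; exact: fM.
have M0 : 0 <= M by apply: le_trans (normr_ge0 (f a)) _; apply: fM; rewrite lexx ab.
have ME := ge0_real_part M0.
have cfN : continuous (fun x => - f x) by move=> x; apply: continuousN; exact: cf.
have fMR x : a <= x <= b -> `|Re (f x)| <= Re M.
  move=> xab; rewrite -lecR -ME; apply: le_trans (norm_Re_le _) _.
  by apply: fM; rewrite xab.
have fMI x : a <= x <= b -> `|Im (f x)| <= Re M.
  move=> xab; rewrite -lecR -ME; apply: le_trans (norm_Im_le _) _.
  by apply: fM; rewrite xab.
apply: le_trans (norm_le_ReIm _) _.
rewrite [in leRHS]ME (@ger0_norm _ (b - a)) ?subr_ge0//.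
have -> : 2 * ((Re M)%:C)%C * ((b - a)%:C)%C = ((2 * Re M * (b - a))%:C)%C :> C.
  by rewrite !rmorphM /= rmorph_nat.
rewrite lecR.
have segN g : continuous g -> segint (fun x => - g x) a b = - segint g a b.
  move=> cg; rewrite -mulN1r -segintZ//; congr segint; apply/funext => x.
  by rewrite mulN1r.
have h1 : `|Re (segint f a b)| <= Re M * (b - a).
  rewrite ler_norml -mulNr; apply/andP; split.
    apply: segint_Re_ge => // x /fMR; rewrite ler_norml => /andP[] //.
  have := @segint_Re_ge (fun x => - f x) a b (- Re M) cfN ab aI bI.
  rewrite (segN f cf) Re_opp mulNr lerN2; apply=> x /fMR.
  by rewrite ler_norml Re_opp lerN2 => /andP[].
have h2 : `|Im (segint f a b)| <= Re M * (b - a).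
  rewrite ler_norml -mulNr; apply/andP; split.
    apply: segint_Im_ge => // x /fMI; rewrite ler_norml => /andP[] //.
  have := @segint_Im_ge (fun x => - f x) a b (- Re M) cfN ab aI bI.
  rewrite (segN f cf) Im_opp mulNr lerN2; apply=> x /fMI.
  by rewrite ler_norml Im_opp lerN2 => /andP[].
lra.
Qed.

End ComplexPlane.

(** * Rectangle integrals and Goursat's theorem *)

Section Derivatives.
Context {K : numFieldType} {V W : normedModType K}.

Lemma differentiable_approx (f : V -> W) (x : V) : differentiable f x ->
  forall e : K, 0 < e -> exists2 d : K, 0 < d &
    forall h, `|h| < d -> `|f (x + h) - f x - 'd f x h| <= e * `|h|.
Proof.
move=> df e e0; have [_ /eqaddoP /(_ e e0)] := (diff_locallyP x f).1 df.
move=> /nbhs_distP[d d0 dP]; exists d => // h hd.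
have := dP h; rewrite sub0r normrN => /(_ hd).
by rewrite /= !fctE /= [h + x]addrC opprD addrA.
Qed.

End Derivatives.

Section OneVariable.
Context {K : numFieldType} {W : normedModType K}.

Lemma derive_approx (f : K -> W) (x : K) : differentiable f x ->
  forall e : K, 0 < e -> exists2 d : K, 0 < d &
    forall h, `|h| < d -> `|f (x + h) - f x - h *: 'D_1 f x| <= e * `|h|.
Proof.
move=> df e e0; have [d d0 dP] := differentiable_approx df e0.
exists d => // h /dP; rewrite deriveE// -linearZ /=.
by rewrite /GRing.scale /= mulr1.
Qed.

Lemma approx_derive (f : K -> W) (x : K) (l : W) :
  (forall e : K, 0 < e -> exists2 d : K, 0 < d &
    forall h, `|h| < d -> `|f (x + h) - f x - h *: l| <= e * `|h|) ->
  is_derive x 1 f l.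
Proof.
move=> H.
suff cl : h^-1 *: ((f \o shift x) (h *: 1) - f x) @[h --> 0^'] --> l.
  apply: DeriveDef; first by apply/cvg_ex; exists l.
  exact: cvg_lim cl.
apply/cvgrPdist_le => e e0; have [d d0 dP] := H e e0.
apply/nbhs_distP; exists d => // h; rewrite sub0r normrN => hd h0.
have := dP h hd => E.
rewrite /= [h *: 1]mulr1 [h + x]addrC.
have -> : l - h^-1 *: (f (x + h) - f x) = - (h^-1 *: (f (x + h) - f x - h *: l)).
  by rewrite [in RHS]scalerBr scalerA mulVf// scale1r opprB.
by rewrite normrN normrZ normfV mulrC ler_pdivrMr ?normr_gt0.
Qed.

End OneVariable.

Section Rectangles.
Context {R : realType}.
Local Notation C := (Cx R).
Local Notation Re := (@complex.Re R).
Local Notation Im := (@complex.Im R).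

Definition cpair (x y : R) : C := (x +i* y)%C.
Definition btw (a b x : R) := (a <= x <= b) || (b <= x <= a).
Definition inrect (a b c d : R) (z : C) := btw a b (Re z) && btw c d (Im z).
Definition ii : C := ('i)%C.

Lemma norm_cpair_sub x y x' y' :
  `|cpair x y - cpair x' y'| <= ((`|x - x'| + `|y - y'|)%:C)%C.
Proof. exact: norm_le_ReIm. Qed.

Lemma norm_ii : `|ii| = 1.
Proof. by rewrite normc_def /= expr0n expr1n add0r sqrtr1. Qed.

Lemma continuous_hline (f : C -> C) (c : R) : continuous f ->
  continuous (fun x => f (cpair x c)).
Proof.
move=> cf x; apply: (@continuous_comp _ _ _ (cpair ^~ c) f); last exact: cf.
apply/(@continuous_distP R C R C) => e e0; exists (Re e); first exact: gt0_Re.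
move=> y xy; rewrite [in ltRHS](ge0_real_part (ltW e0)).
by apply: le_lt_trans (norm_cpair_sub _ _ _ _) _; rewrite subrr normr0 addr0 ltcR.
Qed.

Lemma continuous_vline (f : C -> C) (a : R) : continuous f ->
  continuous (fun y => f (cpair a y)).
Proof.
move=> cf x; apply: (@continuous_comp _ _ _ (cpair a) f); last exact: cf.
apply/(@continuous_distP R C R C) => e e0; exists (Re e); first exact: gt0_Re.
move=> y xy; rewrite [in ltRHS](ge0_real_part (ltW e0)).
by apply: le_lt_trans (norm_cpair_sub _ _ _ _) _; rewrite subrr normr0 add0r ltcR.
Qed.

(* Oriented: exchanging a and b, or c and d, changes the sign, so that rectangles can
   be split at arbitrary points. *)
Definition rectint (f : C -> C) (a b c d : R) : C :=
  segint (fun x => f (cpair x c)) a b - segint (fun x => f (cpair x d)) a b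
  + ii * (segint (fun y => f (cpair b y)) c d - segint (fun y => f (cpair a y)) c d).

Lemma rectint_hsplit f a b e c d :
  rectint f a b c d + rectint f b e c d = rectint f a e c d.
Proof. by rewrite /rectint -!(segint_split _ a b e); ring. Qed.

Lemma rectint_vsplit f a b c d e :
  rectint f a b c d + rectint f a b d e = rectint f a b c e.
Proof. by rewrite /rectint -!(segint_split _ c d e); ring. Qed.

Lemma rectint_hrev f a b c d : rectint f a b c d = - rectint f b a c d.
Proof. by rewrite /rectint ![segint _ a b]segint_rev; ring. Qed.

Lemma rectint_vrev f a b c d : rectint f a b c d = - rectint f a b d c.
Proof. by rewrite /rectint ![segint _ c d]segint_rev; ring. Qed.

(* Weaker than continuity of f, which may have a pole inside the rectangle. *)
Definition bdcont (f : C -> C) (a b c d : R) :=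
  [/\ continuous (fun x => f (cpair x c)), continuous (fun x => f (cpair x d)),
      continuous (fun y => f (cpair a y)) & continuous (fun y => f (cpair b y))].

Lemma continuous_bdcont f a b c d : continuous f -> bdcont f a b c d.
Proof.
by move=> cf; split; [exact: continuous_hline|exact: continuous_hline|
  exact: continuous_vline|exact: continuous_vline].
Qed.

Section RectangleIntegral.
Variables a b c d : R.
Hypotheses (aI : -2 < a < 2) (bI : -2 < b < 2) (cI : -2 < c < 2) (dI : -2 < d < 2).

Lemma rectintD f g : bdcont f a b c d -> bdcont g a b c d ->
  rectint (fun z => f z + g z) a b c d = rectint f a b c d + rectint g a b c d.
Proof.
move=> [f1 f2 f3 f4] [g1 g2 g3 g4]; rewrite /rectint.
by rewrite (segintD f1 g1 aI bI) (segintD f2 g2 aI bI)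
  (segintD f3 g3 cI dI) (segintD f4 g4 cI dI); ring.
Qed.

Lemma rectintZ k f : bdcont f a b c d ->
  rectint (fun z => k * f z) a b c d = k * rectint f a b c d.
Proof.
move=> [f1 f2 f3 f4]; rewrite /rectint.
by rewrite (segintZ k f1 aI bI) (segintZ k f2 aI bI)
  (segintZ k f3 cI dI) (segintZ k f4 cI dI); ring.
Qed.

Lemma rectint1 : rectint (cst 1) a b c d = 0.
Proof. by rewrite /rectint !subrr; ring. Qed.

Lemma rectint_id : rectint id a b c d = 0.
Proof.
have cre : continuous (fun x : R => (x%:C)%C : C) by move=> x; exact: realC_continuous.
have cii : continuous (fun x : R => ii * (x%:C)%C).
  by move=> x; apply: (@cvgM C); [exact: cvg_cst|exact: cre].
have c1 : continuous (cst 1 : R -> C) by move=> x; exact: cvg_cst.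
have h e : segint (fun x => cpair x e) a b
    = ((((b ^+ 2 - a ^+ 2) / 2)%:C)%C + ii * (e%:C)%C * ((b - a)%:C)%C).
  have cie : continuous (fun x : R => ii * (e%:C)%C * cst 1 x).
    by move=> x; exact: cvg_cst.
  have E := segintD cre cie aI bI.
  rewrite (segintZ (ii * (e%:C)%C) c1 aI bI) (segint_id aI bI) (segint1 aI bI) in E.
  by rewrite -E; congr segint; apply/funext => x; apply: cx_ext => /=; ring.
have v e : segint (fun y => cpair e y) c d
    = (e%:C)%C * ((d - c)%:C)%C + ii * (((d ^+ 2 - c ^+ 2) / 2)%:C)%C.
  have cie : continuous (fun x : R => (e%:C)%C * cst 1 x : C).
    by move=> x; exact: cvg_cst.
  have E := segintD cie cii cI dI.
  rewrite (segintZ (e%:C)%C c1 cI dI) (segint1 cI dI) (segintZ ii cre cI dI)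
    (segint_id cI dI) in E.
  by rewrite -E; congr segint; apply/funext => x; apply: cx_ext => /=; ring.
rewrite /rectint !h !v; apply: cx_ext;
  rewrite ?(Re_add, Im_add, Re_opp, Im_opp, Re_mul, Im_mul) /=; ring.
Qed.

(** In each direction there are two sides, each with the factor 2 of [segint_norm_le]; this gives 4.
    The bound on [f] is required on the sides only, since [f] may have a pole inside. *)
Lemma rectint_norm_le f (M : C) : bdcont f a b c d ->
  (forall z, inrect a b c d z -> [|| Re z == a, Re z == b, Im z == c | Im z == d] ->
    `|f z| <= M) ->
  `|rectint f a b c d| <= 4 * M * ((`|b - a| + `|d - c|)%:C)%C.
Proof.
move=> [f1 f2 f3 f4] fM.
have Bl (x y : R) : btw x y x by rewrite /btw !lexx /= andbT; exact: le_total.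
have Br (x y : R) : btw x y y by rewrite /btw !lexx !andbT; exact: le_total.
have h1 := @segint_norm_le R _ a b M f1 aI bI.
have h2 := @segint_norm_le R _ a b M f2 aI bI.
have h3 := @segint_norm_le R _ c d M f3 cI dI.
have h4 := @segint_norm_le R _ c d M f4 cI dI.
rewrite /rectint.
apply: le_trans (ler_normD _ _) _; rewrite normrM norm_ii mul1r.
have -> : 4 * M * ((`|b - a| + `|d - c|)%:C)%C =
  (2 * M * ((`|b - a|)%:C)%C + 2 * M * ((`|b - a|)%:C)%C) +
  (2 * M * ((`|d - c|)%:C)%C + 2 * M * ((`|d - c|)%:C)%C).
  by rewrite rmorphD /=; ring.
apply: lerD; apply: le_trans (ler_normB _ _) _; apply: lerD.
- by apply: h1 => x xab; apply: fM; rewrite /inrect /= ?eqxx ?orbT// Bl andbT.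
- by apply: h2 => x xab; apply: fM; rewrite /inrect /= ?eqxx ?orbT// Br andbT.
- by apply: h4 => x xab; apply: fM; rewrite /inrect /= ?eqxx ?orbT// Br.
- by apply: h3 => x xab; apply: fM; rewrite /inrect /= ?eqxx ?orbT// Bl.
Qed.

End RectangleIntegral.

End Rectangles.

Section PointwiseContinuity.
Context {K : numFieldType} {T : topologicalType} (f g : T -> K).

Lemma continuous_cst (k : K) : continuous (fun _ : T => k).
Proof. by move=> x; exact: cvg_cst. Qed.

Lemma continuous_add : continuous f -> continuous g -> continuous (fun x => f x + g x).
Proof. by move=> cf cg x; apply: cvgD; [exact: cf|exact: cg]. Qed.

Lemma continuous_mul : continuous f -> continuous g -> continuous (fun x => f x * g x).
Proof. by move=> cf cg x; apply: cvgM; [exact: cf|exact: cg]. Qed.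

Lemma continuous_sub : continuous f -> continuous g -> continuous (fun x => f x - g x).
Proof. by move=> cf cg x; apply: cvgB; [exact: cf|exact: cg]. Qed.

End PointwiseContinuity.

Lemma continuous_idfun (T : topologicalType) : continuous (fun x : T => x).
Proof. by move=> x; exact: cvg_id. Qed.

Lemma norm_small_eq0 (K : numFieldType) (V : normedModType K) (x : V) (S : K) :
  0 <= S -> (forall e, 0 < e -> `|x| <= e * S) -> x = 0.
Proof.
move=> S0 H; apply/eqP; case: eqVneq => // x0.
have S1 : 0 < S + 1 by rewrite ltr_wpDl.
have nx : 0 < `|x| by rewrite normr_gt0.
have := H _ (divr_gt0 nx S1).
by rewrite mulrAC ler_pdivlMr// ler_pM2l// gerDl ler10.
Qed.

Section Goursat.
Context {R : realType}.
Local Notation C := (Cx R).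
Local Notation Re := (@complex.Re R).
Local Notation Im := (@complex.Im R).

(** Every left end is below every right end, so the supremum of the left ends lies in all the
    intervals. *)
Lemma nested_intervals (x : nat -> R) (p : R) : 0 <= p ->
  (forall n, x n <= x n.+1 /\ x n.+1 + p / 2 ^+ n.+1 <= x n + p / 2 ^+ n) ->
  exists X, forall n, x n <= X /\ X <= x n + p / 2 ^+ n.
Proof.
move=> p0 H.
have up m n : (m <= n)%N -> x m <= x n /\ x n + p / 2 ^+ n <= x m + p / 2 ^+ m.
  elim: n => [|n IH]; first by rewrite leqn0 => /eqP ->.
  rewrite leq_eqVlt ltnS => /orP[/eqP -> //|/IH[h1 h2]].
  have [h3 h4] := H n; split; first exact: le_trans h1 h3.
  exact: le_trans h4 h2.
have pn n : 0 <= p / 2 ^+ n by rewrite divr_ge0 // exprn_ge0.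
have ub m n : x m <= x n + p / 2 ^+ n.
  case: (leqP m n) => [/up[h _]|/ltnW/up[_ h]].
    by apply: le_trans h _; rewrite lerDl.
  by apply: le_trans h; rewrite lerDl.
exists (sup (range x)) => n.
have ne : range x !=set0 by exists (x 0%N), 0%N.
split.
  apply: ub_le_sup; last by exists n.
  by exists (x 0%N + p / 2 ^+ 0) => _ [m _ <-]; exact: ub.
by apply: ge_sup => // _ [m _ <-]; exact: ub.
Qed.

(** The order of [C] is only partial, but moduli are real, so the four negations become strict
    inequalities; their sum contradicts the triangle inequality. *)
Lemma norm_quarter (a b c d t : C) : a = b + c + (d + t) ->
  [|| `|a| <= 4 * `|b|, `|a| <= 4 * `|c|, `|a| <= 4 * `|d| | `|a| <= 4 * `|t|].
Proof.
move=> ->; apply/negP => /negP; rewrite !negb_or.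
rewrite -!real_ltNge ?realM ?normr_real//; try exact: realn.
move=> /and4P[h1 h2 h3 h4].
have := ler_normD (b + c) (d + t); have := ler_normD b c; have := ler_normD d t.
move: (`|b + c + (d + t)|) (`|b|) (`|c|) (`|d|) (`|t|) (`|b + c|) (`|d + t|) h1 h2 h3 h4.
move=> A B D E F G H h1 h2 h3 h4 l1 l2 l3.
have : 4 * B + 4 * D + (4 * E + 4 * F) < A + A + (A + A).
  by do !apply: ltrD.
have -> : 4 * B + 4 * D + (4 * E + 4 * F) = 4 * (B + D + (E + F)) by ring.
have -> : A + A + (A + A) = 4 * A by ring.
rewrite ltr_pM2l// => /lt_le_trans/(_ l3)/lt_le_trans/(_ (lerD l2 l1)).
by rewrite ltxx.
Qed.

Lemma btw_dist (x h u X : R) : btw x (x + h) u -> x <= X -> X <= x + h ->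
  `|u - X| <= h.
Proof.
rewrite /btw => ux h1 h2; rewrite ler_norml.
by case/orP: ux => /andP[? ?]; apply/andP; split; lra.
Qed.

Lemma unit_window (x : R) : -1 <= x <= 1 -> -2 < x < 2.
Proof. by move=> /andP[? ?]; apply/andP; split; lra. Qed.

Section Bisection.
Variables (f : C -> C) (p q : R).

(** The state [s] is the lower left corner of a rectangle with sides p / 2^n and q / 2^n. The new
    state is the corner of a quarter that carries at least a quarter of the integral. *)
Lemma bisection_step n (s : R * R) : exists s' : R * R, 0 <= p -> 0 <= q ->
  [/\ s.1 <= s'.1 /\ s'.1 + p / 2 ^+ n.+1 <= s.1 + p / 2 ^+ n,
      s.2 <= s'.2 /\ s'.2 + q / 2 ^+ n.+1 <= s.2 + q / 2 ^+ n &
  `|rectint f s.1 (s.1 + p / 2 ^+ n) s.2 (s.2 + q / 2 ^+ n)| <=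
  4 * `|rectint f s'.1 (s'.1 + p / 2 ^+ n.+1) s'.2 (s'.2 + q / 2 ^+ n.+1)|].
Proof.
case: s => x y /=.
set h := p / 2 ^+ n.+1; set k := q / 2 ^+ n.+1.
have n2 : (2 ^+ n : R) != 0 by rewrite expf_neq0// pnatr_eq0.
have hE : p / 2 ^+ n = h + h by rewrite /h exprS; field.
have kE : q / 2 ^+ n = k + k by rewrite /k exprS; field.
rewrite hE kE.
have dec : rectint f x (x + (h + h)) y (y + (k + k)) =
  rectint f x (x + h) y (y + k) + rectint f (x + h) (x + h + h) y (y + k) +
  (rectint f x (x + h) (y + k) (y + k + k) +
   rectint f (x + h) (x + h + h) (y + k) (y + k + k)).
  by rewrite !rectint_hsplit rectint_vsplit !addrA.
have ge0 (r : R) : 0 <= r -> 0 <= r / 2 ^+ n.+1 by move=> r0; rewrite divr_ge0// exprn_ge0.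
have /or4P[] := norm_quarter dec => E;
  [exists (x, y)|exists (x + h, y)|exists (x, y + k)|exists (x + h, y + k)] => p0 q0;
  have := ge0 _ p0; have := ge0 _ q0; rewrite -/h -/k => k0 h0; split => //=; lra.
Qed.

End Bisection.

(** Goursat's bisection argument: the quarters shrink to a point [z], and near [z] the function
    differs from an affine one, whose integral vanishes, by an error small compared with the
    diameter. *)
Lemma goursat_ordered (f : C -> C) (a c p q : R) : continuous f ->
  0 <= p -> 0 <= q ->
  -1 <= a -> a + p <= 1 -> -1 <= c -> c + q <= 1 ->
  (forall z : C, a <= Re z <= a + p -> c <= Im z <= c + q -> differentiable f z) ->
  rectint f a (a + p) c (c + q) = 0.
Proof.
move=> cf p0 q0 a1 ap1 c1 cq1 df.
have [nx nxP] := choice (fun ns : nat * (R * R) => bisection_step f p q ns.1 ns.2).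
pose s := fix s n := if n is m.+1 then nx (m, s m) else (a, c).
have sP n := nxP (n, s n) p0 q0.
have [X XP] : exists X, forall n, (s n).1 <= X /\ X <= (s n).1 + p / 2 ^+ n.
  by apply: nested_intervals => // n; have [] := sP n.
have [Y YP] : exists Y, forall n, (s n).2 <= Y /\ Y <= (s n).2 + q / 2 ^+ n.
  by apply: nested_intervals => // n; have [] := sP n.
have nI n : [/\ a <= (s n).1, (s n).1 + p / 2 ^+ n <= a + p,
    c <= (s n).2 & (s n).2 + q / 2 ^+ n <= c + q].
  elim: n => [|n [h1 h2 h3 h4]]; first by rewrite /= !expr0 !divr1.
  have [[h5 h6] [h7 h8] _] := sP n; split.
  - exact: le_trans h1 h5.
  - exact: le_trans h6 h2.
  - exact: le_trans h3 h7.
  - exact: le_trans h8 h4.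
have Jn n : `|rectint f a (a + p) c (c + q)| <=
    4 ^+ n * `|rectint f (s n).1 ((s n).1 + p / 2 ^+ n) (s n).2 ((s n).2 + q / 2 ^+ n)|.
  elim: n => [|n IH]; first by rewrite /= !expr0 !divr1 mul1r.
  apply: le_trans IH _; rewrite exprSr -mulrA ler_wpM2l ?exprn_ge0//.
  by have [] := sP n.
pose z := cpair X Y.
have dfz : differentiable f z.
  by have [] := XP 0%N; have [] := YP 0%N; rewrite /= !expr0 !divr1 => ????;
    apply: df => /=; apply/andP.
(* After n bisections the half-perimeter is (p + q) / 2^n. The integrand is at most e times that,
   and [rectint_norm_le] contributes 4 times it again; the factor 4^n lost by bisecting cancels the
   square of 2^n. *)
suff H (e : C) : 0 < e -> `|rectint f a (a + p) c (c + q)| <=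
    e * (4 * (((p + q) ^+ 2)%:C)%C).
  by apply: norm_small_eq0 H; rewrite mulr_ge0// lecR sqr_ge0.
move=> e0; have [d d0 dP] := derive_approx dfz e0.
pose B := 'D_1 f z.
have [n nd] : exists n, (((p + q) / 2 ^+ n)%:C)%C < d.
  have d0' := gt0_Re d0.
  have dE := ge0_real_part (ltW d0).
  exists (Num.bound ((p + q) / Re d)); rewrite dE ltcR /=.
  rewrite ltr_pdivrMr ?exprn_gt0// mulrC -ltr_pdivrMr//.
  apply: lt_trans (archi_boundP _) _; first by rewrite divr_ge0 ?addr_ge0// ltW.
  by rewrite -natrX ltr_nat ltn_expl.
have [ha hb hc hd] := nI n.
set x := (s n).1; set y := (s n).2; set h := p / 2 ^+ n; set k := q / 2 ^+ n.
rewrite -/x -/y -/h -/k in ha hb hc hd.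
have h0 : 0 <= h by rewrite divr_ge0// exprn_ge0.
have k0 : 0 <= k by rewrite divr_ge0// exprn_ge0.
(* The remainder of [f] after its affine approximation at [z]. Its integral is that of [f], because
   constants and the identity integrate to 0 around a rectangle. *)
pose r w := f w - (f z - B * z) - B * w.
pose A := f z - B * z.
have cr1 : continuous (fun w : C => (- A) * cst 1 w) 
  by apply: continuous_mul; exact: continuous_cst.
have cr2 : continuous (fun w : C => (- B) * id w).
  by apply: continuous_mul; [exact: continuous_cst|exact: continuous_idfun].
have cr12 : continuous (fun w : C => (- A) * cst 1 w + (- B) * id w).
  by apply: continuous_add; [exact: cr1|exact: cr2].
have xI : -2 < x < 2 by apply/andP; split; lra.
have yI : -2 < y < 2 by apply/andP; split; lra.
have xhI : -2 < x + h < 2 by apply/andP; split; lra.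
have ykI : -2 < y + k < 2 by apply/andP; split; lra.
have rE : r = (fun w => f w + ((- A) * cst 1 w + (- B) * id w)).
  by apply/funext => w; rewrite /r /A /=; ring.
have cr : continuous r.
  by rewrite rE; apply: continuous_add; [exact: cf|exact: cr12].
have Jr : rectint r x (x + h) y (y + k) = rectint f x (x + h) y (y + k).
  have b1 : bdcont (fun _ : C => 1) x (x + h) y (y + k).
    by apply: continuous_bdcont; exact: continuous_cst.
  have b2 : bdcont (fun w : C => w) x (x + h) y (y + k).
    by apply: continuous_bdcont; exact: continuous_idfun.
  have bc g : continuous g -> bdcont g x (x + h) y (y + k) by exact: continuous_bdcont.
  rewrite rE (rectintD xI xhI yI ykI (bc _ cf) (bc _ cr12)).
  rewrite (rectintD xI xhI yI ykI (bc _ cr1) (bc _ cr2)).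
  rewrite (rectintZ xI xhI yI ykI (- A) b1) (rectintZ xI xhI yI ykI (- B) b2).
  by rewrite rectint1 (rectint_id xI xhI yI ykI) !mulr0 !addr0.
have := @rectint_norm_le R x (x + h) y (y + k) xI xhI yI ykI r
  (e * ((h + k)%:C)%C) (continuous_bdcont _ _ _ _ cr).
rewrite Jr => Jle; apply: le_trans (Jn n) _.
have {}Jle : `|rectint f x (x + h) y (y + k)| <=
   4 * (e * ((h + k)%:C)%C) * ((`|x + h - x| + `|y + k - y|)%:C)%C.
  apply: Jle => w /andP[wx wy] _.
  have [Xx Xh] := XP n; have [Yy Yk] := YP n.
  rewrite -/x -/y -/h -/k in Xx Xh Yy Yk.
  have wz : `|w - z| <= ((h + k)%:C)%C.
    apply: le_trans (norm_le_ReIm _) _; rewrite lecR Re_add Re_opp Im_add Im_opp /=.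
    exact: lerD (btw_dist wx Xx Xh) (btw_dist wy Yy Yk).
  have wd : `|w - z| < d by apply: le_lt_trans wz _; rewrite -mulrDl in nd *.
  have zwE : z + (w - z) = w by ring.
  have := dP _ wd; rewrite zwE => {}dP.
  apply: le_trans (le_trans dP (ler_wpM2l (ltW e0) wz)).
  suff -> : r w = f w - f z - (w - z) *: 'D_1 f z by [].
  by rewrite /r -/B /GRing.scale /=; ring.
apply: le_trans (ler_wpM2l _ Jle) _; first by rewrite exprn_ge0.
rewrite ![_ + _ - _]addrAC !subrr !add0r (ger0_norm h0) (ger0_norm k0).
have -> : h + k = (p + q) / 2 ^+ n by rewrite /h /k mulrDl.
have n2 : (2 : C) ^+ n != 0 by rewrite expf_neq0// pnatr_eq0.
have -> : 4 ^+ n = 2 ^+ n * 2 ^+ n :> C by rewrite -exprMn -natrM.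
rewrite !rmorphM fmorphV !rmorphXn /= rmorph_nat.
have eq_ler (u v : C) : u = v -> u <= v by move=> ->.
by apply: eq_ler; field.
Qed.

End Goursat.

(** * Exceptional points of rectangle integrals *)

Section CauchyEstimate.
Context {R : realType}.
Local Notation C := (Cx R).
Local Notation Re := (@complex.Re R).
Local Notation Im := (@complex.Im R).

(** The corners are unordered, in accordance with the oriented [rectint], and are confined to
    [-1, 1] so that all integrals stay in the window where [segint] is meaningful. *)
Definition rect_null (f : C -> C) (Q : C -> Prop) := forall a b c d : R,
  -1 <= a <= 1 -> -1 <= b <= 1 -> -1 <= c <= 1 -> -1 <= d <= 1 ->
  (forall z, inrect a b c d z -> Q z) -> rectint f a b c d = 0.

Lemma btwC (a b x : R) : btw a b x = btw b a x.
Proof. by rewrite /btw orbC. Qed.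

Lemma goursat (f : C -> C) : continuous f -> rect_null f (fun z => differentiable f z).
Proof.
move=> cf a b c d aI bI cI dI df.
wlog ab : a b aI bI df / a <= b => [H|].
  case: (leP a b) => [|/ltW] ab; first exact: H aI bI df ab.
  rewrite rectint_hrev (H b a bI aI _ ab) ?oppr0; first by [].
  by move=> z zin; apply: df; move: zin; rewrite /inrect btwC.
wlog cd : c d cI dI df / c <= d => [H|].
  case: (leP c d) => [|/ltW] cd; first exact: H cI dI df cd.
  rewrite rectint_vrev (H d c dI cI _ cd) ?oppr0; first by [].
  by move=> z zin; apply: df; move: zin; rewrite /inrect [btw d c _]btwC.
have -> : b = a + (b - a) by rewrite addrC subrK.
have -> : d = c + (d - c) by rewrite addrC subrK.
move: aI bI cI dI => /andP[a1 a2] /andP[b1 b2] /andP[c1 c2] /andP[d1 d2].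
have E (x y : R) : x + (y - x) = y by rewrite addrC subrK.
have ab' : 0 <= b - a by rewrite subr_ge0.
have cd' : 0 <= d - c by rewrite subr_ge0.
apply: (goursat_ordered cf ab' cd' a1 _ c1); rewrite !E; [exact: b2|exact: d2|].
by move=> z za zc; apply: df; rewrite /inrect /btw za zc.
Qed.

Lemma rectint_hdegen (f : C -> C) a c d : rectint f a a c d = 0.
Proof. by have /eqP := rectint_hsplit f a a a c d; rewrite -subr_eq0 addrK => /eqP. Qed.

Lemma rectint_vdegen (f : C -> C) a b c : rectint f a b c c = 0.
Proof. by have /eqP := rectint_vsplit f a b c c c; rewrite -subr_eq0 addrK => /eqP. Qed.

Lemma scaled_between (t u : R) : 0 < t <= 1 -> u != 0 ->
  (0 < t * u <= u) \/ (u <= t * u < 0).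
Proof.
move=> /andP[t0 t1] u0; case: (ltgtP u 0) u0 => // u0 _; [right|left].
  by rewrite pmulr_rlt0// u0 andbT ler_niMl// ltW.
by rewrite pmulr_rgt0// u0 /= ler_piMl// ltW.
Qed.

Lemma btwI (x y z : R) : -1 <= x <= 1 -> -1 <= y <= 1 -> btw x y z -> -1 <= z <= 1.
Proof.
by move=> /andP[? ?] /andP[? ?]; rewrite /btw => /orP[] /andP[? ?]; apply/andP; split; lra.
Qed.

Lemma btw_trans (x y s e z : R) : btw x y s -> btw x y e -> btw s e z -> btw x y z.
Proof.
by rewrite /btw => /orP[] /andP[? ?] /orP[] /andP[? ?] /orP[] /andP[? ?];
  apply/orP; (left + right); apply/andP; split; lra.
Qed.

Lemma btw_norm (u r x : R) : btw u (u + r) x -> `|u - x| <= `|r|.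
Proof.
by rewrite /btw ler_norml; case: (ger0P r) => r0 /orP[] /andP[? ?]; apply/andP; split; lra.
Qed.

(** A cut at the fraction [t] of the way from [p] to [e] separates the two: the part beyond the cut
    avoids [p]. *)
Lemma btw_scaled (t p e : R) : 0 < t <= 1 -> e != p ->
  btw p e (p + t * (e - p)) /\ ~~ btw (p + t * (e - p)) e p.
Proof.
rewrite -subr_eq0 => tI e0.
rewrite /btw; move: (t * (e - p)) (scaled_between tI e0) => v.
move=> {e0} H; split.
  by apply/orP; case: H => /andP[? ?]; [left|right]; apply/andP; split; lra.
by apply/negP => /orP[] /andP[? ?]; case: H => /andP[? ?]; lra.
Qed.

(** A rectangle around [p] is cut at [p] into four rectangles with a corner at [p]. Each of these
    can be shrunk towards [p] without changing its integral, since the parts removed avoid [p]. By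
    continuity the integrand stays bounded near [p] while the perimeter tends to 0. *)
Lemma rect_null_point (f : C -> C) (p : C) (Q : C -> Prop) : continuous f ->
  rect_null f (fun z => Q z /\ z <> p) -> rect_null f Q.
Proof.
move=> cf H a b c d aI bI cI dI Qabcd.
have [pin|pout] := boolP (inrect a b c d p); last first.
  apply: H => // z zin; split; first exact: Qabcd.
  by move=> zp; rewrite -zp zin in pout.
pose p1 := Re p; pose p2 := Im p.
have [/andP[pab pcd]] : inrect a b c d p by [].
have p1I := btwI aI bI pab; have p2I := btwI cI dI pcd.
rewrite -/p1 in p1I; rewrite -/p2 in p2I.
suff corner e g : btw a b e -> btw c d g -> rectint f p1 e p2 g = 0.
  have Bl (x y : R) : btw x y x by rewrite /btw !lexx /= andbT; exact: le_total.
  have Br (x y : R) : btw x y y by rewrite /btw !lexx !andbT; exact: le_total.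
  have h1 := rectint_hsplit f p1 a b c d.
  have h2 := rectint_vsplit f p1 a p2 c d.
  have h3 := rectint_vsplit f p1 b p2 c d.
  rewrite (corner a c (Bl _ _) (Bl _ _)) (corner a d (Bl _ _) (Br _ _)) add0r in h2.
  rewrite (corner b c (Br _ _) (Bl _ _)) (corner b d (Br _ _) (Br _ _)) add0r in h3.
  by rewrite h2 h3 add0r in h1.
move=> abe cdg.
have [->|ep] := eqVneq e p1; first exact: rectint_hdegen.
have [->|gp] := eqVneq g p2; first exact: rectint_vdegen.
have eI := btwI aI bI abe; have gI := btwI cI dI cdg.
pose et (t : R) := p1 + t * (e - p1).
pose gt (t : R) := p2 + t * (g - p2).
have btwet (t : R) tI := @btw_scaled t p1 e tI ep.
have btwgt (t : R) tI := @btw_scaled t p2 g tI gp.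
(* Cutting at [et t] and [gt t] leaves the small rectangle at [p] and two others, one on which the
   first coordinate and one on which the second coordinate differs from that of [p]. *)
have shrink (t : R) : 0 < t <= 1 -> rectint f p1 e p2 g = rectint f p1 (et t) p2 (gt t).
  move=> tI; have [et1 et2] := btwet t tI; have [gt1 gt2] := btwgt t tI.
  have etab : btw a b (et t) by exact: btw_trans pab abe et1.
  have gtcd : btw c d (gt t) by exact: btw_trans pcd cdg gt1.
  rewrite -(rectint_hsplit f p1 (et t) e) -(rectint_vsplit f p1 (et t) p2 (gt t) g).
  have etI := btwI aI bI etab; have gtI := btwI cI dI gtcd.
  rewrite [X in _ + X](H (et t) e p2 g etI eI p2I gI); last first.
    move=> z /andP[z1 z2]; split.
      by apply: Qabcd; rewrite /inrect (btw_trans etab abe z1) (btw_trans pcd cdg z2).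
    by move=> zp; rewrite zp -/p1 (negbTE et2) in z1.
  rewrite addr0 [X in _ + X](H p1 (et t) (gt t) g p1I etI gtI gI) ?addr0//.
  move=> z /andP[z1 z2]; split.
    by apply: Qabcd; rewrite /inrect (btw_trans pab etab z1) (btw_trans gtcd cdg z2).
  by move=> zp; rewrite zp -/p2 (negbTE gt2) in z2.
pose L : R := `|e - p1| + `|g - p2|.
have L0 : 0 <= L by rewrite addr_ge0.
apply: (@norm_small_eq0 C C _ (4 * (`|f p| + 1) * (L%:C)%C)).
  by rewrite !mulr_ge0// ?addr_ge0// lecR.
move=> eps eps0.
have [d0 d0_gt0 d0P] := (@continuous_distP C C C C f p).1 (cf p) 1 ltr01.
have d0E := ge0_real_part (ltW d0_gt0); have d0R := gt0_Re d0_gt0.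
have epsE := ge0_real_part (ltW eps0); have epsR := gt0_Re eps0.
(* The bound by [Re eps] makes the perimeter small; the last bound keeps the shrunken rectangle
   within [d0] of [p], where [f] is bounded by [|f p| + 1]. *)
pose t : R := Num.min 1 (Num.min (Re eps) (Re d0 / (2 * (L + 1)))).
have tI : 0 < t <= 1.
  by rewrite /t !lt_min ltr01 epsR /= divr_gt0 ?mulr_gt0 ?ltr_wpDl//= ge_min lexx.
have te : t <= Re eps by rewrite /t !ge_min lexx !orbT.
have td : t * L < Re d0.
  have : t <= Re d0 / (2 * (L + 1)) by rewrite /t !ge_min lexx !orbT.
  rewrite ler_pdivlMr ?mulr_gt0 ?ltr_wpDl// => tL.
  have := mulr_ge0 (ltW (proj1 (andP tI))) L0.
  by have /andP[? ?] := tI; nra.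
have [et1 et2] := btwet t tI; have [gt1 gt2] := btwgt t tI.
have etab : btw a b (et t) by exact: btw_trans pab abe et1.
have gtcd : btw c d (gt t) by exact: btw_trans pcd cdg gt1.
have := @rectint_norm_le R p1 (et t) p2 (gt t) (unit_window p1I) (unit_window (btwI aI bI etab))
  (unit_window p2I) (unit_window (btwI cI dI gtcd)) f (`|f p| + 1) (continuous_bdcont _ _ _ _ cf).
rewrite -shrink// => J.
have {}J : `|rectint f p1 e p2 g| <= 4 * (`|f p| + 1) *
    ((`|et t - p1| + `|gt t - p2|)%:C)%C.
  apply: J => z /andP[z1 z2] _.
  have : `|p - z| < d0.
    apply: le_lt_trans (norm_le_ReIm _) _; rewrite d0E ltcR Re_add Re_opp Im_add Im_opp.
    apply: le_lt_trans td; rewrite /L mulrDr.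
    have t0 : 0 <= t by have /andP[/ltW] := tI.
    have key (u v x : R) : btw u (u + t * (v - u)) x -> `|u - x| <= t * `|v - u|.
      rewrite -[t in t * `|_|](ger0_norm t0) -normrM; exact: btw_norm.
    exact: lerD (key _ _ _ z1) (key _ _ _ z2).
  move=> /d0P h; rewrite -lerBlDl; apply: le_trans (ltW h).
  by rewrite distrC; exact: lerB_dist.
apply: le_trans J _.
have -> : `|et t - p1| + `|gt t - p2| = t * L.
  have t0 : 0 <= t by have /andP[/ltW] := tI.
  by rewrite /et /gt ![_ + _ - _]addrAC !subrr !add0r !normrM (ger0_norm t0) -mulrDr.
rewrite rmorphM /= mulrCA mulrC [leRHS]mulrC.
rewrite ler_wpM2l//; first by rewrite !mulr_ge0// ?addr_ge0// lecR.
by rewrite epsE lecR.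
Qed.

End CauchyEstimate.

(** * Cauchy estimates *)

Section ContinuousAt.
Context {K : numFieldType} {T : topologicalType}.

Lemma near_eq_continuous (f g : T -> K) x : (\forall z \near x, f z = g z) ->
  {for x, continuous g} -> {for x, continuous f}.
Proof.
move=> fg cg; have fgx : f x = g x := nbhs_singleton fg.
rewrite /prop_for /continuous_at fgx; apply: cvg_trans cg.
by apply: near_eq_cvg; apply: filterS fg.
Qed.

Lemma continuous_at_mul (f g : T -> K) x : {for x, continuous f} ->
  {for x, continuous g} -> {for x, continuous (fun z => f z * g z)}.
Proof. by move=> cf cg; apply: cvgM. Qed.

Lemma continuous_at_inv (f : T -> K) x : {for x, continuous f} -> f x != 0 ->
  {for x, continuous (fun z => (f z)^-1)}.
Proof. by move=> cf f0; apply: cvgV. Qed.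

End ContinuousAt.

Lemma near_eq_derive (K : numFieldType) (V W : normedModType K) (f g : V -> W) (z v : V) :
  (\forall y \near z, f y = g y) -> differentiable g z -> 'D_v f z = 'D_v g z.
Proof.
move=> fg dg; apply: derive_val; apply: (@near_eq_is_derive _ _ _ g).
  by apply: filterS fg.
by apply: derivableP; exact: diff_derivable.
Qed.

(** * Difference quotients and Cauchy's formula on a square *)

Section DifferenceQuotient.
Context {R : realType}.
Local Notation C := (Cx R).
Local Notation Re := (@complex.Re R).
Local Notation Im := (@complex.Im R).

Definition dquot (u : C -> C) (w z : C) : C :=
  if z == w then 'D_1 u w else (u z - u w) / (z - w).

Lemma near_neq (K : numFieldType) (V : normedModType K) (x y : V) :
  x != y -> \forall z \near x, z != y.
Proof.
move=> xy; apply/nbhs_distP; exists `|x - y|; first by rewrite normr_gt0 subr_eq0.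
by move=> z; apply: contraTneq => ->; rewrite ltxx.
Qed.

Lemma differentiable_div (f g : C -> C) (z : C) :
  differentiable f z -> differentiable g z -> g z != 0 ->
  differentiable (fun x => f x / g x) z.
Proof.
by move=> df dg gz; apply: differentiableM => //; apply: differentiableV.
Qed.

Lemma dquot_differentiable u (w z : C) : differentiable u z -> z != w ->
  differentiable (dquot u w) z.
Proof.
move=> du zw.
apply: (@near_eq_differentiable C C C _ (fun z => (u z - u w) / (z - w))).
  have := @near_neq C C z w zw; apply: filterS => x xw.
  by rewrite /dquot (negbTE xw).
apply: differentiable_div; last by rewrite subr_eq0.
  by apply: differentiableB => //; exact: differentiable_cst.
by apply: differentiableB => //; exact: differentiable_cst.
Qed.

Lemma dquot_continuous u (w : C) : continuous u -> differentiable u w ->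
  continuous (dquot u w).
Proof.
move=> cu du z; have [->|zw] := eqVneq z w.
  apply/(@continuous_distP C C C C) => e e0.
  have e2 : 0 < e / 2 by rewrite divr_gt0.
  have [d d0 dP] := derive_approx du e2; exists d => // y wy.
  rewrite /dquot eqxx; case: (eqVneq y w) => [|yw]; first by rewrite subrr normr0.
  have yw0 : y - w != 0 by rewrite subr_eq0.
  have := dP (y - w); rewrite distrC => /(_ wy).
  have -> : w + (y - w) = y by ring.
  move=> h; rewrite distrC.
  have -> : (u y - u w) / (y - w) - 'D_1 u w =
    (u y - u w - (y - w) *: 'D_1 u w) / (y - w).
    by rewrite /GRing.scale /=; field.
  rewrite normrM normfV; apply: (@le_lt_trans _ _ (e / 2)); last first.
    by rewrite ltr_pdivrMr// ltr_pMr// ltr1n.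
  by rewrite ler_pdivrMr ?normr_gt0// [X in _ <= _ * X]distrC.
apply: (@near_eq_continuous C C _ (fun z => (u z - u w) / (z - w))).
  have := @near_neq C C z w zw; apply: filterS => x xw.
  by rewrite /dquot (negbTE xw).
apply: (@continuous_at_mul C C).
  by apply: (@continuous_sub C C); [exact: cu|exact: continuous_cst].
apply: (@continuous_at_inv C C); last by rewrite subr_eq0.
by apply: (@continuous_sub C C); [exact: continuous_idfun|exact: continuous_cst].
Qed.

End DifferenceQuotient.

Section CauchyFormula.
Context {R : realType}.
Local Notation C := (Cx R).
Local Notation Re := (@complex.Re R).
Local Notation Im := (@complex.Im R).

Local Notation K u := (rectint u (-1) 1 (-1) 1).
Local Notation Q z := (inrect (-1) 1 (-1) 1 z).

Lemma btw_unit (x : R) : -1 <= x <= 1 -> btw (-1) 1 x.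
Proof. by rewrite /btw => ->. Qed.

(** These points keep a distance of at least 1/2 from the sides of the square with corners at 1 and
    -1 in each coordinate, so 1 / (z - w) is bounded by 2 on the sides. *)
Definition half_square (z : C) := -2^-1 <= Re z <= 2^-1 /\ -2^-1 <= Im z <= 2^-1.

Lemma window1 : -2 < (1 : R) < 2. Proof. by apply/andP; split; lra. Qed.
Lemma windowN1 : -2 < (-1 : R) < 2. Proof. by apply/andP; split; lra. Qed.

Lemma continuous_at_bd (f : C -> C) (w : C) : half_square w ->
  (forall z, z != w -> {for z, continuous f}) -> bdcont f (-1) 1 (-1) 1.
Proof.
move=> [/andP[w1 w2] /andP[w3 w4]] cf.
have hl (c : R) : c = 1 \/ c = -1 -> continuous (fun x => f (cpair x c)).
  move=> c1 x; apply: (@continuous_comp _ _ _ (cpair ^~ c) f).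
    exact: (@continuous_hline R id c (@continuous_idfun C)).
  apply: cf; apply/eqP => E; have := congr1 Im E => /=.
  by case: c1 => -> h; lra.
have vl (c : R) : c = 1 \/ c = -1 -> continuous (fun x => f (cpair c x)).
  move=> c1 x; apply: (@continuous_comp _ _ _ (cpair c) f).
    exact: (@continuous_vline R id c (@continuous_idfun C)).
  apply: cf; apply/eqP => E; have := congr1 Re E => /=.
  by case: c1 => -> h; lra.
by split; [apply: hl; right|apply: hl; left|apply: vl; right|apply: vl; left].
Qed.

Lemma rectint_ext (f g : C -> C) w : half_square w -> (forall z, z != w -> f z = g z) -> K f = K g.
Proof.
move=> [/andP[w1 w2] /andP[w3 w4]] fg.
have hl (c : R) : c = 1 \/ c = -1 -> (fun x => f (cpair x c)) = (fun x => g (cpair x c)).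
  move=> c1; apply/funext => x.
  apply: fg; apply/eqP => E; have := congr1 Im E => /=.
  by case: c1 => -> h; lra.
have vl (c : R) : c = 1 \/ c = -1 -> (fun x => f (cpair c x)) = (fun x => g (cpair c x)).
  move=> c1; apply/funext => x.
  apply: fg; apply/eqP => E; have := congr1 Re E => /=.
  by case: c1 => -> h; lra.
rewrite /rectint (hl 1 (or_introl erefl)) (hl (-1) (or_intror erefl)).
by rewrite (vl 1 (or_introl erefl)) (vl (-1) (or_intror erefl)).
Qed.

Lemma continuous_at_div_sub (u : C -> C) (w z : C) : continuous u -> z != w ->
  {for z, continuous (fun z => u z / (z - w))}.
Proof.
move=> cu zw; apply: (@continuous_at_mul C C); first exact: cu.
apply: (@continuous_at_inv C C); last by rewrite subr_eq0.
by apply: (@continuous_sub C C); [exact: continuous_idfun|exact: continuous_cst].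
Qed.

(* [u] may fail to be differentiable at [p]; this is what allows the formula to be
   applied to difference quotients. *)
Lemma cauchy_formula (u : C -> C) (p w : C) : continuous u ->
  (forall z, Q z -> z <> p -> differentiable u z) -> half_square w -> w <> p ->
  u w * K (fun z => 1 / (z - w)) = K (fun z => u z / (z - w)).
Proof.
move=> cu du hw wp.
have Qw : Q w.
  case: hw => /andP[? ?] /andP[? ?].
  by rewrite /inrect !btw_unit//; apply/andP; split; lra.
have cv := dquot_continuous cu (du w Qw wp).
(* There are two exceptional points: [p], where [u] itself may fail to be differentiable, and [w],
   where the quotient is only known to be continuous. *)
have N : rect_null (dquot u w) (fun z => Q z).
  apply: (rect_null_point (p := p) cv); apply: (rect_null_point (p := w) cv).
  move=> a b c d aI bI cI dI H; apply: (goursat cv aI bI cI dI) => z /H[[Qz zp] /eqP zw].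
  by apply: dquot_differentiable; [exact: du|exact: zw].
have nI : -1 <= (-1 : R) <= 1 by rewrite lexx /=; lra.
have pI : -1 <= (1 : R) <= 1 by rewrite lexx andbT; lra.
have K0 : K (dquot u w) = 0 by apply: (N _ _ _ _ nI pI nI pI).
have c1 : bdcont (fun z => 1 / (z - w)) (-1) 1 (-1) 1.
  by apply: (continuous_at_bd hw) => z zw; apply: continuous_at_div_sub zw; exact: continuous_cst.
have c2 : bdcont (fun z => u z / (z - w)) (-1) 1 (-1) 1.
  by apply: (continuous_at_bd hw) => z zw; exact: continuous_at_div_sub.
have c3 : bdcont (dquot u w) (-1) 1 (-1) 1 by exact: continuous_bdcont.
rewrite -(rectintZ windowN1 window1 windowN1 window1 (u w) c1) -[LHS]add0r -K0.
have c4 : bdcont (fun z => u w * (1 / (z - w))) (-1) 1 (-1) 1.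
  apply: (continuous_at_bd hw) => z zw; apply: (@continuous_at_mul C C).
    exact: continuous_cst.
  by apply: continuous_at_div_sub zw; exact: continuous_cst.
rewrite -(rectintD windowN1 window1 windowN1 window1 c3 c4).
apply: (rectint_ext hw) => z zw; rewrite /dquot (negbTE zw).
have zw0 : z - w != 0 by rewrite subr_eq0.
by field.
Qed.

End CauchyFormula.

(** * Bounds from Cauchy's formula *)

Section CauchyBounds.
Context {R : realType}.
Local Notation C := (Cx R).
Local Notation Re := (@complex.Re R).
Local Notation Im := (@complex.Im R).
Local Notation K u := (rectint u (-1) 1 (-1) 1).
Local Notation Q z := (inrect (-1) 1 (-1) 1 z).

Lemma Re_inv (z : C) : Re (z^-1) = Re z / (Re z ^+ 2 + Im z ^+ 2).
Proof. by case: z. Qed.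

Lemma Im_inv (z : C) : Im (z^-1) = - Im z / (Re z ^+ 2 + Im z ^+ 2).
Proof. by case: z => a b /=; rewrite mulNr. Qed.

(** Here [r] and [s] are the components of z - w along and across a side of the square, up to sign,
    for z on that side and w in [half_square]. From (3/2 - s)(s - 1/2) >= 0 the denominator is at
    most 3/2 + 2 s, hence at most 5 s; 1/16 is a crude bound. *)
Lemma div_sqr_ge (r s : R) : -(3 / 2) <= r <= 3 / 2 -> 2^-1 <= s <= 3 / 2 ->
  16^-1 <= s / (r ^+ 2 + s ^+ 2).
Proof.
move=> /andP[r1 r2] /andP[s1 s2].
have N0 : 0 < r ^+ 2 + s ^+ 2 by rewrite ltr_wpDl ?sqr_ge0// exprn_gt0//; lra.
rewrite ler_pdivlMr// !expr2.
have h1 : 0 <= (3 / 2 - r) * (r + 3 / 2) by apply: mulr_ge0; lra.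
have h2 : 0 <= (3 / 2 - s) * (s - 2^-1) by apply: mulr_ge0; lra.
lra.
Qed.

Lemma pole_bdcont (w : C) : half_square w -> bdcont (fun z => 1 / (z - w)) (-1) 1 (-1) 1.
Proof.
move=> hw; apply: (continuous_at_bd hw) => z zw.
by apply: continuous_at_div_sub zw; exact: continuous_cst.
Qed.

(** The integral equals 2 pi i, but only its distance from 0 matters. Along each side the
    contribution to the imaginary part has an integrand of at least 1/16 by [div_sqr_ge]; over a
    length of 2 this is 1/8, and there are four sides. *)
Lemma winding_ge (w : C) : half_square w -> 2^-1 <= `|K (fun z => 1 / (z - w))|.
Proof.
move=> hw; have [b1 b2 b3 b4] := pole_bdcont hw.
case: hw => /andP[w1 w2] /andP[w3 w4].
have le11 : (-1 : R) <= 1 by lra.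
have N (f : R -> C) : continuous f -> segint (fun x => -1 * f x) (-1) 1 = - segint f (-1) 1.
  by move=> cf; rewrite (segintZ (-1) cf windowN1 window1) mulN1r.
have cN (f : R -> C) : continuous f -> continuous (fun x : R => -1 * f x : C).
  by move=> cf; apply: continuous_mul; [exact: continuous_cst|exact: cf].
have h1 := segint_Im_ge b1 le11 windowN1 window1 (m := 16^-1).
have h2 := segint_Im_ge (cN _ b2) le11 windowN1 window1 (m := 16^-1).
have h3 := segint_Re_ge (cN _ b3) le11 windowN1 window1 (m := 16^-1).
have h4 := segint_Re_ge b4 le11 windowN1 window1 (m := 16^-1).
rewrite (N _ b2) Im_opp in h2; rewrite (N _ b3) Re_opp in h3.
set S1 := segint _ _ _ in h1; set S2 := segint _ _ _ in h2.
set S3 := segint _ _ _ in h3; set S4 := segint _ _ _ in h4.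
have KE : K (fun z => 1 / (z - w)) = S1 - S2 + ii * (S4 - S3) by [].
have {}h1 : 16^-1 * (1 - -1) <= Im S1.
  apply: h1 => x /andP[x1 x2]; rewrite div1r Im_inv Re_add Im_add Re_opp Im_opp /=.
  by rewrite -[_ ^+ 2 in X in _ <= _ / (_ + X)]sqrrN; apply: div_sqr_ge; apply/andP; split; lra.
have {}h2 : 16^-1 * (1 - -1) <= - Im S2.
  apply: h2 => x /andP[x1 x2];
    rewrite div1r mulN1r Im_opp Im_inv Re_add Im_add Re_opp Im_opp /= mulNr opprK.
  by apply: div_sqr_ge; apply/andP; split; lra.
have {}h3 : 16^-1 * (1 - -1) <= - Re S3.
  apply: h3 => x /andP[x1 x2];
    rewrite div1r mulN1r Re_opp Re_inv Re_add Im_add Re_opp Im_opp /= -mulNr.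
  by rewrite -[_ ^+ 2 in X in _ <= _ / (X + _)]sqrrN [X in _ / X]addrC; apply: div_sqr_ge;
    apply/andP; split; lra.
have {}h4 : 16^-1 * (1 - -1) <= Re S4.
  apply: h4 => x /andP[x1 x2]; rewrite div1r Re_inv Re_add Im_add Re_opp Im_opp /=.
  by rewrite [X in _ / X]addrC; apply: div_sqr_ge; apply/andP; split; lra.
have : 2^-1 <= `|Im (K (fun z => 1 / (z - w)))|.
  apply: le_trans (ler_norm _); rewrite KE !(Re_add, Im_add, Re_opp, Im_opp, Re_mul, Im_mul).
  have -> : Re ii = 0 by [].
  have -> : Im ii = 1 by [].
  move: h1 h2 h3 h4; move: (Im S1) (Im S2) (Re S3) (Re S4) (Im S3) (Im S4) => a b c d e f; lra.
rewrite -lecR => h; apply: le_trans (norm_Im_le _); apply: le_trans h.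
by rewrite fmorphV rmorph_nat.
Qed.

Definition onbd (z : C) := Q z /\ [|| Re z == -1, Re z == 1, Im z == -1 | Im z == 1].

(* 16 = 4 * (2 + 2), from rectint_norm_le for a square of side 2. *)
Lemma rectint_bd_le (f : C -> C) (M : C) : bdcont f (-1) 1 (-1) 1 ->
  (forall z, onbd z -> `|f z| <= M) -> `|K f| <= 16 * M.
Proof.
move=> bf fM.
have := @rectint_norm_le R (-1) 1 (-1) 1 windowN1 window1 windowN1 window1 f M bf.
have -> : `|1 - -1| + `|1 - -1| = 4 :> R.
  by rewrite opprK ger0_norm; lra.
rewrite rmorph_nat [4 * M]mulrC -mulrA -natrM mulrC; apply=> z Qz zb.
by apply: fM; split.
Qed.

Lemma onbd_dist (z w : C) : onbd z -> half_square w -> 2^-1 <= `|z - w|.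
Proof.
move=> [_ zb] [/andP[w1 w2] /andP[w3 w4]].
have E : (2^-1 : C) = ((2^-1 : R)%:C)%C by rewrite fmorphV rmorph_nat.
have hR : 2^-1 <= `|Re (z - w)| -> 2^-1 <= `|z - w|.
  by move=> h; rewrite E; apply: le_trans (norm_Re_le _); rewrite lecR.
have hI : 2^-1 <= `|Im (z - w)| -> 2^-1 <= `|z - w|.
  by move=> h; rewrite E; apply: le_trans (norm_Im_le _); rewrite lecR.
have nge (x : R) : 2^-1 <= x \/ 2^-1 <= - x -> 2^-1 <= `|x|.
  case=> h; first exact: le_trans h (ler_norm _).
  by rewrite -normrN; exact: le_trans h (ler_norm _).
case/or4P: zb => /eqP zE; [apply: hR|apply: hR|apply: hI|apply: hI];
 apply: nge; rewrite ?(Re_add, Re_opp, Im_add, Im_opp) zE; (left + right); lra.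
Qed.

Lemma onbd_norm (z : C) : onbd z -> 1 <= `|z|.
Proof.
move=> [_ zb].
have E : (1 : C) = ((1 : R)%:C)%C by [].
case/or4P: zb => /eqP zE; rewrite E.
- by apply: le_trans (norm_Re_le _); rewrite zE normrN1 lecR.
- by apply: le_trans (norm_Re_le _); rewrite zE normr1 lecR.
- by apply: le_trans (norm_Im_le _); rewrite zE normrN1 lecR.
- by apply: le_trans (norm_Im_le _); rewrite zE normr1 lecR.
Qed.

Lemma norm_half_square (w : C) : `|w| <= 2^-1 -> half_square w.
Proof.
have E : (2^-1 : C) = ((2^-1 : R)%:C)%C by rewrite fmorphV rmorph_nat.
rewrite E => w2; split; rewrite -ler_norml -lecR.
  exact: le_trans (norm_Re_le _) w2.
exact: le_trans (norm_Im_le _) w2.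
Qed.

Lemma bdcontD (f g : C -> C) (a b c d : R) : bdcont f a b c d -> bdcont g a b c d ->
  bdcont (fun z => f z + g z) a b c d.
Proof.
move=> [f1 f2 f3 f4] [g1 g2 g3 g4].
by split; [exact: (continuous_add f1 g1)|exact: (continuous_add f2 g2)|
  exact: (continuous_add f3 g3)|exact: (continuous_add f4 g4)].
Qed.

(** Serves also as a minimum of [d1] and [d2]: the order of [C] is not total, so the minimum is
    taken among the real parts. *)
Lemma small_point (d1 d2 : C) : 0 < d1 -> 0 < d2 ->
  exists w : C, [/\ w != 0, `|w| < d1, `|w| < d2 & `|w| <= 2^-1].
Proof.
move=> d10 d20.
pose r : R := Num.min (Re d1 / 2) (Num.min (Re d2 / 2) 2^-1).
have h1 := gt0_Re d10; have h2 := gt0_Re d20.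
have r0 : 0 < r by rewrite /r !lt_min !divr_gt0 //= invr_gt0.
exists (r%:C)%C; rewrite normC (gtr0_norm r0); split.
- by rewrite -normr_gt0 normC ltcR normr_gt0 gt_eqF.
- by rewrite (ge0_real_part (ltW d10)) ltcR !gt_min ltr_pdivrMr// ltr_pMr// ltr1n.
- by rewrite (ge0_real_part (ltW d20)) ltcR !gt_min [X in _ || (X || _)]ltr_pdivrMr//
    ltr_pMr// ltr1n !orbT.
- have -> : (2^-1 : C) = ((2^-1 : R)%:C)%C by rewrite fmorphV rmorph_nat.
  by rewrite lecR !ge_min lexx !orbT.
Qed.

(** On the sides, g(z) = (f z - f 0) / z is at most 2 M. Cauchy's formula bounds g w for w != 0,
    with 16 from [rectint_bd_le], one factor 2 from 1 / (z - w) and another from dividing by the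
    winding integral; letting w tend to 0 gives 128 M. For the second estimate f h - f 0 - h f'(0) =
    h u(h) with u = g - g(0), which is at most 130 M on the sides and is O(|h|) inside. *)
Lemma square_estimate (f : C -> C) (M : C) : continuous f ->
  (forall z, Q z -> differentiable f z) -> (forall z, Q z -> `|f z| <= M) ->
  `|'D_1 f 0| <= 128 * M /\ forall h, `|h| <= 2^-1 ->
  `|f h - f 0 - h * 'D_1 f 0| <= 2 * (16 * (130 * M * 4)) * `|h| ^+ 2.
Proof.
move=> cf df fM; pose g := dquot f 0.
have Q0 : Q (0 : C).
  by rewrite /inrect; apply/andP; split; apply: btw_unit => /=; apply/andP; split; lra.
have M0 : 0 <= M by apply: le_trans (fM 0 Q0).
have cg : continuous g := dquot_continuous cf (df 0 Q0).
have dg z : Q z -> z <> 0 -> differentiable g z.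
  by move=> Qz /eqP z0; apply: dquot_differentiable; [exact: df|exact: z0].
have g0 : g 0 = 'D_1 f 0 by rewrite /g /dquot eqxx.
have gE z : z != 0 -> g z = (f z - f 0) / z.
  by move=> z0; rewrite /g /dquot (negbTE z0) subr0.
have gbd z : onbd z -> `|g z| <= 2 * M.
  move=> zb; have z1 := onbd_norm zb.
  have z0 : 0 < `|z| by apply: lt_le_trans z1.
  rewrite gE -?normr_gt0// normrM normfV ler_pdivrMr//.
  apply: le_trans (ler_normB _ _) _; apply: (@le_trans _ _ (M + M)).
    by apply: lerD; apply: fM => //; case: zb.
  by rewrite -mulr2n -[M *+ 2]mulr_natl ler_peMr// mulr_ge0.
pose c (w : C) := K (fun z => 1 / (z - w)).
have inv_bd w z : half_square w -> onbd z -> `|(z - w)^-1| <= 2.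
  move=> hw zb; have zw := onbd_dist zb hw.
  have zw0 : 0 < `|z - w| by apply: lt_le_trans zw; rewrite invr_gt0.
  by rewrite normfV -[leRHS]invrK lef_pV2 ?posrE ?invr_gt0.
have div_bdcont (u : C -> C) (w : C) : continuous u -> half_square w ->
  bdcont (fun z => u z / (z - w)) (-1) 1 (-1) 1.
  by move=> cu hw; apply: (continuous_at_bd hw) => z zw; exact: continuous_at_div_sub.
have winding_div (x B w : C) : half_square w -> `|x * c w| <= B -> `|x| <= 2 * B.
  move=> hw; rewrite normrM => xB; rewrite -ler_pdivrMl//.
  apply: le_trans xB; rewrite mulrC ler_wpM2l//; exact: winding_ge.
have e1 (w : C) : half_square w -> w != 0 -> `|g w| <= 2 * (16 * (2 * M * 2)).
  move=> hw /eqP w0; apply: (winding_div _ _ w) => //.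
  rewrite /c (cauchy_formula cg dg hw w0).
  apply: rectint_bd_le; first exact: div_bdcont.
  by move=> z zb; rewrite normrM ler_pM// ?gbd// inv_bd.
have g0le : `|g 0| <= 2 * (16 * (2 * M * 2)).
  apply/ler_addgt0Pr => e e0.
  have [d d0 dP] := (@continuous_distP C C C C g 0).1 (cg 0) e e0.
  have [w [w0 wd _ wh]] := small_point d0 d0.
  have := dP w; rewrite sub0r normrN => /(_ wd) gw.
  rewrite -[g 0](subrK (g w)) addrC; apply: le_trans (ler_normD _ _) _.
  apply: lerD; last exact: ltW.
  by apply: e1 w0; exact: norm_half_square.
have E128 : 2 * (16 * (2 * M * 2)) = 128 * M by ring.
rewrite E128 in g0le.
split; first by rewrite -g0.
move=> h hh; have [->|h0] := eqVneq h 0.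
  by rewrite mul0r !subrr normr0 expr0n mulr0.
pose u (z : C) := g z - g 0.
have cu : continuous u by apply: continuous_sub; [exact: cg|exact: continuous_cst].
have du (z : C) : Q z -> z <> 0 -> differentiable u z.
  by move=> Qz z0; apply: differentiableB; [exact: dg|exact: differentiable_cst].
have ubd (z : C) : onbd z -> `|u z| <= 130 * M.
  move=> zb; apply: le_trans (ler_normB _ _) _.
  have -> : 130 * M = 2 * M + 128 * M by ring.
  by apply: lerD => //; exact: gbd.
pose D := 16 * (130 * M * 4).
have D0 : 0 <= D by rewrite !mulr_ge0.
have hhalf : half_square h by exact: norm_half_square.
have uh : `|u h * c h| <= D * `|h|.
  apply/ler_addgt0Pr => e e0.
  have e64 : 0 < e / 64 by rewrite divr_gt0.
  have eD : 0 < e / (2 * (D + 1)) by rewrite divr_gt0// mulr_gt0// ltr_wpDl.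
  have [d d0 dP] := (@continuous_distP C C C C u 0).1 (cu 0) _ e64.
  have [w [w0 wd wD wh]] := small_point d0 eD.
  have whalf : half_square w by exact: norm_half_square.
  have uw : `|u w| <= e / 64.
    have := dP w; rewrite sub0r normrN => /(_ wd).
    by rewrite {1}/u subrr sub0r normrN => /ltW.
  have cw : `|c w| <= 16 * 2.
    apply: rectint_bd_le; first exact: pole_bdcont.
    by move=> z zb; rewrite div1r inv_bd.
  have diff : `|u h * c h - u w * c w| <= D * `|h - w|.
    rewrite /c (cauchy_formula cu du hhalf (elimN eqP h0)).
    rewrite (cauchy_formula cu du whalf (elimN eqP w0)).
    have b1 := div_bdcont u h cu hhalf; have b2 := div_bdcont u w cu whalf.
    have bN : bdcont (fun z => -1 * (u z / (z - w))) (-1) 1 (-1) 1.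
      apply: (continuous_at_bd whalf) => z zw; apply: (@continuous_at_mul C C).
        exact: continuous_cst.
      exact: continuous_at_div_sub.
    rewrite -[X in _ + X]mulN1r -(rectintZ windowN1 window1 windowN1 window1 (-1) b2).
    rewrite -(rectintD windowN1 window1 windowN1 window1 b1 bN).
    have -> : D * `|h - w| = 16 * (130 * M * 4 * `|h - w|) by rewrite /D; ring.
    apply: rectint_bd_le.
      exact: bdcontD b1 bN.
    move=> z zb.
    have zh0 : z - h != 0.
      by rewrite -normr_gt0; apply: lt_le_trans (onbd_dist zb hhalf); rewrite invr_gt0.
    have zw0 : z - w != 0.
      by rewrite -normr_gt0; apply: lt_le_trans (onbd_dist zb whalf); rewrite invr_gt0.
    have -> : u z / (z - h) + -1 * (u z / (z - w)) =
      u z * ((z - h)^-1 * (z - w)^-1) * (h - w) by field; rewrite ?zh0 ?zw0.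
    rewrite normrM ler_wpM2r// normrM ler_pM// ?ubd// normrM.
    have -> : (4 : C) = 2 * 2 by rewrite -natrM.
    by apply: ler_pM; rewrite ?inv_bd.
  rewrite -[u h * c h](subrK (u w * c w)); apply: le_trans (ler_normD _ _) _.
  apply: le_trans (lerD diff (lexx _)) _.
  have : D * `|h - w| <= D * `|h| + e / 2.
    apply: (@le_trans _ _ (D * (`|h| + `|w|))); first by rewrite ler_wpM2l// ler_normB.
    rewrite mulrDr lerD2l; apply: (@le_trans _ _ ((D + 1) * `|w|)).
      by rewrite ler_wpM2r// lerDl.
    rewrite mulrC -ler_pdivlMr ?ltr_wpDl//; apply: le_trans (ltW wD) _.
    by rewrite invfM mulrA.
  move=> {}diff; apply: le_trans (lerD diff (lexx _)) _.
  rewrite -addrA lerD2l normrM.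
  apply: (@le_trans _ _ (e / 2 + (e / 64) * (16 * 2))); first by rewrite lerD2l ler_pM.
  have -> : e / 64 * (16 * 2) = e / 2 by field.
  by rewrite -splitr.
have {}uh := winding_div _ _ h hhalf uh.
have -> : f h - f 0 - h * 'D_1 f 0 = h * u h by rewrite /u gE// g0; field.
rewrite normrM expr2 -/D.
have -> : 2 * D * (`|h| * `|h|) = `|h| * (2 * (D * `|h|)) by ring.
by rewrite ler_wpM2l.
Qed.

End CauchyBounds.

Lemma differentiable_affine (K : numFieldType) (a b x : K) :
  differentiable (fun z => b + a * z) x.
Proof.
apply: differentiableD; first exact: differentiable_cst.
exact: (@differentiableZ K K K id a).
Qed.

(** * Estimates on discs, Liouville's theorem and partial derivatives *)

Section CauchyConsequences.
Context {R : realType}.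
Local Notation C := (Cx R).
Local Notation Re := (@complex.Re R).
Local Notation Im := (@complex.Im R).
Local Notation Q z := (inrect (-1) 1 (-1) 1 z).

(** Applied to both coordinates in [cclamp], this retracts the plane onto a square with a margin of
    1/4 around the square of integration. Composition with it makes a function given on a disc
    continuous everywhere, as the integral lemmas require, and leaves it unchanged near the square
    of integration. *)
Definition clamp (x : R) : R :=
  if x < -(5 / 4) then -(5 / 4) else if 5 / 4 < x then 5 / 4 else x.

Lemma clamp_lipschitz (x y : R) : `|clamp x - clamp y| <= `|x - y|.
Proof.
rewrite /clamp; case: (ltP x) => x1; case: (ltP y) => y1;
  do ?[case: (ltP _ x) => x2]; do ?[case: (ltP _ y) => y2];
  rewrite ler_norml; case: (ger0P (x - y)) => ?; apply/andP; split; lra.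
Qed.

Lemma clamp_le (x : R) : `|clamp x| <= 5 / 4.
Proof.
by rewrite /clamp ler_norml; case: (ltP x) => x1; do ?[case: (ltP _ x) => x2];
  apply/andP; split; lra.
Qed.

Lemma clampE (x : R) : -(5 / 4) <= x <= 5 / 4 -> clamp x = x.
Proof.
by move=> /andP[x1 x2]; rewrite /clamp ltNge x1 /= ltNge x2.
Qed.

Definition cclamp (z : C) : C := cpair (clamp (Re z)) (clamp (Im z)).

Lemma cclamp_continuous : continuous cclamp.
Proof.
move=> z; apply/(@continuous_distP C C C C) => e e0.
exists (e / 2) => [|y zy]; first by rewrite divr_gt0.
apply: (@le_lt_trans _ _ (`|z - y| + `|z - y|)); last by rewrite [e]splitr ltrD.
apply: le_trans (norm_cpair_sub _ _ _ _) _; rewrite rmorphD /=; apply: lerD.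
  apply: le_trans (norm_Re_le _); rewrite lecR Re_add Re_opp; exact: clamp_lipschitz.
apply: le_trans (norm_Im_le _); rewrite lecR Im_add Im_opp; exact: clamp_lipschitz.
Qed.

Lemma cclamp_norm (z : C) : `|cclamp z| < 3.
Proof.
apply: le_lt_trans (norm_le_ReIm _) _ => /=.
have -> : (3 : C) = ((3 : R)%:C)%C by rewrite rmorph_nat.
rewrite ltcR; have := clamp_le (Re z); have := clamp_le (Im z); lra.
Qed.

Lemma cclampE_near (z : C) : Q z -> \forall y \near z, cclamp y = y.
Proof.
move=> /andP[z1 z2]; apply/(@nbhs_distP C C).
have E : (4^-1 : C) = ((4^-1 : R)%:C)%C by rewrite fmorphV rmorph_nat.
exists 4^-1; first by rewrite invr_gt0.
move=> y zy; have hR := le_lt_trans (norm_Re_le _) zy.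
have hI := le_lt_trans (norm_Im_le _) zy.
move: hR hI; rewrite E !ltcR Re_add Re_opp Im_add Im_opp !ltr_norml => /andP[a b] /andP[c d].
have [z3 z4] : -1 <= Re z <= 1 /\ -1 <= Im z <= 1.
  by move: z1 z2; rewrite /btw => /orP[] /andP[? ?] /orP[] /andP[? ?]; split; apply/andP;
    split; lra.
move: z3 z4 => /andP[? ?] /andP[? ?].
by apply: cx_ext => /=; apply: clampE; apply/andP; split; lra.
Qed.

(** The radius 3 exceeds 5/4 + 5/4, which bounds the values of [cclamp]. The constant is the sum of
    the two constants of [square_estimate], so that one [A] serves both bounds. *)
Lemma unit_estimate : exists2 A : C, 0 <= A & forall (f : C -> C) (M : C),
  (forall z, `|z| < 3 -> differentiable f z) -> (forall z, `|z| < 3 -> `|f z| <= M) ->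
  `|'D_1 f 0| <= A * M /\ forall h, `|h| <= 2^-1 ->
  `|f h - f 0 - h * 'D_1 f 0| <= A * M * `|h| ^+ 2.
Proof.
exists (128 + 2 * (16 * (130 * 4))); first by rewrite addr_ge0// !mulr_ge0.
move=> f M df fM; pose g (z : C) := f (cclamp z).
have M0 : 0 <= M by apply: le_trans (fM 0 _) => //; rewrite normr0.
have cg : continuous g.
  move=> z; apply: (@continuous_comp _ _ _ cclamp f); first exact: cclamp_continuous.
  by apply: differentiable_continuous; apply: df; exact: cclamp_norm.
have ng z : Q z -> \forall y \near z, g y = f y.
  by move=> Qz; have := cclampE_near Qz; apply: filterS => y; rewrite /g => ->.
have small (z : C) : Q z -> `|z| < 3.
  move=> Qz; have := nbhs_singleton (cclampE_near Qz) => <-; exact: cclamp_norm.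
have dg (z : C) : Q z -> differentiable g z.
  by move=> Qz; apply: (near_eq_differentiable (ng z Qz)); apply: df; exact: small.
have Q0 : Q (0 : C).
  by rewrite /inrect; apply/andP; split; apply: btw_unit => /=; apply/andP; split; lra.
have gM (z : C) : Q z -> `|g z| <= M by move=> _; apply: fM; exact: cclamp_norm.
have [h1 h2] := square_estimate cg dg gM.
have gE (z : C) : Q z -> g z = f z by move=> Qz; exact: nbhs_singleton (ng z Qz).
have d0 : 'D_1 g 0 = 'D_1 f 0.
  by apply: near_eq_derive; [exact: ng|apply: df; exact: small].
rewrite d0 in h1 h2; split.
  by apply: le_trans h1 _; rewrite ler_wpM2r// lerDl !mulr_ge0.
move=> h hh; have := h2 h hh; rewrite !gE//; last first.
  have [/andP[? ?] /andP[? ?]] := norm_half_square hh.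
  by rewrite /inrect; apply/andP; split; apply: btw_unit => /=; apply/andP; split; lra.
move=> h3; apply: le_trans h3 _; rewrite ler_wpM2r ?exprn_ge0//.
have -> : 2 * (16 * (130 * M * 4)) = 2 * (16 * (130 * 4)) * M by ring.
by rewrite ler_wpM2r// lerDr.
Qed.

(** Rescaling by k = r / 3 reduces to [unit_estimate]. The factor 9 is the square of that 3, from
    the second-order term, and r / 6 is k / 2. *)
Lemma cauchy_estimate : exists2 A : C, 0 <= A &
  forall (f : C -> C) (z0 r M : C), 0 < r ->
  (forall z, `|z - z0| < r -> differentiable f z) ->
  (forall z, `|z - z0| < r -> `|f z| <= M) ->
  `|'D_1 f z0| <= A * M / r /\ forall h, `|h| <= r / 6 ->
  `|f (z0 + h) - f z0 - h * 'D_1 f z0| <= A * M * `|h| ^+ 2 / r ^+ 2.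
Proof.
have [A A0 AP] := unit_estimate; exists (9 * A); first by rewrite mulr_ge0.
move=> f z0 r M r0 df fM.
have M0 : 0 <= M by apply: le_trans (fM z0 _) => //; rewrite subrr normr0.
pose k := r / 3; have k0 : 0 < k by rewrite divr_gt0.
have k_neq0 : k != 0 by rewrite gt_eqF.
pose F (z : C) := f (z0 + k * z).
have inr z : `|z| < 3 -> `|z0 + k * z - z0| < r.
  move=> z3; rewrite addrAC subrr add0r normrM (gtr0_norm k0).
  by rewrite /k mulrAC ltr_pdivrMr// ltr_pM2l.
have dz0 : differentiable f z0 by apply: df; rewrite subrr normr0.
have dF z : `|z| < 3 -> differentiable F z.
  move=> z3; apply: (@differentiable_comp _ _ _ _ (fun z => z0 + k * z) f).
    exact: differentiable_affine.
  exact: df (inr z z3).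
have FM z : `|z| < 3 -> `|F z| <= M by move=> z3; exact: fM (inr z z3).
have [h1 h2] := AP F M dF FM.
have D : 'D_1 F 0 = k * 'D_1 f z0.
  apply: derive_val; apply: approx_derive => e e0.
  have e1 : 0 < e / k by rewrite divr_gt0.
  have [d d0 dP] := derive_approx dz0 e1.
  exists (d / k) => [|h hd]; first by rewrite divr_gt0.
  have := dP (k * h); rewrite normrM (gtr0_norm k0) mulrC -ltr_pdivlMr// => /(_ hd).
  rewrite mulrA [e / k * _]mulrAC divfK// /F add0r mulr0 addr0.
  suff -> : h *: (k * 'D_1 f z0) = (k * h) *: 'D_1 f z0 by [].
  by rewrite /GRing.scale /=; ring.
rewrite D in h1 h2; split.
  rewrite normrM (gtr0_norm k0) mulrC -ler_pdivlMr// in h1.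
  apply: le_trans h1 _; rewrite /k invfM invrK.
  have -> : A * M * (r^-1 * 3) = 3 * (A * M / r) by ring.
  have -> : 9 * A * M / r = 9 * (A * M / r) by ring.
  rewrite ler_wpM2r ?ler_nat//.
  by rewrite !mulr_ge0// invr_ge0 ltW.
move=> h hr; have := h2 (h / k); rewrite /F mulr0 addr0.
have -> : k * (h / k) = h by field.
have -> : h / k * (k * 'D_1 f z0) = h * 'D_1 f z0 by field.
rewrite normrM normfV (gtr0_norm k0) => h3; apply: le_trans (h3 _) _.
  rewrite ler_pdivrMr//; apply: le_trans hr _; rewrite /k.
  have -> : r / 6 = 2^-1 * (r / 3) by field.
  by [].
have r_neq0 : r != 0 by rewrite gt_eqF.
have -> // : A * M * (`|h| / k) ^+ 2 = 9 * A * M * `|h| ^+ 2 / r ^+ 2.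
by rewrite /k; field.
Qed.

Lemma liouville (f : C -> C) (M : C) : (forall z, differentiable f z) ->
  (forall z, `|f z| <= M) -> forall z, f z = f 0.
Proof.
move=> df fM z; have [A A0 AP] := cauchy_estimate.
have M0 : 0 <= M by apply: le_trans (fM 0).
have D0 : 'D_1 f 0 = 0.
  apply: (@norm_small_eq0 C C _ (A * M)) => [|e e0]; first by rewrite mulr_ge0.
  have [h _] := AP f 0 e^-1 M (ltac:(by rewrite invr_gt0)) (fun z _ => df z) (fun z _ => fM z).
  by rewrite invrK mulrC in h.
apply/eqP; rewrite -subr_eq0; apply/eqP.
apply: (@norm_small_eq0 C C _ (A * M * `|z| ^+ 2)) => [|e e0].
  by rewrite !mulr_ge0 ?exprn_ge0.
(* The summands ensure in turn 1 / r <= e, r >= 1, so that 1 / r^2 <= e as well, and |z| <= r / 6,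
   the range of the second-order estimate. *)
pose r := e^-1 + 1 + 6 * `|z|.
have ei : 0 < e^-1 by rewrite invr_gt0.
have r1 : 1 <= r by rewrite /r -addrA addrCA lerDl addr_ge0 ?mulr_ge0// ltW.
have re : e^-1 <= r by rewrite /r -addrA lerDl addr_ge0 ?mulr_ge0.
have r0 : 0 < r by apply: lt_le_trans r1.
have [_ h] := AP f 0 r M r0 (fun z _ => df z) (fun z _ => fM z).
have := h z; rewrite D0 mulr0 subr0 add0r => {}h.
apply: le_trans (h _) _.
  by rewrite ler_pdivlMr// mulrC /r lerDr addr_ge0// ltW.
rewrite mulrC ler_wpM2r//; first by rewrite !mulr_ge0 ?exprn_ge0.
rewrite -[leRHS]invrK lef_pV2 ?posrE ?exprn_gt0//.
by apply: le_trans re _; rewrite expr2 ler_peMl// ltW.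
Qed.

(** By hypothesis every lower bound q h - b |h| is below every upper bound q k + b |k|; the supremum
    of the lower bounds is the limit, with an explicit rate. *)
Lemma real_cauchy_limit (q : C -> R) (b : R) (d : C) : 0 < d -> 0 <= b ->
  (forall h k, h != 0 -> k != 0 -> `|h| <= d -> `|k| <= d ->
     `|q h - q k| <= b * (Re `|h| + Re `|k|)) ->
  exists L, forall h, h != 0 -> `|h| <= d -> `|q h - L| <= b * Re `|h|.
Proof.
move=> d0 b0 H.
pose S := [set x : R | exists2 h : C, h != 0 /\ `|h| <= d & x = q h - b * Re `|h|].
have le h k : h != 0 -> k != 0 -> `|h| <= d -> `|k| <= d ->
    q h - b * Re `|h| <= q k + b * Re `|k|.
  move=> h0 k0 hd kd; have := H h k h0 k0 hd kd.
  by rewrite ler_norml mulrDr => /andP[_]; lra.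
exists (sup S) => h h0 hd; rewrite ler_norml; apply/andP; split.
  rewrite lerBrDl -lerBrDr opprK; apply: ge_sup; first by exists (q h - b * Re `|h|), h.
  by move=> _ [k [k0 kd] ->]; exact: le.
rewrite lerBlDr -lerBlDl; apply: ub_le_sup; last by exists h.
by exists (q h + b * Re `|h|) => _ [k [k0 kd] ->]; exact: le.
Qed.

Lemma cauchy_limit (q : C -> C) (B d : C) : 0 < d -> 0 <= B ->
  (forall h k, h != 0 -> k != 0 -> `|h| <= d -> `|k| <= d ->
     `|q h - q k| <= B * (`|h| + `|k|)) ->
  exists L, forall h, h != 0 -> `|h| <= d -> `|q h - L| <= 2 * B * `|h|.
Proof.
move=> d0 B0 H.
have b0 : 0 <= Re B by rewrite -lecR -ge0_real_part.
have nE (h : C) : `|h| = ((Re `|h|)%:C)%C by apply: ge0_real_part.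
have BE := ge0_real_part B0.
have H' h k : h != 0 -> k != 0 -> `|h| <= d -> `|k| <= d ->
     `|q h - q k| <= ((Re B * (Re `|h| + Re `|k|))%:C)%C.
  move=> h0 k0 hd kd; apply: le_trans (H h k h0 k0 hd kd) _.
  by rewrite rmorphM rmorphD /= -BE -!nE.
have [L1 L1P] : exists L, forall h, h != 0 -> `|h| <= d -> `|Re (q h) - L| <= Re B * Re `|h|.
  apply: (real_cauchy_limit d0 b0) => h k h0 k0 hd kd.
  by rewrite -lecR -Re_opp -Re_add; apply: le_trans (norm_Re_le _) _; exact: H'.
have [L2 L2P] : exists L, forall h, h != 0 -> `|h| <= d -> `|Im (q h) - L| <= Re B * Re `|h|.
  apply: (real_cauchy_limit d0 b0) => h k h0 k0 hd kd.
  by rewrite -lecR -Im_opp -Im_add; apply: le_trans (norm_Im_le _) _; exact: H'.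
exists (cpair L1 L2) => h h0 hd.
apply: le_trans (norm_le_ReIm _) _; rewrite Re_add Im_add Re_opp Im_opp /=.
have -> : 2 * B * `|h| = ((Re B * Re `|h| + Re B * Re `|h|)%:C)%C.
  by rewrite rmorphD rmorphM /= -BE -nE; ring.
by rewrite lecR lerD// ?L1P ?L2P.
Qed.

Lemma differentiable_slice1 (W : normedModType C) (F : C * C -> W) (z w : C) :
  differentiable F (z, w) -> differentiable (fun x => F (x, w)) z.
Proof.
move=> dF; apply: (@differentiable_comp _ _ _ _ (fun x => (x, w)) F) => //.
Qed.

Lemma differentiable_slice2 (W : normedModType C) (F : C * C -> W) (z w : C) :
  differentiable F (z, w) -> differentiable (fun x => F (z, x)) w.
Proof.
move=> dF; apply: (@differentiable_comp _ _ _ _ (fun x => (z, x)) F) => //.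
Qed.

Lemma near_pair_dist (z w : C) (P : set (C * C)) : (\forall p \near (z, w), P p) ->
  exists2 d : C, 0 < d & forall x y, `|x - z| < d -> `|y - w| < d -> P (x, y).
Proof.
move=> [[A B] /= [nA nB] AB].
have [a a0 aA] := (@nbhs_distP C C z A).1 nA.
have [b b0 bB] := (@nbhs_distP C C w B).1 nB.
have [d [d0 da db _]] := small_point a0 b0.
exists `|d|; first by rewrite normr_gt0.
move=> x y xd yd; apply: (AB (x, y)); split => /=.
  by apply: aA; rewrite distrC; exact: lt_trans xd da.
by apply: bB; rewrite distrC; exact: lt_trans yd db.
Qed.

Lemma sub_scale_div (a b c : C) : b != 0 -> a - b *: c = (a / b - c) * b.
Proof. by move=> b0; rewrite /GRing.scale /=; field. Qed.

(* By the Cauchy estimate in z, the difference quotients of F in z converge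
   uniformly in w; by the one in w, so do their w-derivatives. *)
Lemma differentiable_partial (F : C * C -> C) (z0 w0 : C) :
  (\forall p \near (z0, w0), differentiable F p) ->
  differentiable (fun z => 'D_1 (fun w => F (z, w)) w0) z0.
Proof.
move=> dF; have [A A0 AP] := cauchy_estimate.
have F00 : differentiable F (z0, w0) by exact: nbhs_singleton dF.
have bF : \forall p \near (z0, w0), `|F p| <= `|F (z0, w0)| + 1.
  have : \forall p \near (z0, w0), `|F (z0, w0) - F p| < 1.
    exact: (differentiable_continuous F00 (near_dist (F (z0, w0)) ltr01)).
  apply: filterS => p /= h.
  rewrite -lerBlDl; apply: le_trans (ltW h); rewrite distrC; exact: lerB_dist.
have [d d0 dP] := near_pair_dist (filterI dF bF).
set M := `|F (z0, w0)| + 1 in dP.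
have M0 : 0 <= M by rewrite addr_ge0.
have d_neq0 : d != 0 by rewrite gt_eqF.
have self (x : C) : `|x - x| < d by rewrite subrr normr0.
pose psi (z : C) := 'D_1 (fun w => F (z, w)) w0.
pose q (h : C) := (psi (z0 + h) - psi z0) / h.
pose DF (h w : C) := (F (z0 + h, w) - F (z0, w)) / h.
pose g (w : C) := 'D_1 (fun z => F (z, w)) z0.
have d6 : 0 < d / 6 by rewrite divr_gt0.
have hd6 (h : C) : `|h| <= d / 6 -> `|z0 + h - z0| < d.
  move=> hd; rewrite addrAC subrr add0r; apply: le_lt_trans hd _.
  by rewrite ltr_pdivrMr// ltr_pMr// ltr1n.
have est (h w : C) : h != 0 -> `|h| <= d / 6 -> `|w - w0| < d ->
    `|DF h w - g w| <= A * M / d ^+ 2 * `|h|.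
  move=> h0 hd wd.
  have [_ /(_ h hd)] := AP (fun z => F (z, w)) z0 d M d0
    (fun z zd => differentiable_slice1 (dP z w zd wd).1) (fun z zd => (dP z w zd wd).2).
  rewrite -/(g w) => E.
  have -> : DF h w - g w = (F (z0 + h, w) - F (z0, w) - h * g w) / h.
    by rewrite /DF; field.
  rewrite normrM normfV ler_pdivrMr ?normr_gt0//; apply: le_trans E _.
  have -> // : A * M * `|h| ^+ 2 / d ^+ 2 = A * M / d ^+ 2 * `|h| * `|h|.
  by field.
have dDF (h w : C) : h != 0 -> `|h| <= d / 6 -> `|w - w0| < d -> differentiable (DF h) w.
  move=> h0 hd wd; apply: differentiableM; last exact: differentiable_cst.
  apply: differentiableB; apply: differentiable_slice2.
    exact: (dP _ _ (hd6 h hd) wd).1.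
  exact: (dP _ _ (self z0) wd).1.
have DDF (h : C) : h != 0 -> `|h| <= d / 6 -> 'D_1 (DF h) w0 = q h.
  move=> h0 hd.
  have d1 : derivable (fun w => F (z0 + h, w)) w0 1.
    by apply/derivable1_diffP; apply: differentiable_slice2; exact: (dP _ _ (hd6 h hd) (self w0)).1.
  have d2 : derivable (fun w => F (z0, w)) w0 1.
    by apply/derivable1_diffP; apply: differentiable_slice2; exact: (dP _ _ (self z0) (self w0)).1.
  have -> : DF h = h^-1 \*: ((fun w => F (z0 + h, w)) - (fun w => F (z0, w))).
    by apply/funext => w; rewrite /DF /= !fctE /GRing.scale /= mulrC.
  have D := is_deriveZ h^-1 (is_deriveB (derivableP d1) (derivableP d2)).
  apply: (etrans (@derive_val _ _ _ _ _ _ _ D)).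
  by rewrite /q /GRing.scale /= mulrC.
have [L LP] : exists L, forall h, h != 0 -> `|h| <= d / 6 ->
    `|q h - L| <= 2 * (A * (A * M / d ^+ 2) / d) * `|h|.
  apply: cauchy_limit => //; first by rewrite !mulr_ge0// ?invr_ge0 ?exprn_ge0 ?ltW.
  move=> h k h0 k0 hd kd.
  (* Both quotients are close to [g], uniformly in w, so their difference is small on the whole
     disc; the Cauchy estimate in w transfers this to the derivatives at [w0], which are [q h] and
     [q k]. *)
  have [E _] := AP (DF h - DF k) w0 d (A * M / d ^+ 2 * (`|h| + `|k|)) d0
    (fun w wd => differentiableB (dDF h w h0 hd wd) (dDF k w k0 kd wd))
    (fun w wd => ltac:(
      by rewrite !fctE mulrDr -[DF h w - _](subrKA (g w)) ;
      apply: le_trans (ler_normD _ _) _; apply: lerD; rewrite ?[`|g w - _|]distrC; exact: est)).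
  have dh : derivable (DF h) w0 1.
    by apply/derivable1_diffP; exact: dDF h0 hd (self w0).
  have dk : derivable (DF k) w0 1.
    by apply/derivable1_diffP; exact: dDF k0 kd (self w0).
  rewrite (deriveB dh dk) (DDF h h0 hd) (DDF k k0 kd) in E; apply: le_trans E _.
  by have -> // : A * (A * M / d ^+ 2 * (`|h| + `|k|)) / d =
     A * (A * M / d ^+ 2) / d * (`|h| + `|k|) by ring.
set B := 2 * _ in LP.
have B0 : 0 <= B by rewrite !mulr_ge0// ?invr_ge0 ?exprn_ge0 ?ltW.
apply/derivable1_diffP; apply: (@ex_derive _ _ _ _ _ _ L); apply: approx_derive => e e0.
have eB : 0 < e / (B + 1) by rewrite divr_gt0// ltr_wpDl.
have [t [t0 td te _]] := small_point d6 eB.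
exists `|t|; first by rewrite normr_gt0.
move=> h ht; have [->|h0] := eqVneq h 0.
  by rewrite addr0 subrr scale0r subrr normr0 mulr0.
have := LP h h0 (ltW (lt_trans ht td)) => E.
rewrite -/(psi _) -/(psi z0).
have -> : psi (z0 + h) - psi z0 - h *: L = (q h - L) * h.
  exact: sub_scale_div.
rewrite normrM ler_wpM2r//; apply: le_trans E _.
apply: (@le_trans _ _ ((B + 1) * `|h|)); first by rewrite ler_wpM2r// lerDl.
by rewrite mulrC -ler_pdivlMr ?ltr_wpDl// ltW// (lt_trans ht te).
Qed.

End CauchyConsequences.

(** * Holomorphic maps into manifolds *)

Lemma differentiable_near (K : numFieldType) (V W : normedModType K) (f : V -> W)
    (x : V) (P : set W) : differentiable f x ->
  (\forall y \near f x, P y) -> \forall z \near x, P (f z).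
Proof. by move=> df nP; exact: (differentiable_continuous df nP). Qed.

Section HolomorphicMaps.
Context {R : realType}.
Local Notation C := (Cx R).

(** A pointwise notion for maps out of a vector space, so that chart inverses and maps lifted along
    [torus_proj] need no chart on the source. As in [holomorphic], the first conjunct is
    continuity. *)
Definition hol_at (V W : normedModType C) (N : cmanifold W) (f : V -> N) (x : V) :=
  forall b, atlas N b -> cdom b (f x) ->
    (\forall z \near x, cdom b (f z)) /\ differentiable (b \o f) x.

Section Charts.
Context {V : normedModType C} {M : cmanifold V}.

Lemma near_chart2 (a b : chart V M) (p : M) : atlas M a -> atlas M b ->
  cdom a p -> cdom b p ->
  \forall z \near a p, [/\ cdom a (cinv a z), cdom b (cinv a z) & a (cinv a z) = z].
Proof.
move=> aM bM pa pb.
have : nbhs (a p) (a @` (cdom a `&` cdom b)).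
  by apply: open_nbhs_nbhs; split; [exact: atlas_open|exists p].
by apply: filterS => z [q [qa qb] <-]; rewrite (chartK qa).
Qed.

Lemma near_chart (a : chart V M) (p : M) : atlas M a -> cdom a p ->
  \forall z \near a p, cdom a (cinv a z) /\ a (cinv a z) = z.
Proof.
by move=> aM pa; have := near_chart2 aM aM pa pa; apply: filterS => z [].
Qed.

Lemma hol_at_cinv (a : chart V M) (p : M) : atlas M a -> cdom a p ->
  hol_at (cinv a) (a p).
Proof.
move=> aM pa b bM; rewrite (chartK pa) => pb; split.
  by have := near_chart2 aM bM pa pb; apply: filterS => z [].
exact: atlas_holo.
Qed.

End Charts.

Section Composition.
Context {U V W W' : normedModType C} {M : cmanifold V} {N : cmanifold W} {P : cmanifold W'}.

Lemma holomorphicP (f : M -> N) :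
  holomorphic f <-> forall p a, atlas M a -> cdom a p -> hol_at (f \o cinv a) (a p).
Proof.
split=> [hf p a aM pa b bN|hf p a b aM bN pa pb].
  by rewrite /= (chartK pa) => pb; exact: hf.
by have := hf p a aM pa b bN; rewrite /= (chartK pa); exact.
Qed.

Lemma hol_at_one_chart (f : U -> N) (x : U) (b : chart W N) : atlas N b -> cdom b (f x) ->
  (\forall z \near x, cdom b (f z)) -> differentiable (b \o f) x -> hol_at f x.
Proof.
move=> bN fxb fb df c cN fxc.
have nbc := near_chart2 bN cN fxb fxc.
have nf : \forall z \near x, cdom c (cinv b (b (f z))).
  have := differentiable_near df nbc.
  by apply: filterS => z [].
split.
  by apply: filterS2 fb nf => z zb; rewrite (chartK zb).
apply: (@near_eq_differentiable _ _ _ _ ((c \o cinv b) \o (b \o f))).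
  by apply: filterS fb => z zb /=; rewrite (chartK zb).
exact: differentiable_comp df (atlas_holo bN cN fxb fxc).
Qed.

Lemma hol_at_precomp (f : V -> N) (k : U -> V) (x : U) : differentiable k x ->
  hol_at f (k x) -> hol_at (f \o k) x.
Proof.
move=> dk hf b bN fb; have [nb db] := hf b bN fb; split.
  exact: differentiable_near dk nb.
exact: differentiable_comp dk db.
Qed.

Lemma hol_at_comp (f : N -> P) (g : U -> N) (x : U) : holomorphic f -> hol_at g x ->
  hol_at (f \o g) x.
Proof.
move=> hf hg c cP fc; have [b bN gb] := atlas_cover (g x).
have [nb db] := hg b bN gb.
have [nf df] := hf (g x) b c bN cP gb fc.
have eqn : \forall z \near x, cinv b (b (g z)) = g z.
  by apply: filterS nb => z zb; rewrite (chartK zb).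
split.
  by apply: filterS2 eqn (differentiable_near db nf) => z /= ->.
apply: (@near_eq_differentiable _ _ _ _ ((c \o f \o cinv b) \o (b \o g))).
  by apply: filterS eqn => z /= ->.
exact: differentiable_comp db df.
Qed.

End Composition.

Lemma holomorphic_comp (V W W' : normedModType C) (M : cmanifold V) (N : cmanifold W)
    (P : cmanifold W') (f : M -> N) (g : N -> P) :
  holomorphic f -> holomorphic g -> holomorphic (g \o f).
Proof.
move=> hf hg; apply/holomorphicP => p a aM pa.
by apply: hol_at_comp hg _; exact: (holomorphicP f).1 hf p a aM pa.
Qed.

End HolomorphicMaps.

(** * The covering map of a torus *)

Section TorusCharts.
Context {R : realType}.
Local Notation C := (Cx R).
Variables (tau : C) (tau_gt0 : 0 < complex.Im tau).
Local Notation E := (elliptic_curve tau_gt0).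
Local Notation proj := (torus_proj tau : C -> E).

(** The number [b (proj w0) - w0] is a period. For w near w0 the translate of w by it lies in the
    image of the chart and projects to the same point as w, so it is the value of the chart
    there. *)
Lemma torus_chart_proj (b : chart (C : normedModType C) E) (w0 : C) : atlas E b ->
  cdom b (proj w0) -> \forall w \near w0, cdom b (proj w) /\ b (proj w) = w + (b (proj w0) - w0).
Proof.
move=> [bi bo] wb.
have bP q : cdom b q -> proj (b q) = q by move=> qb; rewrite -[in RHS](chartK qb) bi.
have zb : \forall z \near w0, (b @` cdom b) (z + (b (proj w0) - w0)).
  have := @cvg_translate _ C w0 (b (proj w0)).
  by move=> /(_ (b @` cdom b)); apply; apply: open_nbhs_nbhs; split=> //; exists (proj w0).
apply: filterS zb => w [q qb qE].
have wq : proj w = q.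
  rewrite -(bP q qb) qE; apply/torus_projP.
  have -> : w - (w + (b (proj w0) - w0)) = w0 - b (proj w0) by ring.
  by apply/torus_projP; rewrite -/(proj _) bP.
by rewrite wq.
Qed.

Lemma torus_proj_hol (w : C) : hol_at proj w.
Proof.
move=> b bE wb; have n := torus_chart_proj bE wb; split.
  by apply: filterS n => z [].
apply: (@near_eq_differentiable _ _ _ _ (fun z => z + (b (proj w) - w))).
  by apply: filterS n => z [].
by apply: differentiableD => //; exact: differentiable_cst.
Qed.

Lemma torus_holomorphic (W : normedModType C) (N : cmanifold W) (f : E -> N) :
  (forall z, hol_at (f \o proj) z) -> holomorphic f.
Proof. by move=> hf; apply/holomorphicP => p a [-> _] pa; exact: hf. Qed.

Lemma torus_projK (p : E) : proj (repr p) = p.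
Proof. exact: reprK. Qed.

Lemma torus_proj_eq (x y : C) : proj x = proj y <-> x - y \in lattice tau.
Proof. exact: torus_projP. Qed.

End TorusCharts.

(** * Maps of tori *)

Section LocallyConstant.
Context {R : realType}.
Local Notation C := (Cx R).
Local Notation Re := (@complex.Re R).
Local Notation Im := (@complex.Im R).

(** Connectedness of the segment by calculus: the indicator function of f t = f 0 has derivative 0
    everywhere, hence is constant. No structure on [T] is needed, which allows [T] to be [Prop]. *)
Lemma locally_constant_segment (T : Type) (f : R -> T) :
  (forall t : R, \forall s \near t, f s = f t) -> f 1 = f 0.
Proof.
move=> H; pose chi (t : R) : R := if `[< f t = f 0 >] then 1 else 0.
have d (t : R) : is_derive t 1 chi 0.
  apply: (@near_eq_is_derive _ _ _ (cst (chi t))).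
  by have := H t; apply: filterS => s st; rewrite /chi st.
have := is_derive_0_is_cst 1 0 d; rewrite /chi.
rewrite [`[< f 0 = f 0 >]]asboolT//; case: asboolP => // _ /eqP.
by rewrite eq_sym oner_eq0.
Qed.

Lemma line_continuous (z w : C) : continuous (fun t : R => z + (t%:C)%C * w).
Proof.
apply: continuous_add; first exact: continuous_cst.
by apply: continuous_mul; [move=> x; exact: realC_continuous|exact: continuous_cst].
Qed.

Lemma locally_constant_eq (T : Type) (f : C -> T) :
  (forall z : C, \forall y \near z, f y = f z) -> forall z, f z = f 0.
Proof.
move=> H z; pose g (t : R) := f (0 + (t%:C)%C * z).
have := @locally_constant_segment T g; rewrite /g mul1r mul0r !add0r; apply=> t.
exact: (line_continuous (H (0 + (t%:C)%C * z))).
Qed.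

Lemma derive_line_Re (f : C -> C) (z h : C) (t : R) :
  differentiable f (z + (t%:C)%C * h) -> 'D_1 f (z + (t%:C)%C * h) = 0 ->
  is_derive t 1 (fun s : R => Re (f (z + (s%:C)%C * h))) 0 /\
  is_derive t 1 (fun s : R => Im (f (z + (s%:C)%C * h))) 0.
Proof.
move=> df D0.
have key (e : R) : 0 < e -> exists2 d : R, 0 < d & forall s : R, `|s| < d ->
    `|f (z + ((t + s)%:C)%C * h) - f (z + (t%:C)%C * h)| <= ((e * `|s|)%:C)%C.
  move=> e0; pose H1 := Re `|h| + 1.
  have nE : `|h| = ((Re `|h|)%:C)%C by apply: ge0_real_part.
  have h0 : 0 <= Re `|h| by move: (normr_ge0 h); rewrite lecE => /andP[].
  have H10 : 0 < H1 by rewrite ltr_wpDl.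
  have eH : 0 < ((e / H1)%:C)%C :> C by rewrite ltcR divr_gt0.
  have [d d0 dP] := derive_approx df eH.
  exists (Re d / H1) => [|s sd]; first by rewrite divr_gt0// gt0_Re.
  have := dP ((s%:C)%C * h); rewrite D0 scaler0 subr0 normrM normC.
  have -> : z + (t%:C)%C * h + (s%:C)%C * h = z + ((t + s)%:C)%C * h.
    by rewrite rmorphD /=; ring.
  have hH : Re `|h| <= H1 by rewrite lerDl.
  move=> E; apply: le_trans (E _) _.
    rewrite nE -rmorphM /= (ge0_real_part (ltW d0)) ltcR.
    apply: (@le_lt_trans _ _ (`|s| * H1)); first by rewrite ler_wpM2l.
    by rewrite -ltr_pdivlMr.
  rewrite nE -!(rmorphM (real_complex R)) lecR.
  have -> : e / H1 * (`|s| * Re `|h|) = e * `|s| * (Re `|h| / H1) by ring.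
  by rewrite ler_piMr ?ler_pdivrMr ?mul1r// mulr_ge0// ltW.
split; apply: (@approx_derive R R) => e e0; have [d d0 dP] := key e e0;
  exists d => // s sd; rewrite scaler0 subr0 -lecR.
- by apply: le_trans (dP s sd); rewrite -Re_opp -Re_add; exact: norm_Re_le.
- by apply: le_trans (dP s sd); rewrite -Im_opp -Im_add; exact: norm_Im_le.
Qed.

Lemma derive0_locally_constant (f : C -> C) (z : C) :
  (\forall y \near z, differentiable f y /\ 'D_1 f y = 0) ->
  \forall y \near z, f y = f z.
Proof.
move=> /(@nbhs_distP C C)[d d0 dP]; apply/(@nbhs_distP C C).
(* Halved because [derive0_eq] works on ]-2, 2[, so the line through z and y is followed up to twice
   the distance between them. *)
exists (d / 2) => [|y zy]; first by rewrite divr_gt0.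
have I (t : R) : -2 < t < 2 -> `|z - (z + (t%:C)%C * (y - z))| < d.
  move=> tI; rewrite opprD addrA subrr sub0r normrN normrM normC -[`|y - z|]distrC.
  have t2 : `|t| < 2 by rewrite ltr_norml.
  rewrite [d](_ : _ = 2 * (d / 2)); last by field.
  apply: (@le_lt_trans _ _ (2 * `|z - y|)); last by rewrite ltr_pM2l.
  rewrite ler_wpM2r//; have -> : (2 : C) = ((2 : R)%:C)%C by rewrite rmorph_nat.
  by rewrite lecR ltW.
have D (t : R) (tI : -2 < t < 2) := derive_line_Re (dP _ (I t tI)).1 (dP _ (I t tI)).2.
have I0 : -2 < (0 : R) < 2 by apply/andP; split; lra.
have I1' : -2 < (1 : R) < 2 by apply/andP; split; lra.
have hR := derive0_eq I0 I1' (fun t tI => (D t tI).1).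
have hI := derive0_eq I0 I1' (fun t tI => (D t tI).2).
rewrite /= mul0r mul1r addr0 addrC subrK in hR hI.
exact: cx_ext.
Qed.

Lemma derive1_add_cst (f : C -> C) (k z : C) : differentiable f z ->
  'D_1 (fun y => f y + k) z = 'D_1 f z.
Proof.
move=> df; apply: derive_val; rewrite -[X in is_derive _ _ _ X]addr0.
apply: (@is_deriveD _ _ _ f (cst k)).
by apply: derivableP; apply/derivable1_diffP.
Qed.

Lemma derive1_shift (f : C -> C) (k z : C) : differentiable f (z + k) ->
  'D_1 (fun y => f (y + k)) z = 'D_1 f (z + k).
Proof.
move=> df; apply: derive_val; apply: approx_derive => e e0.
have [d d0 dP] := derive_approx df e0; exists d => // h /dP.
have -> : z + k + h = z + h + k by ring.
exact.
Qed.

Lemma derive1_affine (a b z : C) : 'D_1 (fun y => a * y + b) z = a.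
Proof.
apply: derive_val; apply: approx_derive => e e0; exists 1 => // h _.
have -> : a * (z + h) + b - (a * z + b) - h *: a = 0 by rewrite /GRing.scale /=; ring.
by rewrite normr0 mulr_ge0// ltW.
Qed.

(** The derivative of f at y is the partial derivative of f(y + w) in w at w = 0, so
    [differentiable_partial] applies. *)
Lemma derive1_differentiable (f : C -> C) (z : C) :
  (\forall y \near z, differentiable f y) -> differentiable (fun y => 'D_1 f y) z.
Proof.
move=> df; pose F (p : C * C) := f (p.1 + p.2).
have dadd (p : C * C) : differentiable (fun p : C * C => p.1 + p.2) p.
  by apply: differentiableD; apply: linear_differentiable => q; [exact: cvg_fst|exact: cvg_snd].
have dF : \forall p \near (z, 0 : C), differentiable F p.
  have df0 : \forall y \near ((z, 0 : C).1 + (z, 0 : C).2), differentiable f y by rewrite /= addr0.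
  have := differentiable_near (dadd (z, 0)) df0.
  by apply: filterS => p dp; exact: differentiable_comp (dadd p) dp.
apply: (near_eq_differentiable _ (differentiable_partial dF)).
apply: filterS df => y dy; rewrite /F /=.
rewrite -[LHS](_ : 'D_1 (fun w => f (w + y)) 0 = _); last by rewrite derive1_shift add0r.
suff -> : (fun w => f (w + y)) = (fun w => f (y + w)) by [].
by apply/funext => w; rewrite addrC.
Qed.

End LocallyConstant.

Section TorusMaps.
Context {R : realType}.
Local Notation C := (Cx R).
Local Notation Re := (@complex.Re R).
Local Notation Im := (@complex.Im R).
Variables (tau : C) (tau_gt0 : 0 < complex.Im tau).
Local Notation E := (elliptic_curve tau_gt0).
Local Notation proj := (torus_proj tau : C -> E).

Definition tchart (p : E) : chart (C : normedModType C) E := projT1 (cid2 (atlas_cover p)).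

Lemma tchartP p : atlas E (tchart p) /\ cdom (tchart p) p.
Proof. by rewrite /tchart; case: cid2. Qed.

(* The charts of E differ by translations, so this does not depend on the chart. *)
Definition tder (G : C -> E) (z : C) : C := 'D_1 (tchart (G z) \o G) z.

Lemma tchart_proj (b : chart (C : normedModType C) E) q : atlas E b -> cdom b q ->
  proj (b q) = q.
Proof. by move=> [bi bo] qb; rewrite -[in RHS](chartK qb) bi. Qed.

Lemma tderE (G : C -> E) (z : C) (b : chart (C : normedModType C) E) :
  hol_at G z -> atlas E b -> cdom b (G z) -> tder G z = 'D_1 (b \o G) z.
Proof.
move=> hG bE zb; have [cE zc] := tchartP (G z); rewrite /tder.
set c := tchart (G z) in cE zc *.
have [nb db] := hG b bE zb.
have cpb : cdom c (proj (b (G z))) by rewrite tchart_proj.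
have := differentiable_near db (torus_chart_proj cE cpb) => nc.
rewrite -(derive1_add_cst (c (proj (b (G z))) - b (G z)) db).
apply: near_eq_derive.
  by apply: filterS2 nb nc => y yb [_]; rewrite /= tchart_proj.
by apply: differentiableD => //; exact: differentiable_cst.
Qed.

Lemma tder_proj_affine (G : C -> E) (a b : C) : (forall z, G z = proj (a * z + b)) ->
  forall z, tder G z = a.
Proof.
move=> GE z; have [cE zc] := tchartP (G z); rewrite /tder.
set c := tchart (G z) in cE zc *.
have zc' : cdom c (proj (a * z + b)) by rewrite -GE.
have dab (y : C) : differentiable (fun y => a * y + b) y.
  have -> : (fun y => a * y + b) = (fun y => b + a * y) by apply/funext => x; rewrite addrC.
  exact: differentiable_affine.
have nc := differentiable_near (dab z) (torus_chart_proj cE zc').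
pose k := c (proj (a * z + b)) - (a * z + b).
rewrite -[RHS](derive1_affine a b z) -(derive1_add_cst k (dab z)).
apply: near_eq_derive; first by apply: filterS nc => y [_ /=]; rewrite GE.
by apply: differentiableD => //; exact: differentiable_cst.
Qed.

Variable G : C -> E.
Hypothesis holG : forall z, hol_at G z.

Lemma tder_near (z : C) : exists f : C -> C,
  \forall y \near z, [/\ differentiable f y, proj (f y) = G y & tder G y = 'D_1 f y].
Proof.
have [bE zb] := tchartP (G z); exists (tchart (G z) \o G).
have [nb _] := holG bE zb; apply: filterS nb => y yb; split.
- exact: (holG bE yb).2.
- exact: tchart_proj.
- exact: tderE.
Qed.

Lemma tder_differentiable (z : C) : differentiable (tder G) z.
Proof.
have [f fP] := tder_near z.
apply: (@near_eq_differentiable _ _ _ _ (fun y => 'D_1 f y)).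
  by apply: filterS fP => y [].
by apply: derive1_differentiable; apply: filterS fP => y [].
Qed.

Lemma tder_periodic (l : C) : (forall z, G (z + l) = G z) -> forall z, tder G (z + l) = tder G z.
Proof.
move=> Gl z; have [bE zb] := tchartP (G z).
have zlb : cdom (tchart (G z)) (G (z + l)) by rewrite Gl.
have [_ dl] := holG bE zlb.
rewrite (tderE (@holG z) bE zb) (tderE (@holG (z + l)) bE zlb) -(derive1_shift dl).
suff -> : (fun y => (tchart (G z) \o G) (y + l)) = tchart (G z) \o G by [].
by apply/funext => y; rewrite /= Gl.
Qed.

Lemma const_tder_affine (a : C) : (forall z, tder G z = a) ->
  exists b, forall z, G z = proj (a * z + b).
Proof.
move=> Da; exists (repr (G 0 : torus tau)); set b := repr _.
(* The truth value of the equation is locally constant: near each point [G] lifts to some [f] for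
   which f(y) - a y is locally constant, so the difference tested against the lattice does not
   change. *)
suff H : forall z, (G z = proj (a * z + b)) = (G 0 = proj (a * 0 + b)).
  by move=> z; rewrite H mulr0 add0r; rewrite torus_projK.
apply: (@locally_constant_eq _ _ (fun z => G z = proj (a * z + b))) => z.
have [f fP] := tder_near z.
have dl (y : C) : differentiable (fun y => - a * y + 0) y.
  have -> : (fun y => - a * y + 0) = (fun y => 0 + - a * y) by apply/funext => x; rewrite addrC.
  exact: differentiable_affine.
pose g y := f y + (- a * y + 0).
have gc : \forall y \near z, g y = g z.
  apply: derive0_locally_constant; apply: filterS fP => y [dy py ty]; split.
    exact: differentiableD.
  rewrite /g; have D1 : is_derive y 1 f a.
    by rewrite -(Da y) ty; apply: derivableP; apply/derivable1_diffP.
  have D2 : is_derive y 1 (fun y => - a * y + 0) (- a).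
    by rewrite -[X in is_derive _ _ _ X](derive1_affine (- a) 0 y); apply: derivableP;
      apply/derivable1_diffP.
  have D3 : is_derive y 1 (f + (fun y => - a * y + 0)) (a - a) := is_deriveD D1 D2.
  by rewrite -[RHS](subrr a); exact: (@derive_val _ _ _ _ _ _ _ D3).
have [_ pz _] := nbhs_singleton fP.
apply: filterS2 fP gc => y [_ py _] gy; apply/propext.
rewrite -py -pz !torus_proj_eq.
have -> // : f y - (a * y + b) = f z - (a * z + b).
have -> : f y = g y + a * y by rewrite /g; ring.
by rewrite gy /g; ring.
Qed.

End TorusMaps.

(** * Doubly periodic functions *)

Section PeriodicFunctions.
Context {R : realType}.
Local Notation C := (Cx R).
Local Notation Re := (@complex.Re R).
Local Notation Im := (@complex.Im R).

Lemma lattice_comb (tau : C) (m n : int) : (m%:~R + n%:~R * tau) \in lattice tau.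
Proof. by apply/asboolP; exists m, n. Qed.

Lemma lattice_one (tau : C) : 1 \in lattice tau.
Proof. by have := lattice_comb tau 1 0; rewrite mul0r addr0. Qed.

Lemma fundamental_domain (tau : C) (z : C) : 0 < Im tau ->
  exists s t : R, [/\ 0 <= s <= 1, 0 <= t <= 1 &
    z - ((s%:C)%C + (t%:C)%C * tau) \in lattice tau].
Proof.
move=> tau0; pose t := Im z / Im tau; pose s := Re z - t * Re tau.
have frac (x : R) : 0 <= x - (Num.floor x)%:~R <= 1.
  have := floor_itv x; rewrite subr_ge0 => /andP[-> /= h].
  by rewrite intrD in h; lra.
exists (s - (Num.floor s)%:~R), (t - (Num.floor t)%:~R); split; [exact: frac|exact: frac|].
have -> : z - (((s - (Num.floor s)%:~R)%:C)%C + ((t - (Num.floor t)%:~R)%:C)%C * tau) =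
    (Num.floor s)%:~R + (Num.floor t)%:~R * tau :> C.
  have fE (m : int) : (m%:~R : C) = ((m%:~R : R)%:C)%C by rewrite rmorph_int.
  rewrite !fE; apply: cx_ext; rewrite !(Re_add, Im_add, Re_opp, Im_opp, Re_mul, Im_mul) /=.
    by rewrite /s; ring.
  have : t * Im tau = Im z by rewrite /t divfK// gt_eqF.
  by move=> <-; ring.
exact: lattice_comb.
Qed.

Lemma Re_norm_continuous (z : C) : {for z, continuous (fun z : C => Re `|z|)}.
Proof.
apply/(@continuous_distP C R C R) => e e0; exists (e%:C)%C; first by rewrite ltcR.
move=> w zw; rewrite -Re_opp -Re_add -ltcR.
apply: le_lt_trans (norm_Re_le _) _; apply: le_lt_trans zw; exact: ler_dist_dist.
Qed.

(** The real unit square parametrises a fundamental parallelogram, so compactness is only used for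
    real segments. *)
Lemma periodic_bounded (tau : C) (f : C -> C) : 0 < Im tau -> continuous f ->
  (forall l z, l \in lattice tau -> f (z + l) = f z) -> exists M, forall z, `|f z| <= M.
Proof.
move=> tau0 cf fl.
pose g (p : R * R) : R := Re `|f ((p.1%:C)%C + (p.2%:C)%C * tau)|.
have cg : continuous g.
  move=> p; apply: (@continuous_comp _ _ _
    (fun p : R * R => f ((p.1%:C)%C + (p.2%:C)%C * tau)) (fun z : C => Re `|z|)).
    apply: (@continuous_comp _ _ _
      (fun p : R * R => (p.1%:C)%C + (p.2%:C)%C * tau : C) f); last exact: cf.
    apply: continuous_add.
      move=> q; apply: (@continuous_comp _ _ _ fst (fun x : R => (x%:C)%C : C)).
        exact: cvg_fst.
      exact: realC_continuous.
    apply: continuous_mul; last exact: continuous_cst.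
    move=> q; apply: (@continuous_comp _ _ _ snd (fun x : R => (x%:C)%C : C)).
      exact: cvg_snd.
    exact: realC_continuous.
  exact: Re_norm_continuous.
have cK : compact (`[0, 1]%classic `*` `[0, 1]%classic : set (R * R)).
  by apply: compact_setX; exact: segment_compact.
have := compact_bounded (continuous_compact (continuous_subspaceT cg) cK).
move=> [M [_ /(_ (M + 1))]]; rewrite ltrDl => /(_ ltr01) MP.
exists (((M + 1)%:C)%C) => z.
have [s [t [sI tI zl]]] := fundamental_domain z tau0.
rewrite -(subrK ((s%:C)%C + (t%:C)%C * tau) z) addrC fl//.
rewrite (ge0_real_part (normr_ge0 _)) lecR.
apply: le_trans (ler_norm _) _; by apply: MP; exists (s, t).
Qed.

End PeriodicFunctions.

Section TorusMapsAffine.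
Context {R : realType}.
Local Notation C := (Cx R).
Variables (tau tau' : C) (tau_gt0 : 0 < complex.Im tau) (tau'_gt0 : 0 < complex.Im tau').
Local Notation E := (elliptic_curve tau_gt0).
Local Notation E' := (elliptic_curve tau'_gt0).

(* The derivative of f o proj is an entire doubly periodic function. *)
Lemma torus_map_affine (f : E -> E') : (forall z, hol_at (f \o torus_proj tau) z) ->
  exists a b : C, forall z, f (torus_proj tau z) = torus_proj tau' (a * z + b).
Proof.
move=> hf; pose G := f \o torus_proj tau : C -> E'.
have D (z : C) : differentiable (tder G) z by exact: tder_differentiable.
have per (l z : C) : l \in lattice tau -> tder G (z + l) = tder G z.
  move=> ll; apply: tder_periodic; first exact: hf.
  move=> y; rewrite /G /=; congr (f _).
  by apply/(torus_proj_eq tau_gt0); rewrite addrAC subrr add0r.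
have cD : continuous (tder G) by move=> z; exact: differentiable_continuous.
have [M MP] := periodic_bounded tau_gt0 cD per.
have Dc := liouville D MP.
have [b bP] := const_tder_affine hf Dc.
by exists (tder G 0), b.
Qed.

Lemma affine_torus_map_lattice (f : E -> E') (a b : C) :
  (forall z, f (torus_proj tau z) = torus_proj tau' (a * z + b)) ->
  forall l, l \in lattice tau -> a * l \in lattice tau'.
Proof.
move=> fE l ll; have -> : a * l = a * l + b - (a * 0 + b) by ring.
apply/(torus_proj_eq tau'_gt0); rewrite -!fE; congr (f _).
by apply/(torus_proj_eq tau_gt0); rewrite subr0.
Qed.

End TorusMapsAffine.

(** * Total spaces *)

Section TotalSpace.
Context {R : realType}.
Local Notation C := (Cx R).
Context {V : normedModType C} {B : cmanifold V} {r : nat} (E : bundle B r).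

Definition fcoord (t : triv E r) (e : total_space E) : 'rV[C]_r :=
  tmap t (tag e) (tagged e).

Lemma total_ext (t : triv E r) (u v : total_space E) : tag u = tag v ->
  tdom t (tag u) -> fcoord t u = fcoord t v -> u = v.
Proof.
case: u => x u; case: v => y v /= xy; subst y => tx; rewrite /fcoord /= => uv.
by congr (Tagged _ _); rewrite -(tmapK tx u) -(tmapK tx v) uv.
Qed.

Section IntoTotal.
Context {U : normedModType C}.

Lemma near_tdom (g : U -> B) (x : U) (t : triv E r) : hol_at g x -> trivs E t ->
  tdom t (g x) -> \forall z \near x, tdom t (g z).
Proof.
move=> hg tE xt; have [a aB xa] := atlas_cover (g x).
have [na da] := hg a aB xa.
have : \forall y \near (a \o g) x, (a @` (tdom t `&` cdom a)) y.
  by apply: open_nbhs_nbhs; split; [exact: triv_open|exists (g x)].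
move=> /(differentiable_near da); apply: filterS2 na => z za [q [qt qa] qz].
by rewrite -(chartK za) -[a (g z)]qz (chartK qa).
Qed.

Lemma total_hol_at (f : U -> total_space E) (x : U) (t : triv E r) : trivs E t ->
  tdom t (tag (f x)) -> hol_at (fun z => tag (f z) : B) x ->
  differentiable (fun z => fcoord t (f z)) x -> hol_at f x.
Proof.
move=> tE xt ht dt; have [a aB xa] := atlas_cover (tag (f x) : B).
have [na da] := ht a aB xa.
apply: (@hol_at_one_chart R U (total_model V r) (total_space E) f x (total_chart a t)).
- by exists a, t.
- by split.
- by have := near_tdom ht tE xt; apply: filterS2 na => z ? ?; split.
exact: differentiable_pair da dt.
Qed.

Lemma total_hol_atP (f : U -> total_space E) (x : U) : hol_at f x ->
  hol_at (fun z => tag (f z) : B) x /\ forall t, trivs E t -> tdom t (tag (f x)) ->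
  differentiable (fun z => fcoord t (f z)) x.
Proof.
move=> hf; have key (a : chart V B) t : atlas B a -> trivs E t -> cdom a (tag (f x)) ->
    tdom t (tag (f x)) -> (\forall z \near x, cdom a (tag (f z))) /\
    differentiable (fun z => (a (tag (f z)), fcoord t (f z))) x.
  move=> aB tE xa xt.
  have [||n d] := hf (total_chart a t); [by exists a, t|by split|split; last exact: d].
  by apply: filterS n => z [].
split=> [a aB xa|t tE xt].
  have [t tE xt] := triv_cover E (tag (f x)).
  have [n d] := key a t aB tE xa xt; split=> //.
  apply: (@differentiable_comp _ _ _ _ (fun z => (a (tag (f z)), fcoord t (f z))) fst) => //.
  by apply: linear_differentiable => q; exact: cvg_fst.
have [a aB xa] := atlas_cover (tag (f x) : B).
have [n d] := key a t aB tE xa xt.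
apply: (@differentiable_comp _ _ _ _ (fun z => (a (tag (f z)), fcoord t (f z))) snd) => //.
by apply: linear_differentiable => q; exact: cvg_snd.
Qed.

Definition escale (c : C) (e : total_space E) : total_space E :=
  Tagged (fun x => E x) (c *: tagged e).

Lemma hol_at_escale (k : U -> C) (f : U -> total_space E) (x : U) :
  differentiable k x -> hol_at f x -> hol_at (fun z => escale (k z) (f z)) x.
Proof.
move=> dk hf; have [h1 h2] := total_hol_atP hf.
have [t tE xt] := triv_cover E (tag (f x)).
apply: (total_hol_at (t := t)) => //.
have -> : (fun z => fcoord t (escale (k z) (f z))) = (fun z => k z *: fcoord t (f z)).
  by apply/funext => z; rewrite /fcoord /= linearZ.
apply: differentiable_mx => i j.
have -> : (fun z => (k z *: fcoord t (f z)) i j) = (fun z => k z * fcoord t (f z) i j).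
  by apply/funext => z; rewrite mxE.
apply: differentiableM => //.
apply: (@differentiable_comp _ _ _ _ (fun z => fcoord t (f z)) (fun A : 'rV[C]_r => A i j)).
  exact: h2.
exact: differentiable_coord.
Qed.

(* Meaningful only for u and v in the same fibre. *)
Definition fiber_sub (u v : total_space E) : total_space E :=
  Tagged (fun x => E x) (tagged u - tagged_as u v).
Definition fiber_add (u v : total_space E) : total_space E :=
  Tagged (fun x => E x) (tagged u + tagged_as u v).

Lemma fcoord_sub t u v : tag u = tag v ->
  fcoord t (fiber_sub u v) = fcoord t u - fcoord t v.
Proof.
case: u => x u; case: v => y v /= xy; subst y.
by rewrite /fcoord /fiber_sub /= -linearB tagged_asE.
Qed.

Lemma fcoord_add t u v : tag u = tag v ->
  fcoord t (fiber_add u v) = fcoord t u + fcoord t v.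
Proof.
case: u => x u; case: v => y v /= xy; subst y.
by rewrite /fcoord /fiber_add /= -linearD tagged_asE.
Qed.

Lemma fiber_subK u v : tag u = tag v -> fiber_add (fiber_sub u v) v = u.
Proof.
case: u => x u; case: v => y v /= xy; subst y.
by rewrite /fiber_sub /fiber_add /= !tagged_asE subrK.
Qed.

Lemma fiber_addK u v : tag u = tag v -> fiber_sub (fiber_add u v) v = u.
Proof.
case: u => x u; case: v => y v /= xy; subst y.
by rewrite /fiber_sub /fiber_add /= !tagged_asE addrK.
Qed.

Lemma hol_at_fiber_sub (f g : U -> total_space E) (x : U) :
  (forall z, tag (f z) = tag (g z)) -> hol_at f x -> hol_at g x ->
  hol_at (fun z => fiber_sub (f z) (g z)) x.
Proof.
move=> fg /total_hol_atP[f1 f2] /total_hol_atP[g1 g2].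
have [t tE xt] := triv_cover E (tag (f x)).
apply: (total_hol_at (t := t)) => //.
have -> : (fun z => fcoord t (fiber_sub (f z) (g z))) =
    (fun z => fcoord t (f z) - fcoord t (g z)).
  by apply/funext => z; rewrite fcoord_sub.
by apply: differentiableB; [exact: f2|apply: g2; rewrite // -fg].
Qed.

Lemma hol_at_fiber_add (f g : U -> total_space E) (x : U) :
  (forall z, tag (f z) = tag (g z)) -> hol_at f x -> hol_at g x ->
  hol_at (fun z => fiber_add (f z) (g z)) x.
Proof.
move=> fg /total_hol_atP[f1 f2] /total_hol_atP[g1 g2].
have [t tE xt] := triv_cover E (tag (f x)).
apply: (total_hol_at (t := t)) => //.
have -> : (fun z => fcoord t (fiber_add (f z) (g z))) =
    (fun z => fcoord t (f z) + fcoord t (g z)).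
  by apply/funext => z; rewrite fcoord_add.
by apply: differentiableD; [exact: f2|apply: g2; rewrite // -fg].
Qed.

End IntoTotal.

Definition bproj (e : total_space E) : B := tag e.
Definition zsec (x : B) : total_space E := Tagged (fun x => E x) (0 : E x).

Lemma bproj_holomorphic : holomorphic bproj.
Proof.
apply/holomorphicP => e c cE ec.
exact: (total_hol_atP (hol_at_cinv cE ec)).1.
Qed.

Lemma zsec_holomorphic : holomorphic zsec.
Proof.
apply/holomorphicP => p a aB pa; have [t tE pt] := triv_cover E p.
apply: (total_hol_at (t := t)) => //=; first by rewrite (chartK pa).
  exact: hol_at_cinv.
have -> : (fun z => fcoord t (zsec (cinv a z))) = cst 0.
  by apply/funext => z; rewrite /fcoord /= linear0.
exact: differentiable_cst.
Qed.

End TotalSpace.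

(** * The maps induced on the base curves *)

Section ZeroSectionProjection.
Context {R : realType}.
Local Notation C := (Cx R).
Context {tau tau' : C} {tau_gt0 : 0 < complex.Im tau} {tau'_gt0 : 0 < complex.Im tau'}.
Context {r r' : nat}.
Local Notation B := (elliptic_curve tau_gt0).
Local Notation B' := (elliptic_curve tau'_gt0).
Variables (E : bundle B r) (E' : bundle B' r').

Lemma bproj_zsec_hol (f : total_space E -> total_space E') : holomorphic f ->
  holomorphic (@bproj R _ _ _ E' \o f \o @zsec R _ _ _ E).
Proof.
move=> hf; apply: holomorphic_comp; first exact: zsec_holomorphic.
by apply: holomorphic_comp hf _; exact: bproj_holomorphic.
Qed.

Lemma torus_holomorphic_affine (f : B -> B') : holomorphic f ->
  exists a b : C, forall z, f (torus_proj tau z) = torus_proj tau' (a * z + b).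
Proof.
move=> hf; apply: torus_map_affine => z.
by apply: hol_at_comp hf _; exact: torus_proj_hol.
Qed.

(* Scaling the fibres of E' by t turns the identity (t = 1) into the composite of
   the two base maps (t = 0); the slope of the induced self-map of the base varies
   continuously in the lattice, hence is constant. *)
Lemma slope_mul1 (Phi : total_space E -> total_space E') (Phi' : total_space E' -> total_space E)
    (a b a' b' : C) :
  holomorphic Phi -> holomorphic Phi' -> cancel Phi Phi' ->
  (forall z, bproj (Phi (zsec E (torus_proj tau z))) = torus_proj tau' (a * z + b)) ->
  (forall z, bproj (Phi' (zsec E' (torus_proj tau' z))) = torus_proj tau (a' * z + b')) ->
  a' * a = 1.
Proof.
move=> hPhi hPhi' PhiK aE a'E.
pose f (t : C) (x : B) : B := bproj (Phi' (escale t (Phi (zsec E x)))).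
pose K (p : C * C) : B := f p.1 (torus_proj tau p.2).
have dfst (p : C * C) : differentiable (fst : C * C -> C) p.
  by apply: linear_differentiable => q; exact: cvg_fst.
have dsnd (p : C * C) : differentiable (snd : C * C -> C) p.
  by apply: linear_differentiable => q; exact: cvg_snd.
have hK p : hol_at K p.
  apply: (hol_at_comp (f := @bproj R _ _ _ E)); first exact: bproj_holomorphic.
  apply: hol_at_comp hPhi' _.
  apply: hol_at_escale; first exact: dfst.
  apply: hol_at_comp hPhi _.
  apply: (hol_at_comp (f := zsec E)); first exact: zsec_holomorphic.
  apply: (@hol_at_precomp _ _ _ _ B (torus_proj tau) snd); first exact: dsnd.
  exact: torus_proj_hol.
have hKt (t z : C) : hol_at (fun z => K (t, z)) z.
  apply: (@hol_at_precomp _ _ _ _ B K (fun z => (t, z))); last exact: hK.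
  by apply: differentiable_pair => //; exact: differentiable_cst.
pose alpha (t : C) := tder (fun z => K (t, z)) 0.
(* For fixed t the self-map [f t] of the torus is affine, and its slope is the image of the period
   1. *)
have alphaL (t : C) : alpha t \in lattice tau.
  have [c [d cd]] := @torus_map_affine R tau tau tau_gt0 tau_gt0 (f t) (hKt t).
  rewrite /alpha (tder_proj_affine (a := c) (b := d))//.
  have := affine_torus_map_lattice cd (lattice_one tau).
  by rewrite mulr1.
(* One chart around [K (t0, 0)] serves all t near t0. In it [alpha] is the z-derivative at 0 of a
   function holomorphic in (t, z), hence continuous, and two slopes closer than the gap of
   [lattice_discrete] coincide. *)
have alpha_lc (t0 : C) : \forall t \near t0, alpha t = alpha t0.
  have [cB Kc] := tchartP (K (t0, 0)); set c := tchart _ in cB Kc.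
  have [nK _] := hK _ c cB Kc.
  pose F p := c (K p).
  have dF : \forall p \near (t0, 0 : C), differentiable F p.
    by apply: filterS nK => p pc; exact: (hK p c cB pc).2.
  have dA := differentiable_partial dF.
  have nt : \forall t \near t0, cdom c (K (t, 0)).
    apply: (@differentiable_near _ _ _ (fun t : C => (t, 0 : C)) t0 (fun p => cdom c (K p))) => //.
  have aF : \forall t \near t0, alpha t = 'D_1 (fun z => F (t, z)) 0.
    by apply: filterS nt => t tc; rewrite /alpha (tderE (hKt t 0) cB tc).
  have [d d0 dP] := lattice_discrete tau_gt0.
  have aF0 := nbhs_singleton aF.
  have near_a := differentiable_near dA (near_dist ('D_1 (fun z => F (t0, z)) 0) d0).
  apply: filterS2 aF near_a => t aFt; rewrite -aFt -aF0 distrC => h.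
  by apply/eqP; rewrite -subr_eq0; apply/eqP/dP => //; exact: rpredB.
have := locally_constant_eq alpha_lc 1.
rewrite {1}/alpha (tder_proj_affine (a := 1) (b := 0)); last first.
  move=> z; rewrite mul1r addr0 /K /f /=.
  have -> : escale 1 (Phi (zsec E (torus_proj tau z))) = Phi (zsec E (torus_proj tau z)).
    by rewrite /escale scale1r; case: (Phi _).
  by rewrite PhiK.
rewrite /alpha (tder_proj_affine (a := a' * a) (b := a' * b + b')) => // z.
rewrite /K /f /=.
have -> : escale 0 (Phi (zsec E (torus_proj tau z))) =
    zsec E' (bproj (Phi (zsec E (torus_proj tau z)))).
  by rewrite /escale scale0r.
by rewrite aE a'E mulrDr addrA mulrA.
Qed.

End ZeroSectionProjection.

Section BaseIsomorphism.
Context {R : realType}.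
Local Notation C := (Cx R).
Context {tau tau' : C} {tau_gt0 : 0 < complex.Im tau} {tau'_gt0 : 0 < complex.Im tau'}.
Context {r r' : nat}.
Local Notation B := (elliptic_curve tau_gt0).
Local Notation B' := (elliptic_curve tau'_gt0).
Variables (E : bundle B r) (E' : bundle B' r').

(** [slope_mul1] controls slopes only: the base map induced by [Phi'] has the slope a' of the
    inverse, but its translation part is not known. The inverse is therefore built directly as w |->
    a' (w - b), which descends to the quotient because a' maps the lattice of tau' into that of tau.
    It is a two-sided inverse because slopes commute. *)
Lemma base_isomorphism (Phi : total_space E -> total_space E')
    (Phi' : total_space E' -> total_space E) :
  holomorphic Phi -> holomorphic Phi' -> cancel Phi Phi' -> cancel Phi' Phi ->
  exists k : B' -> B, [/\ holomorphic k,
    cancel (fun x => bproj (Phi (zsec E x))) k & cancel k (fun x => bproj (Phi (zsec E x)))].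
Proof.
move=> hPhi hPhi' PhiK Phi'K.
have [a [b aE]] := torus_holomorphic_affine (bproj_zsec_hol hPhi).
have [a' [b' a'E]] := torus_holomorphic_affine (bproj_zsec_hol hPhi').
have a'a := slope_mul1 hPhi hPhi' PhiK aE a'E.
have a'L := affine_torus_map_lattice a'E.
pose k (q : B') : B := torus_proj tau (a' * (repr (q : torus tau') - b)).
have kE w : k (torus_proj tau' w) = torus_proj tau (a' * (w - b)).
  rewrite /k; apply/(torus_proj_eq tau_gt0).
  set u := repr _.
  have -> : a' * (u - b) - a' * (w - b) = a' * (u - w) by ring.
  by apply: a'L; apply/(torus_proj_eq tau'_gt0); rewrite torus_projK.
exists k; split.
- apply: torus_holomorphic => w.
  have -> : k \o torus_proj tau' = (torus_proj tau : C -> B) \o (fun w => - (a' * b) + a' * w).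
    by apply/funext => z; rewrite /= kE mulrBr addrC.
  apply: (@hol_at_precomp _ _ _ _ B (torus_proj tau)); last exact: torus_proj_hol.
  exact: differentiable_affine.
- move=> x; rewrite -(torus_projK (tau_gt0 := tau_gt0) x).
  rewrite -[LHS]/(k ((@bproj R _ _ _ E' \o Phi \o zsec E) _)) aE kE.
  by rewrite addrK mulrA a'a mul1r.
move=> y; rewrite -(torus_projK (tau_gt0 := tau'_gt0) y) kE.
rewrite -[LHS]/((@bproj R _ _ _ E' \o Phi \o zsec E) _) aE.
by rewrite mulrA [a * a']mulrC a'a mul1r subrK.
Qed.

End BaseIsomorphism.

(** * Fibre derivatives *)

Section Recentering.
Context {R : realType}.
Local Notation C := (Cx R).
Context {V V' : normedModType C} {B : cmanifold V} {B' : cmanifold V'} {r r' : nat}.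
Variables (E : bundle B r) (E' : bundle B' r').

Lemma recenter (Phi : total_space E -> total_space E')
    (Phi' : total_space E' -> total_space E) (k : B' -> B) :
  let h := fun x => bproj (Phi (zsec E x)) in
  holomorphic Phi -> holomorphic Phi' -> cancel Phi Phi' -> cancel Phi' Phi ->
  holomorphic k -> cancel h k -> cancel k h ->
  exists (Psi : total_space E -> total_space E') (Psi' : total_space E' -> total_space E),
    [/\ holomorphic Psi /\ holomorphic Psi', cancel Psi Psi', cancel Psi' Psi,
      forall x, Psi (zsec E x) = zsec E' (h x) & forall y, Psi' (zsec E' y) = zsec E (k y)].
Proof.
move=> h hPhi hPhi' PhiK Phi'K hk hK kK.
(* Because [k] inverts [h], the image of the zero section under [Phi] meets every fibre of [E']
   exactly once: [S y] lies over [y]. *)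
pose S (y : B') : total_space E' := Phi (zsec E (k y)).
have tS y : tag (S y) = y by exact: kK.
have hS : holomorphic S.
  apply: (holomorphic_comp (f := zsec E \o k)) hPhi.
  by apply: holomorphic_comp hk _; exact: zsec_holomorphic.
pose T u := fiber_sub u (S (bproj u)); pose T' u := fiber_add u (S (bproj u)).
have hSb : holomorphic (S \o @bproj R _ _ _ E').
  by apply: holomorphic_comp hS; exact: bproj_holomorphic.
have hT : holomorphic T.
  apply/holomorphicP => p c cE pc.
  apply: (hol_at_fiber_sub (f := cinv c) (g := (S \o @bproj R _ _ _ E') \o cinv c)).
  - by move=> z; rewrite /= tS.
  - exact: hol_at_cinv.
  - by apply: hol_at_comp hSb _; exact: hol_at_cinv.
have hT' : holomorphic T'.
  apply/holomorphicP => p c cE pc.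
  apply: (hol_at_fiber_add (f := cinv c) (g := (S \o @bproj R _ _ _ E') \o cinv c)).
  - by move=> z; rewrite /= tS.
  - exact: hol_at_cinv.
  - by apply: hol_at_comp hSb _; exact: hol_at_cinv.
have TK : cancel T T' by move=> u; rewrite /T' /T /bproj /= fiber_subK// tS.
have T'K : cancel T' T by move=> u; rewrite /T' /T /bproj /= fiber_addK// tS.
have Tz x : T (Phi (zsec E x)) = zsec E' (h x).
  rewrite /T /S -/(h x) hK /h; case: (Phi _) => y v.
  by rewrite /fiber_sub /zsec /= tagged_asE subrr.
exists (T \o Phi), (Phi' \o T'); split.
- by split; apply: holomorphic_comp.
- by move=> u /=; rewrite TK PhiK.
- by move=> u /=; rewrite Phi'K T'K.
- exact: Tz.
- by move=> y; rewrite /= -[in LHS](kK y) -Tz TK PhiK.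
Qed.

End Recentering.

Section DerivativeLemmas.
Context {K : numFieldType}.

Lemma derive_dir (V W : normedModType K) (f : V -> W) (x v : V) :
  'D_v f x = 'D_1 (fun s : K => f (x + s *: v)) 0.
Proof.
suff E : (fun h : K => h^-1 *: ((f \o shift x) (h *: v) - f x)) =
    (fun h : K => h^-1 *: (((fun s : K => f (x + s *: v)) \o shift 0) (h *: 1) -
      f (x + 0 *: v))) by rewrite /derive E.
by apply/funext => s /=; rewrite addr0 scale0r addr0 [s *: 1]mulr1 [x + s *: v]addrC.
Qed.

Lemma derive_comp1 (V W : normedModType K) (f : V -> W) (g : K -> V) (x : K) :
  differentiable g x -> differentiable f (g x) ->
  'D_1 (f \o g) x = 'd f (g x) ('D_1 g x).
Proof.
move=> dg df; rewrite deriveE; last exact: differentiable_comp.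
by rewrite diff_comp// deriveE.
Qed.

Lemma derive_linear_comp (V W : normedModType K) (l : {linear V -> W}) (g : K -> V) (x : K) :
  continuous l -> differentiable g x -> 'D_1 (fun s => l (g s)) x = l ('D_1 g x).
Proof.
move=> cl dg; rewrite (derive_comp1 (f := l) dg); last exact: linear_differentiable.
by rewrite diff_lin.
Qed.

Lemma derive_entry m n (f : K -> 'M[K]_(m, n)) (x : K) i j : differentiable f x ->
  ('D_1 f x) i j = 'D_1 (fun s => f s i j) x.
Proof.
move=> df.
have cl : linear (fun A : 'M[K]_(m, n) => A i j : K) by move=> c A A'; rewrite !mxE.
pose lM := GRing.isLinear.Build _ _ _ _ _ cl.
pose l : {linear 'M[K]_(m, n) -> K} := HB.pack (fun A : 'M[K]_(m, n) => A i j) lM.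
by rewrite (derive_linear_comp (l := l) _ df)//; exact: coord_continuous.
Qed.

(** The term of the product rule with the derivative of [M] is multiplied by [A x = 0]. Hence
    derivatives of fibre coordinates at a zero vector change between trivialisations by the
    transition matrix alone, even if the base point moves. *)
Lemma derive_mulmx_at0 n p (A : K -> 'rV[K]_n) (M : K -> 'M[K]_(n, p)) (x : K) :
  differentiable A x -> differentiable M x -> A x = 0 ->
  'D_1 (fun s => A s *m M s) x = 'D_1 A x *m M x.
Proof.
move=> dA dM A0; apply/rowP => j; rewrite derive_entry; last exact: differentiable_mulmx.
have D k : is_derive x 1 ((fun s => A s 0 k) * (fun s => M s k j))
    (A x 0 k *: 'D_1 (fun s => M s k j) x + M x k j *: 'D_1 (fun s => A s 0 k) x).
  by apply: is_deriveM; apply: derivableP; apply/derivable1_diffP;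
    [apply: (differentiable_comp (g := fun N : 'rV[K]_n => N 0 k) dA)
    |apply: (differentiable_comp (g := fun N : 'M[K]_(n, p) => N k j) dM)];
    exact: differentiable_coord.
have -> : (fun s => (A s *m M s) 0 j) =
    \sum_(k < n) ((fun s => A s 0 k) * (fun s => M s k j)).
  by apply/funext => s; rewrite mxE fct_sumE.
rewrite (@derive_val _ _ _ _ _ _ _ (is_derive_sum D)) mxE; apply: eq_bigr => k _.
by rewrite A0 mxE scale0r add0r derive_entry// /GRing.scale /= mulrC.
Qed.

End DerivativeLemmas.

Section FiberDerivative.
Context {R : realType}.
Local Notation C := (Cx R).
Context {B B' : cmanifold (C : normedModType C)} {r r' : nat}.
Variables (E : bundle B r) (E' : bundle B' r').

Lemma fcoord_transition (t u : triv E r) (e : total_space E) : tdom t (tag e) ->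
  fcoord u e = fcoord t e *m transition t u (tag e).
Proof. by move=> te; rewrite /transition mul_rV_lin1 /= /fcoord (tmapK te). Qed.

Lemma hol_at_cst (U : normedModType C) (N : cmanifold (C : normedModType C)) (p : N) (x : U) :
  hol_at (fun _ : U => p) x.
Proof.
by move=> b bN pb; split; [exact: nearW|exact: differentiable_cst].
Qed.

Definition fincl (t : triv E r) (x : B) (v : 'rV[C]_r) : total_space E :=
  Tagged (fun x => E x) (tinv t x v).

Lemma fincl_hol (t : triv E r) (x : B) (v : 'rV[C]_r) : trivs E t -> tdom t x ->
  hol_at (fincl t x) v.
Proof.
move=> tE xt; apply: (total_hol_at (t := t)) => //; first exact: hol_at_cst.
have -> : (fun z => fcoord t (fincl t x z)) = id.
  by apply/funext => z; rewrite /fcoord /= (tinvK xt).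
by [].
Qed.

Lemma fincl0 (t : triv E r) (x : B) : fincl t x 0 = zsec E x.
Proof. by rewrite /fincl linear0. Qed.

Lemma escale_fincl (t : triv E r) (x : B) (s : C) v :
  escale s (fincl t x v) = fincl t x (s *: v).
Proof. by rewrite /escale /fincl linearZ. Qed.

Lemma escale_hol0 (e : total_space E) (s : C) : hol_at (fun s => escale s e) s.
Proof.
have [t tE te] := triv_cover E (tag e).
apply: (total_hol_at (t := t)) => //; first exact: hol_at_cst.
have -> : (fun s => fcoord t (escale s e)) = (fun s => s *: fcoord t e).
  by apply/funext => z; rewrite /fcoord /= linearZ.
exact: differentiableZl.
Qed.

Lemma escale0 (e : total_space E) : escale 0 e = zsec E (tag e).
Proof. by rewrite /escale scale0r. Qed.

Lemma transition_hol (U : normedModType C) (g : U -> B) (x : U) (t u : triv E r) :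
  trivs E t -> trivs E u -> tdom t (g x) -> tdom u (g x) -> hol_at g x ->
  differentiable (fun z => transition t u (g z)) x.
Proof.
move=> tE uE xt xu hg; have [a aB xa] := atlas_cover (g x).
have [na da] := hg a aB xa.
apply: (@near_eq_differentiable _ _ _ _ ((transition t u \o cinv a) \o (a \o g))).
  by apply: filterS na => z za; rewrite /= (chartK za).
exact: differentiable_comp da (triv_holo tE uE aB xa xt xu).
Qed.

End FiberDerivative.

Section FiberDerivative.
Context {R : realType}.
Local Notation C := (Cx R).
Context {B B' : cmanifold (C : normedModType C)} {r r' : nat}.
Variables (E : bundle B r) (E' : bundle B' r').

(** The base point of Psi (s e) moves with s; only the fibre coordinate is differentiated. [F] is
    defined in trivialisations chosen at each point, and the formula then holds in every
    trivialisation by [derive_mulmx_at0], because the coordinate vanishes at s = 0. Linearity is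
    that of the differential at 0 of [Psi] on a fibre, and holomorphy in the base point comes from
    [differentiable_partial]. *)
Lemma fiber_derivative (Psi : total_space E -> total_space E') (h : B -> B') :
  holomorphic Psi -> holomorphic h -> (forall x, Psi (zsec E x) = zsec E' (h x)) ->
  exists F : forall x, {linear E x -> E' (h x)},
    let Phi (e : total_space E) : total_space E' :=
      Tagged (fun y => E' y) (F (tag e) (tagged e)) in
    (forall e t, trivs E' t -> tdom t (h (tag e)) ->
      fcoord t (Phi e) = 'D_1 (fun s : C => fcoord t (Psi (escale s e))) 0) /\
    holomorphic Phi.
Proof.
move=> hPsi hh Psi0.
pose T x := projT1 (cid2 (triv_cover E x)).
have TP x : trivs E (T x) /\ tdom (T x) x by rewrite /T; case: cid2.
pose T' y := projT1 (cid2 (triv_cover E' y)).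
have TP' y : trivs E' (T' y) /\ tdom (T' y) y by rewrite /T'; case: cid2.
pose G t t' x (v : 'rV[C]_r) : 'rV[C]_r' := fcoord t' (Psi (fincl (E := E) t x v)).
have dG t t' x : trivs E t -> tdom t x -> trivs E' t' -> tdom t' (h x) ->
    differentiable (G t t' x) 0.
  move=> tE xt t'E xt'.
  have hi : hol_at (fincl t x) (0 : 'rV[C]_r) by exact: fincl_hol.
  have := (total_hol_atP (hol_at_comp hPsi hi)).2 t' t'E.
  by apply; rewrite /= fincl0 Psi0.
pose F x : {linear E x -> E' (h x)} :=
  (tinv (T' (h x)) (h x) \o ('d (G (T x) (T' (h x)) x) 0 \o tmap (T x) x))%FUN.
exists F => Phi.
have FE e t : trivs E' t -> tdom t (h (tag e)) ->
    fcoord t (Phi e) = 'D_1 (fun s : C => fcoord t (Psi (escale s e))) 0.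
  case: e => x v0 /= tE' xt.
  have [t1E xt1] := TP x; have [t2E xt2] := TP' (h x).
  set t1 := T x in t1E xt1; set t2 := T' (h x) in t2E xt2.
  set e := Tagged (fun x => E x) v0.
  pose g s := Psi (escale s e).
  have hg : hol_at g 0 by apply: hol_at_comp hPsi _; exact: escale_hol0.
  have g0 : g 0 = zsec E' (h x) by rewrite /g escale0 Psi0.
  have [htg dg] := total_hol_atP hg.
  have g0t2 : tdom t2 (tag (g 0)) by rewrite g0.
  have g0t : tdom t (tag (g 0)) by rewrite g0.
  have nt2 := near_tdom htg t2E g0t2.
  have dA := dg t2 t2E g0t2.
  have dM := transition_hol (g := fun s => tag (g s)) t2E tE' g0t2 g0t htg.
  have A0 : fcoord t2 (g 0) = 0 by rewrite g0 /fcoord /= linear0.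
  rewrite (near_eq_derive (g := fun s => fcoord t2 (g s) *m transition t2 t (tag (g s))));
    last 2 first.
  - by apply: filterS nt2 => s; exact: fcoord_transition.
  - exact: differentiable_mulmx.
  rewrite (derive_mulmx_at0 dA dM A0) g0 /=.
  rewrite (fcoord_transition (t := t2) t (e := Phi e)); last exact: xt2.
  congr (_ *m _); rewrite /fcoord /= (tinvK xt2) -/t1 -/t2.
  rewrite -deriveE; last exact: dG.
  rewrite derive_dir.
  suff -> : (fun s => G t1 t2 x (0 + s *: tmap t1 x v0)) = (fun s => fcoord t2 (g s)) by [].
  apply/funext => s; rewrite add0r /G -escale_fincl; congr (fcoord _ (Psi (escale _ _))).
  by rewrite /fincl /e (tmapK xt1).
split=> //.
apply/holomorphicP => p c [a [t [aB tE ->{c}]]] pc; set c := total_chart a t in pc *.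
have cE : atlas (total_space E) c by exists a, t.
have [pa pt] : cdom a (tag p) /\ tdom t (tag p) by exact: pc.
have [t2 t2E ht2] := triv_cover E' (h (tag p)).
have htag : hol_at (fun z => tag ((Phi \o cinv c) z) : B') (c p).
  apply: (hol_at_comp (f := h) (g := @bproj R _ _ _ E \o cinv c)) => //.
  by apply: hol_at_comp; [exact: bproj_holomorphic|exact: hol_at_cinv].
have t2p : tdom t2 (tag ((Phi \o cinv c) (c p))) by rewrite /= (chartK pa).
apply: (total_hol_at t2E t2p htag).
have nt2 := near_tdom htag t2E t2p.
(* The matrix entries of [Phi] in the trivialisations t and t2, as functions of the base coordinate
   z. They do not involve the choices [T] and [T'], which need not vary holomorphically. *)
pose beta (j : 'I_r) (k : 'I_r') (z : C) : C :=
  'D_1 (fun s : C => fcoord t2 (Psi (cinv c (z, s *: delta_mx 0 j))) 0 k) 0.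
have fincl_cinv z v : cinv c (z, v) = fincl t (cinv a z) v by [].
pose Q (zv : C * 'rV[C]_r) : 'rV[C]_r' := \row_k \sum_j zv.2 0 j * beta j k zv.1.
apply: (@near_eq_differentiable C (total_model C r) _ _ Q).
  apply: filterS nt2 => -[z v] /= zt2; apply/rowP => k; rewrite /Q mxE.
  have fl : fcoord t2 (Phi (fincl t (cinv a z) v)) =
      \sum_j v 0 j *: fcoord t2 (Phi (fincl t (cinv a z) (delta_mx 0 j))).
    rewrite /fcoord /= {1}(row_sum_delta v) !linear_sum.
    by apply: eq_bigr => j _; rewrite !linearZ.
  rewrite -fincl_cinv in fl.
  rewrite fl summxE; apply: eq_bigr => j _; rewrite mxE; congr (_ * _).
  rewrite FE//.
  rewrite derive_entry; last first.
    have hs : hol_at (fun s => Psi (escale s (fincl t (cinv a z) (delta_mx 0 j)))) 0.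
      by apply: hol_at_comp hPsi _; exact: escale_hol0.
    by apply: (total_hol_atP hs).2 => //; rewrite escale0 Psi0.
  rewrite /beta.
  suff -> : (fun s => fcoord t2 (Psi (escale s (fincl t (cinv a z) (delta_mx 0 j)))) 0 k) =
    (fun s => fcoord t2 (Psi (cinv c (z, s *: delta_mx 0 j))) 0 k) by [].
  by apply/funext => s; rewrite escale_fincl.
apply: differentiable_mx => i k.
have -> : (fun zv : C * 'rV[C]_r => Q zv i k) =
    \sum_j (fun zv : C * 'rV[C]_r => zv.2 0 j * beta j k zv.1).
  by apply/funext => zv; rewrite /Q mxE fct_sumE.
apply: differentiable_sum => j; apply: differentiableM.
  apply: (differentiable_comp (g := fun N : 'rV[C]_r => N 0 j)).
    by apply: linear_differentiable => q; exact: cvg_snd.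
  exact: differentiable_coord.
apply: (differentiable_comp (g := beta j k)).
  by apply: linear_differentiable => q; exact: cvg_fst.
(* Restriction to the j-th coordinate line of the fibres leaves a function of the two variables z
   and s, to which [differentiable_partial] applies. *)
pose m (q : C * C) : C * 'rV[C]_r := (q.1, q.2 *: delta_mx 0 j).
have dm q : differentiable m q.
  apply: differentiable_pair.
    by apply: linear_differentiable => q'; exact: cvg_fst.
  by apply: differentiableZl; apply: linear_differentiable => q'; exact: cvg_snd.
(* The derivative is taken at s = 0, so the point that matters is the zero vector below [p]; [c]
   contains it because its domain consists of whole fibres. *)
pose p0 := zsec E (tag p).
have p0c : cdom c p0 by split.
have cp0 : c p0 = m (a (tag p), 0).
  by rewrite /c /= /total_cmap /m /= scale0r linear0.
have nc : \forall q \near (a (tag p), 0 : C), cdom c (cinv c (m q)) /\ c (cinv c (m q)) = m q.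
  have := near_chart cE p0c; rewrite cp0; exact: differentiable_near.
have hol_m q : cdom c (cinv c (m q)) -> c (cinv c (m q)) = m q ->
    hol_at (Psi \o (cinv c \o m)) q.
  move=> h1 h2; apply: hol_at_comp hPsi _.
  by apply: hol_at_precomp; [exact: dm|rewrite -h2; exact: hol_at_cinv].
have [h1 h2] := nbhs_singleton nc.
have [ht0 _] := total_hol_atP (hol_m _ h1 h2).
have t2q : tdom t2 (tag ((Psi \o (cinv c \o m)) (a (tag p), 0))).
  have E0 : (Psi \o (cinv c \o m)) (a (tag p), 0) = zsec E' (h (tag p)).
    by rewrite -[LHS]/(Psi (cinv c (m (a (tag p), 0)))) -cp0 (chartK p0c) Psi0.
  by rewrite E0.
have nt2' := near_tdom ht0 t2E t2q.
apply: (@differentiable_partial R (fun q => fcoord t2 (Psi (cinv c (m q))) 0 k)).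
apply: filterS2 nc nt2' => q [q1 q2] qt2.
apply: (differentiable_comp (f := fun q => fcoord t2 (Psi (cinv c (m q))))
  (g := fun N : 'rV[C]_r' => N 0 k)); last exact: differentiable_coord.
exact: (total_hol_atP (hol_m q q1 q2)).2.
Qed.



Lemma total_diff_pair (U W : normedModType C) (L : C * U -> W) (x p : C) (y q : U) :
  differentiable L (x, y) ->
  'd L (x, y) (p, q) = 'D_1 (fun s : C => L (x + s *: p, y)) 0 +
                       'D_1 (fun s : C => L (x, y + s *: q)) 0.
Proof.
move=> dL; have -> : (p, q) = (p, 0) + (0, q) by rewrite /= -[RHS]/(p + 0, 0 + q) addr0 add0r.
have F1 : (fun s : C => L ((x, y) + s *: (p, 0))) = (fun s => L (x + s *: p, y)).
  by apply/funext => s; rewrite -[(x, y) + _]/(x + s *: p, y + s *: 0) scaler0 addr0.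
have F2 : (fun s : C => L ((x, y) + s *: (0, q))) = (fun s => L (x, y + s *: q)).
  by apply/funext => s; rewrite -[(x, y) + _]/(x + s *: 0, y + s *: q) scaler0 addr0.
by rewrite linearD -(deriveE (p, 0) dL) -(deriveE (0, q) dL)
  (derive_dir L (x, y) (p, 0)) (derive_dir L (x, y) (0, q)) F1 F2.
Qed.

(* The differential of Psi' along the zero section of E' is tangent to the zero
   section of E, so only the vertical part of that of Psi survives composition. *)
Lemma fiber_derivative_cancel (Psi Phi : total_space E -> total_space E')
    (Psi' Phi' : total_space E' -> total_space E) (h : B -> B') (k : B' -> B) :
  holomorphic Psi -> holomorphic Psi' -> cancel Psi Psi' -> cancel h k ->
  (forall x, Psi (zsec E x) = zsec E' (h x)) ->
  (forall y, Psi' (zsec E' y) = zsec E (k y)) ->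
  (forall e, tag (Phi e) = h (tag e)) -> (forall e, tag (Phi' e) = k (tag e)) ->
  (forall e t, trivs E' t -> tdom t (h (tag e)) ->
    fcoord t (Phi e) = 'D_1 (fun s : C => fcoord t (Psi (escale s e))) 0) ->
  (forall e t, trivs E t -> tdom t (k (tag e)) ->
    fcoord t (Phi' e) = 'D_1 (fun s : C => fcoord t (Psi' (escale s e))) 0) ->
  cancel Phi Phi'.
Proof.
move=> hPsi hPsi' PsiK hK Psi0 Psi'0 tPhi tPhi' PhiE Phi'E e.
pose x := tag e; pose y := h x.
have [t tE xt] := triv_cover E x; have [t' t'E yt'] := triv_cover E' y.
have [a aB ya] := atlas_cover (y : B').
have tagE : tag (Phi' (Phi e)) = tag e by rewrite tPhi' tPhi hK.
apply: (total_ext (t := t)) => //; first by rewrite tagE.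
pose c := total_chart a t'.
have cE : atlas (total_space E') c by exists a, t'.
have yc v : cdom c (Tagged (fun y => E' y) (v : E' y)) by split.
pose L (q : C * 'rV[C]_r') := fcoord t (Psi' (cinv c q)).
have zc : cdom c (zsec E' y) by exact: yc.
have cy0 : c (zsec E' y) = (a y, 0) by rewrite /= /total_cmap /= linear0.
have xt' : tdom t (k y) by rewrite /y hK.
have dL : differentiable L (a y, 0).
  rewrite -cy0; apply: (total_hol_atP _).2 => //.
    by apply: hol_at_comp hPsi' _; apply: hol_at_cinv => //; exact: yc.
  by rewrite (chartK zc) Psi'0.
pose g (s : C) := Psi (escale s e).
have hg : hol_at g 0 by apply: hol_at_comp hPsi _; exact: escale_hol0.
have g0 : g 0 = zsec E' y by rewrite /g escale0 Psi0.
have g0c : cdom c (g 0) by rewrite g0; exact: yc.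
have [ng dg] := hg c cE g0c.
have cg0 : (c \o g) 0 = (a y, 0) by rewrite /= g0 -cy0.
pose D := 'D_1 (c \o g) 0.
have chain : 'D_1 (L \o (c \o g)) 0 = 'd L (a y, 0) D.
  by rewrite derive_comp1 ?cg0.
(* As [Psi'] inverts [Psi], this composite reads off the coordinate of s e, which is linear in s.
   Its derivative is thus the coordinate of e, and the chain rule expresses the same derivative
   through [D]. *)
have Lg : \forall s \near 0, (L \o (c \o g)) s = s *: fcoord t e.
  apply: filterS ng => s gs; rewrite /= /L (chartK gs) /g PsiK.
  by rewrite /fcoord /= linearZ.
have lhs : 'D_1 (L \o (c \o g)) 0 = fcoord t e.
  rewrite (near_eq_derive (1 : C) Lg); last exact: differentiableZl.
  rewrite -[RHS]scale1r.
  by apply: derive_val; apply: approx_derive => eps e0; exists 1 => // s _;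
    rewrite add0r scale0r subr0 scale1r subrr normr0 mulr_ge0// ltW.
have Dpair : D = (D.1, D.2) by exact: surjective_pairing.
have dsnd : D.2 = fcoord t' (Phi e).
  rewrite PhiE// -[RHS](_ : 'D_1 (fun s => ((c \o g) s).2) 0 = _)//.
  rewrite -(derive_linear_comp (l := snd) _ dg)//.
  by move=> q; exact: cvg_snd.
rewrite -[RHS]lhs chain Dpair (total_diff_pair _ _ dL).
have L0 : (fun s : C => L (a y + s *: D.1, 0)) = cst 0.
  apply/funext => s; rewrite /L -[cinv c _]/(fincl t' (cinv a (a y + s *: D.1)) 0).
  by rewrite fincl0 Psi'0 /fcoord /= linear0.
have DL0 : 'D_1 (fun s : C => L (a y + s *: D.1, 0)) 0 = 0.
  by rewrite L0; apply: derive_val; exact: is_derive_cst.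
have xk : tdom t (k (tag (Phi e))) by rewrite tPhi hK.
rewrite DL0 add0r (Phi'E _ _ tE xk).
suff -> : (fun s : C => L (a y, 0 + s *: D.2)) =
  (fun s => fcoord t (Psi' (escale s (Phi e)))) by [].
apply/funext => s; rewrite /L add0r dsnd; congr (fcoord t (Psi' _)).
have cs : c (escale s (Phi e)) = (a y, s *: fcoord t' (Phi e)).
  have -> : a y = a (tag (Phi e)) by rewrite tPhi.
  by rewrite -[LHS]/(a (tag (Phi e)), fcoord t' (escale s (Phi e))) /fcoord /= linearZ.
have sc : cdom c (escale s (Phi e)).
  by rewrite -[cdom c _]/(cdom a (tag (Phi e)) /\ tdom t' (tag (Phi e))) tPhi.
by rewrite -cs (chartK sc).
Qed.

End FiberDerivative.

Theorem theorem1p5 (R : realType) (tau tau' : Cx R)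
    (tau_gt0 : 0 < complex.Im tau) (tau'_gt0 : 0 < complex.Im tau')
    (E : bundle (elliptic_curve tau_gt0) 2)
    (E' : bundle (elliptic_curve tau'_gt0) 2)
    (degE : has_degree E 0) (degE' : has_degree E' 0)
    (XY : biholomorphic (total_space E) (total_space E')) :
  biholomorphic (elliptic_curve tau_gt0) (elliptic_curve tau'_gt0) /\
  bundle_isomorphic E E'.
Proof.
case: XY => Phi0 [hPhi0 [Phi0' [Phi0K Phi0'K hPhi0']]].
have [k [hk hK kK]] := base_isomorphism hPhi0 hPhi0' Phi0K Phi0'K.
set h := fun x => bproj _ in hK kK.
have hh : holomorphic h by exact: bproj_zsec_hol.
have bh : biholomorphism h by split=> //; exists k.
split; first by exists h.
have [Psi [Psi' [[hPsi hPsi'] PsiK Psi'K Psi0 Psi'0]]] :=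
  recenter hPhi0 hPhi0' Phi0K Phi0'K hk hK kK.
have [F [FE hF]] := fiber_derivative hPsi hh Psi0.
have [F' [F'E hF']] := fiber_derivative hPsi' hk Psi'0.
set Phi := fun e : total_space E => _ in FE hF.
set Phi' := fun e : total_space E' => _ in F'E hF'.
exists h, F, Phi; split=> //; split=> //; exists Phi'; split=> //.
  exact: (fiber_derivative_cancel (h := h) (k := k) hPsi hPsi' PsiK hK Psi0 Psi'0).
exact: (fiber_derivative_cancel (h := k) (k := h) hPsi' hPsi Psi'K kK Psi'0 Psi0).
Qed.
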